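(* Let $V$ be a strongly rational vertex operator algebra such that every irreducible $V$-module $W'$ has a finite-dimensional graded subspace $U\subseteq W'$ with $W'=U\oplus C_2(W')$ and $U\subseteq\sum_{i\in\Lambda}\mathcal U(\mathrm{Vir}_\omega).v^i$, each $v^i\in W'$ a $\mathrm{Vir}_\omega$ highest-weight vector. Let $W$ be an irreducible $V$-module with conformal weight $h_W\in\mathbb Z$, and let $\tau\in\mathbb H$. Then the monodromy representation $\rho_{\nabla^{\mathscr M_{1,1}}}:\mathrm{SL}(2,\mathbb Z)\to\mathrm{GL}(\mathscr C(E_\tau,\mathsf p,z,W))$ of $\pi_1(\mathscr M_{1,1})\cong\mathrm{SL}(2,\mathbb Z)$ on the fiber at $[\tau]$ of the bundle with flat connection $(\mathscr C(W)|_{\mathscr M_{1,1}},\nabla^{\mathscr M_{1,1}})$ is equivalent to the representation $\tilde\rho_\tau:\mathrm{SL}(2,\mathbb Z)\to\mathrm{GL}(\mathscr C(E_\tau,\mathsf p,z,W))$ defined by trace functions associated to intertwining operators and their modular invariance.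
   Context: VOAs. $V=(V,Y,\mathbf 1,\omega)$, $V=\bigoplus_{n\ge0}V_n$, $\dim V_n<\infty$, usual axioms; $Y(a,z)=\sum a_{(n)}z^{-n-1}$, $Y(\omega,z)=\sum L(n)z^{-n-2}$, central charge $c$ (elsewhere $c$ is a matrix entry). An admissible module is $M=\bigoplus_{n\in\mathbb N}M(n)$ with $a_{(m)}M(n)\subseteq M(\mathrm{wt}\,a-m-1+n)$; conformal weight $h_M$: $L(0)$ semisimple, $M(n)$ the eigenspace for $h_M+n$; $M'=\bigoplus M(n)^*$. Strongly rational: simple, $V_0=\mathbb C\mathbf1$, rational (admissible modules are direct sums of simple ones), $C_2$-cofinite ($\dim V/\mathrm{span}\{a_{(-2)}b\}<\infty$), $V\cong V'$, and $V$ is a sum of Virasoro highest-weight modules. $C_2(W)=\mathrm{span}\{a_{(-2)}v\}$. $M^0=V,\dots,M^N$ are the irreducible modules. Intertwining operators and trace functions. $I\binom{M}{W\;M}$: linear maps $I(\cdot,w):W\to\mathrm{End}(M)[[w^{\pm1}]]w^{-h_W}$, $I(v,w)=\sum v_{(n)}w^{-n-1-h_W}$, with truncation, $L(-1)$-derivative property and Jacobi identity. For $v\in W(n)$, $\deg v=n$, $o_I(v)=v_{(\deg v-1)}$ (extended linearly). $\langle\varphi_I(\tau)|v\rangle=\sum_{n\ge0}\mathrm{tr}|_{M(n)}o_I(v)q^{n+h_M-c/24}$, $q=e^{2\pi i\tau}$. Conformal blocks. $Y_W[a,z]=Y_W(a,e^{2\pi iz}-1)e^{2\pi iz\,\mathrm{wt}\,a}=\sum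 a[n]z^{-n-1}$, $\tilde\omega=(2\pi i)^2(\omega-\frac c{24}\mathbf1)$, $L[n]=\tilde\omega[n+1]$; $L[0]$ is semisimple on $W$ with eigenvalues in $h_W+\mathbb N\subseteq\mathbb Z$. $G_{2k}(\tau)=2\zeta(2k)+\frac{2(2\pi i)^{2k}}{(2k-1)!}\sum_{n\ge1}\sigma_{2k-1}(n)q^n$. $\mathscr C(E_\tau,\mathsf p,z,W)$ ($E_\tau=\mathbb C/(\mathbb Z+\mathbb Z\tau)$, $\mathsf p=[0]$, $z$ the coordinate from $\mathbb C$) is the space of functionals on $W$ vanishing on all $a[0]v$ and $a[-m]v+(-1)^m\sum_{k\ge1}\binom{2k-1}{m-1}G_{2k}(\tau)a[2k-m]v$, $a\in V$, $v\in W$, $m\ge2$. $\mathscr C_{\mathbb H}(W)=\pi^*(\mathscr C(W)|_{\mathscr M_{1,1}})$ is the finite-rank holomorphic bundle on $\mathbb H$ with fibers $\mathscr C(E_\tau,\mathsf p,z,W)$, where $\pi:\mathbb H\to\mathscr M_{1,1}=[\mathrm{SL}(2,\mathbb Z)\backslash\!\backslash\mathbb H]$ and $\mathscr C(W)$ is the conformal block bundle; its sections are maps $\varphi$ with $\varphi(\tau)\in\mathscr C(E_\tau,\mathsf p,z,W)$ and $\langle\varphi(\cdot)|v\rangle$ holomorphic for all $v\in W$. The representation $\tilde\rho_\tau$. Let $C_W\subseteq\Gamma(\mathbb H,\mathscr C_{\mathbb H}(W))$ be the span of all $\varphi_I$, $I\in I\binom{M^k}{W\;M^k}$, $0\le k\le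 N$. For $\gamma=\begin{pmatrix}a&b\\c&d\end{pmatrix}\in\mathrm{SL}(2,\mathbb Z)$ put $\langle(\gamma^{-1}.\varphi)(\tau)|v\rangle=\langle\varphi(\gamma\tau)|(c\tau+d)^{-L[0]}v\rangle$. This preserves $C_W$ and, since $h_W\in\mathbb Z$, gives a representation $\tilde\rho(g)\varphi=g.\varphi$ on $C_W$. Evaluation $\mathrm{ev}_\tau:C_W\to\mathscr C(E_\tau,\mathsf p,z,W)$, $\varphi\mapsto\varphi(\tau)$, is an isomorphism, and $\tilde\rho_\tau(g)=\mathrm{ev}_\tau\circ\tilde\rho(g)\circ\mathrm{ev}_\tau^{-1}$. The connections. $\nabla$ on $\mathscr C_{\mathbb H}(W)$ is the flat connection with, for $\xi=\frac1{2\pi i}\frac d{d\tau}$, $\langle\nabla_\xi\varphi(\tau)|v\rangle=\xi\langle\varphi(\tau)|v\rangle-\frac1{(2\pi i)^2}\langle\varphi(\tau)|(L[-2]-\sum_{k\ge1}G_{2k}(\tau)L[2k-2])v\rangle$. The maps $\Phi_\gamma(\tau):\mathscr C_{\mathbb H}(W)_{\gamma\tau}\to\mathscr C_{\mathbb H}(W)_\tau$, $\langle\Phi_\gamma(\tau)(\psi)|v\rangle=\langle\psi|(c\tau+d)^{-L[0]}v\rangle$, form an $\mathrm{SL}(2,\mathbb Z)$-equivariant structure. Sections $s$ of $\mathscr C(W)|_{\mathscr M_{1,1}}$ over $U$ correspond to sections $\tilde s$ of $\mathscr C_{\mathbb H}(W)$ over $\pi^{-1}(U)$ with $\gamma^{-1}.\tilde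 s=\tilde s$ for all $\gamma$. $\nabla^{\mathscr M_{1,1}}$ is the descended flat connection: for a vector field $A$ on $U$ with invariant pullback $\tilde A$, the section $\nabla^{\mathscr M_{1,1}}_As$ corresponds to $\nabla_{\tilde A}\tilde s$. Monodromy. The isomorphism $\pi_1(\mathscr M_{1,1},[\tau])\cong\mathrm{SL}(2,\mathbb Z)$ sends a loop $\eta$ whose lift $\tilde\eta$ to $\mathbb H$ starting at $\tau$ ends at $\gamma\tau$ to $\gamma^{-1}$. $\rho_{\nabla^{\mathscr M_{1,1}}}(\gamma^{-1})=P_\eta$ is the $\nabla^{\mathscr M_{1,1}}$-parallel transport along $\eta$ on the fiber $\mathscr C(E_\tau,\mathsf p,z,W)$ at $[\tau]$, that is, $P_\eta=\Phi_\gamma(\tau)\circ P_{\tilde\eta}$ with $P_{\tilde\eta}$ the $\nabla$-parallel transport along $\tilde\eta$. *)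

(* Defs.v *)
From HB Require Import structures.
From mathcomp Require Import all_boot all_order all_algebra.
From mathcomp Require Import all_classical all_reals all_analysis.
From mathcomp Require Import complex ring.
Set Implicit Arguments. Unset Strict Implicit. Unset Printing Implicit Defensive.
Import Order.TTheory GRing.Theory Num.Theory.
Import numFieldNormedType.Exports.
Local Open Scope classical_set_scope.
Local Open Scope ring_scope.
Local Open Scope complex_scope.

(* The normed space structure of R[i] over itself, so that limits and complex
   derivatives make sense in R[i]. *)
HB.instance Definition _ (R : realType) := GRing.ComAlgebra.copy R[i] R[i]^o.
HB.instance Definition _ (R : realType) := Vector.copy R[i] R[i]^o.
HB.instance Definition _ (R : realType) := NormedModule.copy R[i] R[i]^o.

Section LinearAlgebra.
Context {R : realType}.
Local Notation C := R[i].
Implicit Types E : lmodType C.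

Definition subspace E (S : set E) : Prop :=
  S 0 /\ forall (a : C) x y, S x -> S y -> S (a *: x + y).

Definition span E (S : set E) : set E :=
  [set x | forall T : set E, subspace T -> S `<=` T -> T x].

Definition finite_dim E (S : set E) : Prop :=
  exists s : seq E, S = span [set x | x \in s].

Definition is_basis E (S : set E) d (b : 'I_d -> E) : Prop :=
  S = [set x | exists c : 'I_d -> C, x = \sum_i c i *: b i] /\
  forall c : 'I_d -> C, \sum_i c i *: b i = 0 -> forall i, c i = 0.

(* The trace of f on an f-stable finite-dimensional subspace S (the value is
   independent of the basis); 0 if there is no such trace. *)
Definition trace_on E (S : set E) (f : E -> E) : C :=
  xget 0 [set t | exists d (b : 'I_d -> E) (A : 'M[C]_d),
    [/\ is_basis S b, forall j, f (b j) = \sum_i A i j *: b i & t = \tr A]].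

(* A direct sum decomposition of E indexed by nat, given by its projections. *)
Record grading E := Grading {
  gproj : nat -> E -> E;
  gproj_linear : forall n, linear (gproj n);
  gprojK : forall m n x, gproj m (gproj n x) = if m == n then gproj n x else 0;
  gproj_sum : forall x, exists N, x = \sum_(n < N) gproj n x
}.

Definition gpiece E (G : grading E) (n : nat) : set E :=
  [set x | gproj G n x = x].

Definition gpiecez E (G : grading E) (d : int) : set E :=
  if d is Posz n then gpiece G n else [set 0].

Definition graded E (G : grading E) (S : set E) : Prop :=
  forall n x, S x -> S (gproj G n x).

End LinearAlgebra.

Section VertexOperatorAlgebras.
Context {R : realType}.
Local Notation C := R[i].

Definition binz (m : int) (j : nat) : C :=
  (\prod_(i < j) (m - i%:Z)%:~R) / j`!%:R.

Definition bilinear_modes (A E : lmodType C) (Y : A -> int -> E -> E) : Prop :=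
  (forall n u, linear (fun a => Y a n u)) /\ (forall a n, linear (Y a n)).

Definition truncated (A E : lmodType C) (Y : A -> int -> E -> E) : Prop :=
  forall a u, exists N : int, forall n, N <= n -> Y a n u = 0.

(* The Jacobi identity in component form (Borcherds identity).  The sums have
   finite support for truncated modes. *)
Definition jacobi (A W M : lmodType C) (YW : A -> int -> W -> W)
    (YM : A -> int -> M -> M) (I : W -> int -> M -> M) : Prop :=
  forall (a : A) (v : W) (u : M) (m n k : int),
    \sum_(j \in [set: nat]) binz m j *: I (YW a (n + j%:Z) v) (m + k - j%:Z) u
    = \sum_(j \in [set: nat]) ((-1) ^+ j * binz n j) *:
        (YM a (m + n - j%:Z) (I v (k + j%:Z) u)
         - (-1 : C) ^ n *: I v (n + k - j%:Z) (YM a (m + j%:Z) u)).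

(* Modes are written vmode a n b for the paper's a_(n) b. *)
Record VOA := MkVOA {
  vspace :> lmodType C;
  vgrading : grading vspace;
  vmode : vspace -> int -> vspace -> vspace;
  vacuum : vspace;
  omega : vspace;
  central_charge : C;
  vmode_bilinear : bilinear_modes vmode;
  vmode_truncated : truncated vmode;
  vmode_jacobi : jacobi vmode vmode vmode;
  vacuum_mode : forall n b, vmode vacuum n b = if n == -1 then b else 0;
  vmode_creation : forall a, vmode a (-1) vacuum = a /\
    forall n : nat, vmode a n%:Z vacuum = 0;
  virasoro : forall (m n : int) b,
    vmode omega (m + 1) (vmode omega (n + 1) b)
    - vmode omega (n + 1) (vmode omega (m + 1) b)
    = (m - n)%:~R *: vmode omega (m + n + 1) b
      + (if m + n == 0 then (m ^+ 3 - m)%:~R / 12%:R * central_charge else 0)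
        *: b;
  translation : forall a n b,
    vmode (vmode omega 0 a) n b = - n%:~R *: vmode a (n - 1) b;
  vweight : forall n b, gpiece vgrading n b -> vmode omega 1 b = n%:R *: b;
  vacuum_weight : gpiece vgrading 0 vacuum;
  omega_weight : gpiece vgrading 2 omega;
  vgrading_finite : forall n, finite_dim (gpiece vgrading n);
  vmode_degree : forall k n m a b,
    gpiece vgrading k a -> gpiece vgrading n b ->
    gpiecez vgrading (k%:Z - m - 1 + n%:Z) (vmode a m b)
}.

Record admissible_module (V : VOA) := MkModule {
  mspace :> lmodType C;
  mgrading : grading mspace;
  mmode : V -> int -> mspace -> mspace;
  mmode_bilinear : bilinear_modes mmode;
  mmode_truncated : truncated mmode;
  mmode_vacuum : forall n u, mmode (vacuum V) n u = if n == -1 then u else 0;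
  mmode_jacobi : jacobi (@vmode V) mmode mmode;
  mmode_degree : forall k n m a u,
    gpiece (vgrading V) k a -> gpiece mgrading n u ->
    gpiecez mgrading (k%:Z - m - 1 + n%:Z) (mmode a m u)
}.

Definition adjoint (V : VOA) : admissible_module V :=
  MkModule (@vmode_bilinear V) (@vmode_truncated V) (@vacuum_mode V)
    (@vmode_jacobi V) (@vmode_degree V).

Section Modules.
Variable V : VOA.
Implicit Types M : admissible_module V.

Definition submodule M (S : set M) : Prop :=
  [/\ subspace S, graded (mgrading M) S
    & forall a n u, S u -> S (mmode a n u)].

Definition simple_submodule M (S : set M) : Prop :=
  [/\ submodule S, S != [set 0]
    & forall T, submodule T -> T `<=` S -> T = [set 0] \/ T = S].

Definition irreducible M : Prop := simple_submodule (M := M) setT.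

Definition virL M (n : int) (u : M) : M := mmode (omega V) (n + 1) u.

Definition conformal_weight M (h : C) : Prop :=
  gpiece (mgrading M) 0 != [set 0] /\
  forall n u, gpiece (mgrading M) n u <-> virL 0 u = (h + n%:R) *: u.

Definition C2 M : set M := span [set x | exists a v, x = mmode a (-2) v].

Definition vir_hw_vector M (u : M) : Prop :=
  (exists h : C, virL 0 u = h *: u) /\
  forall n : int, 0 < n -> virL n u = 0.

(* U(Vir) . S *)
Definition vir_generated M (S : set M) : set M :=
  [set x | forall T : set M, subspace T ->
    (forall n u, T u -> T (virL n u)) -> S `<=` T -> T x].

(* The contragredient module M': the graded dual, with Y'(a,z) the transpose of
   Y(e^{z L(1)} (-z^{-2})^{L(0)} a, z^{-1}).  For a of weight k, expanding in z
   gives the mode a'_(n) = (-1)^k sum_j 1/j! (L(1)^j a)_(2k - n - j - 2)^T. *)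
Definition graded_dual M : set (M -> C) :=
  [set f | (forall (a : C) x y, f (a *: x + y) = a * f x + f y) /\
    exists N, forall n u, (N <= n)%N -> gpiece (mgrading M) n u -> f u = 0].

Definition contragredient_mode M (a : V) (n : int) (f : M -> C) : M -> C :=
  fun u => \sum_(k \in [set: nat]) (-1) ^+ k *
    \sum_(j \in [set: nat]) (j`!%:R)^-1 *
      f (mmode (iter j (vmode (omega V) 2) (gproj (vgrading V) k a))
           ((2 * k)%N%:Z - n - j%:Z - 2) u).

Definition rational : Prop :=
  forall M, exists F : set (set M),
    [/\ forall S, F S -> simple_submodule S,
        span (\bigcup_(S in F) S) = setT
      & forall S, F S -> S `&` span (\bigcup_(T in F `\ S) T) = [set 0]].

Definition C2_cofinite : Prop :=
  exists s : seq V, span ([set x | x \in s] `|` C2 (M := adjoint V)) = setT.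

Definition self_contragredient : Prop :=
  exists theta : V -> V -> C,
    [/\ forall (a : C) x y, theta (a *: x + y) = a *: theta x + theta y,
        injective theta,
        range theta = graded_dual (M := adjoint V)
      & forall a n b,
          theta (vmode a n b)
          = contragredient_mode (M := adjoint V) a n (theta b)].

Definition strongly_rational : Prop :=
  irreducible (adjoint V) /\
  gpiece (vgrading V) 0 = [set c *: vacuum V | c in [set: C]] /\
  rational /\
  C2_cofinite /\
  self_contragredient /\
  vir_generated [set u | vir_hw_vector (M := adjoint V) u] = setT.

Definition vir_C2_complement M : Prop :=
  exists U : set M,
    [/\ subspace U, finite_dim U, graded (mgrading M) U,
        U `&` C2 (M := M) = [set 0]
      & (forall x, exists u y, [/\ U u, C2 y & x = u + y]) /\
        exists Lambda : set M,
          (forall u, Lambda u -> vir_hw_vector u) /\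
          U `<=` vir_generated Lambda].

End Modules.
End VertexOperatorAlgebras.

Arguments VOA : clear implicits.

Section UpperHalfPlane.
Variable R : realType.
Local Notation C := R[i].

Definition upper := {z : C | 0 < complex.Im z}.

Definition SL2Z := {A : 'M[int]_2 | \det A == 1}.

HB.instance Definition _ := Choice.on SL2Z.

Lemma SL2Z_one_subproof : \det (1%:M : 'M[int]_2) == 1.
Proof. by rewrite det1. Qed.
Lemma SL2Z_mul_subproof (A B : SL2Z) : \det (val A *m val B) == 1.
Proof. by rewrite det_mulmx (eqP (valP A)) (eqP (valP B)) mulr1. Qed.
Lemma SL2Z_inv_subproof (A : SL2Z) : \det (\adj (val A)) == 1.
Proof.
have := congr1 (fun B => \det B) (mul_adj_mx (val A)).
by rewrite det_mulmx (eqP (valP A)) mulr1 det1 => ->.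
Qed.

Definition SL2Z_one : SL2Z := exist _ 1%:M SL2Z_one_subproof.
Definition SL2Z_mul (A B : SL2Z) : SL2Z := exist _ (val A *m val B) (SL2Z_mul_subproof A B).
Definition SL2Z_inv (A : SL2Z) : SL2Z := exist _ (\adj (val A)) (SL2Z_inv_subproof A).

Lemma SL2Z_mulA : associative SL2Z_mul.
Proof. by move=> A B D; apply: val_inj; rewrite /= mulmxA. Qed.
Lemma SL2Z_mul1 : left_id SL2Z_one SL2Z_mul.
Proof. by move=> A; apply: val_inj; rewrite /= mul1mx. Qed.
Lemma SL2Z_mulr1 : right_id SL2Z_one SL2Z_mul.
Proof. by move=> A; apply: val_inj; rewrite /= mulmx1. Qed.
Lemma SL2Z_mulV : left_inverse SL2Z_one SL2Z_inv SL2Z_mul.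
Proof.
by move=> A; apply: val_inj; rewrite /= mul_adj_mx (eqP (valP A)).
Qed.
Lemma SL2Z_mulrV : right_inverse SL2Z_one SL2Z_inv SL2Z_mul.
Proof.
by move=> A; apply: val_inj; rewrite /= mul_mx_adj (eqP (valP A)).
Qed.

HB.instance Definition _ := isGroup.Build SL2Z
  SL2Z_mulA SL2Z_mul1 SL2Z_mulr1 SL2Z_mulV SL2Z_mulrV.

Definition automorphy (g : SL2Z) (tau : upper) : C :=
  (val g 1 0)%:~R * val tau + (val g 1 1)%:~R.

Definition moebius_fun (g : SL2Z) (tau : upper) : C :=
  ((val g 0 0)%:~R * val tau + (val g 0 1)%:~R) / automorphy g tau.

Lemma moebius_subproof (g : SL2Z) (tau : upper) :
  0 < complex.Im (moebius_fun g tau).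
Proof.
rewrite /moebius_fun /automorphy.
case: g tau => [A /= /eqP detA] [[x y] /= y0].
have {}detA : (A 0 0)%:~R * (A 1 1)%:~R - (A 0 1)%:~R * (A 1 0)%:~R = 1 :> R.
  move: detA; rewrite (expand_det_row _ ord0) big_ord_recl big_ord1.
  rewrite /cofactor !det_mx11 !mxE /= expr0 mul1r expr1 mulN1r mulrN.
  rewrite -!rmorphM -rmorphB.
  have -> : lift ord0 0 = 1 :> 'I_2 by apply: val_inj.
  have -> : lift 1 0 = 0 :> 'I_2 by apply: val_inj.
  by move=> ->.
have intC (n : int) : n%:~R = (n%:~R)%:C :> C by rewrite rmorph_int.
rewrite !intC.
move: (A 0 0)%:~R (A 0 1)%:~R (A 1 0)%:~R (A 1 1)%:~R detA => a b c d detA.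
have N_gt0 : 0 < (c * x + d) ^+ 2 + (c * y) ^+ 2.
  rewrite lt_neqAle addr_ge0 ?sqr_ge0// andbT eq_sym paddr_eq0 ?sqr_ge0//.
  rewrite !sqrf_eq0 mulf_eq0 (gt_eqF y0) orbF.
  apply/negP => /andP[+ /eqP c0]; rewrite c0 mul0r add0r => /eqP d0.
  by move: detA; rewrite c0 d0 !mulr0 subrr => /esym/eqP; rewrite oner_eq0.
have -> : complex.Im ((a%:C * (x +i* y) + b%:C) / (c%:C * (x +i* y) + d%:C))
    = y / ((c * x + d) ^+ 2 + (c * y) ^+ 2).
  rewrite [in LHS]/GRing.inv /= !mul0r !subr0 !addr0.
  rewrite mulrN !mulrA -mulNr -mulrDl; congr (_ / _).
  by rewrite -[RHS]mul1r -detA; ring.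
exact: divr_gt0.
Qed.

Definition moebius (g : SL2Z) (tau : upper) : upper :=
  exist _ (moebius_fun g tau) (moebius_subproof g tau).

End UpperHalfPlane.

Section ModularFunctions.
Context {R : realType}.
Local Notation C := R[i].

Definition cexp (z : C) : C :=
  (expR (complex.Re z) * cos (complex.Im z))
  +i* (expR (complex.Re z) * sin (complex.Im z)).

Definition twopii : C := 0 +i* (2 * pi).

(* q^s with q = e^{2 pi i tau} *)
Definition qpow (tau : upper R) (s : C) : C := cexp (twopii * val tau * s).

Definition zeta (s : nat) : C :=
  (limn (series (fun n => (n.+1%:R : R) ^- s)))%:C.

Definition sigma (p n : nat) : nat := (\sum_(d <- divisors n) d ^ p)%N.

(* G_{2k}(tau), for k >= 1 *)
Definition eisenstein (k : nat) (tau : upper R) : C :=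
  2 * zeta (2 * k)%N
  + 2 * twopii ^+ (2 * k)%N / ((2 * k - 1)`!)%N%:R
    * limn (series (fun n =>
        (sigma (2 * k - 1)%N n.+1)%:R * qpow tau n.+1%:R)).

Definition extend_upper (f : upper R -> C) (z : C) : C :=
  if insub z is Some tau then f tau else 0.

Definition holomorphic_upper (f : upper R -> C) : Prop :=
  forall tau : upper R, derivable (extend_upper f) (val tau) 1.

Definition curve_derivative (f : R -> C) (t : R) (l : C) : Prop :=
  is_derive t (1 : R) (fun u => complex.Re (f u)) (complex.Re l) /\
  is_derive t (1 : R) (fun u => complex.Im (f u)) (complex.Im l).

(* The coefficient of x^j in ((e^x - 1) / x)^p, by the binomial series in
   (e^x - 1) / x - 1, whose i-th power has order at least i. *)
Definition expm1_coef (p : int) (j : nat) : C :=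
  \sum_(i < j.+1) binz p i *
    ((\poly_(l < j.+1) (if l == 0%N then 0 else (l.+1)`!%:R^-1 : C)) ^+ i)`_j.

(* The coefficient of x^(p + j) in (e^x - 1)^p e^(k x) *)
Definition laurent_coef (p : int) (k j : nat) : C :=
  \sum_(r < j.+1) expm1_coef p (j - r)%N * (k%:R ^+ r / r`!%:R).

End ModularFunctions.

Section ConformalBlocks.
Context {R : realType} {V : VOA R} (W : admissible_module V).
Local Notation C := R[i].

(* a[n]: for a of weight k, the coefficient of z^(-n-1) in
   sum_m a_(m) (e^{2 pi i z} - 1)^(-m-1) e^{2 pi i z k}, where m = n + j. *)
Definition sqmode (a : V) (n : int) (v : W) : W :=
  twopii ^ (- n - 1) *: \sum_(k \in [set: nat]) \sum_(j \in [set: nat])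
    laurent_coef (- n - j%:Z - 1) k j
      *: mmode (gproj (vgrading V) k a) (n + j%:Z) v.

Definition omega_tilde : V :=
  twopii ^+ 2 *: (omega V - (central_charge V / 24%:R) *: vacuum V).

Definition sqL (n : int) (v : W) : W := sqmode omega_tilde (n + 1) v.

(* x^{-L[0]} v, computed by decomposing v into L[0]-eigenvectors with integral
   eigenvalues; the value does not depend on the decomposition. *)
Definition sqL0_pow (x : C) (v : W) : W :=
  xget 0 [set y | exists n (u : 'I_n -> W) (m : 'I_n -> int),
    [/\ forall i, sqL 0 (u i) = (m i)%:~R *: u i,
        v = \sum_i u i & y = \sum_i x ^ (- m i) *: u i]].

Definition conformal_block (tau : upper R) (psi : W -> C) : Prop :=
  [/\ forall (a : C) x y, psi (a *: x + y) = a * psi x + psi y,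
      forall a v, psi (sqmode a 0 v) = 0
    & forall a v (m : nat), (2 <= m)%N ->
        psi (sqmode a (- m%:Z) v
             + (-1) ^+ m *: \sum_(k \in [set k : nat | (1 <= k)%N])
                 ('C((2 * k - 1)%N, (m - 1)%N)%:R * eisenstein k tau)
                   *: sqmode a ((2 * k)%N%:Z - m%:Z) v) = 0].

Definition conformal_block_pred (tau : upper R) : {pred W -> C} :=
  fun psi => `[< conformal_block tau psi >].

Lemma conformal_block_closed tau : submod_closed (conformal_block_pred tau).
Proof.
split; first by apply/asboolP; split => *; rewrite /GRing.zero /= ?mulr0 ?addr0.
move=> c f g /asboolP[f1 f2 f3] /asboolP[g1 g2 g3]; apply/asboolP.
have E u : (c *: f + g) u = c * f u + g u by [].
split=> [a x y|a v|a v m m2]; rewrite !E.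
- by rewrite f1 g1; ring.
- by rewrite f2 g2 mulr0 addr0.
- by rewrite f3// g3// mulr0 addr0.
Qed.

HB.instance Definition _ (tau : upper R) :=
  GRing.isSubmodClosed.Build _ _ (conformal_block_pred tau)
    (conformal_block_closed tau).

Record fiber (tau : upper R) := Fiber {
  fiber_val :> W -> C;
  _ : fiber_val \in conformal_block_pred tau
}.

HB.instance Definition _ tau := [isSub for @fiber_val tau].
HB.instance Definition _ tau := [Choice of fiber tau by <:].
HB.instance Definition _ tau := [SubChoice_isSubLmodule of fiber tau by <:].

Definition holomorphic_section (phi : upper R -> W -> C) : Prop :=
  (forall tau, conformal_block tau (phi tau)) /\
  forall v, holomorphic_upper (fun tau => phi tau v).

(* gamma^{-1}.phi, and g.phi *)
Definition slash (gamma : SL2Z) (phi : upper R -> W -> C) : upper R -> W -> C :=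
  fun tau v => phi (moebius gamma tau) (sqL0_pow (automorphy gamma tau) v).

Definition sl2_action (g : SL2Z) (phi : upper R -> W -> C) :
    upper R -> W -> C := slash (g^-1)%g phi.

(* I v n is the coefficient v_(n) of w^(-n-1-hW). *)
Definition intertwining_operator (hW : C) (M : admissible_module V)
    (I : W -> int -> M -> M) : Prop :=
  [/\ bilinear_modes I, truncated I,
      forall v n u, I (virL (-1) v) n u = - (n%:~R + hW) *: I v (n - 1) u
    & jacobi (@mmode _ _ W) (@mmode _ _ M) I].

Definition zero_mode (M : admissible_module V) (I : W -> int -> M -> M)
    (v : W) (u : M) : M :=
  \sum_(n \in [set: nat]) I (gproj (mgrading W) n v) (n%:Z - 1) u.

Definition trace_term (hM : C) (M : admissible_module V)
    (I : W -> int -> M -> M) (tau : upper R) (v : W) (n : nat) : C :=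
  trace_on (gpiece (mgrading M) n) (zero_mode I v)
  * qpow tau (n%:R + hM - central_charge V / 24%:R).

Definition trace_function (hM : C) (M : admissible_module V)
    (I : W -> int -> M -> M) : upper R -> W -> C :=
  fun tau v => limn (series (trace_term hM I tau v)).

(* The connection form of nabla_xi *)
Definition connection_op (tau : upper R) (v : W) : W :=
  twopii ^- 2 *: (sqL (-2) v
    - \sum_(k \in [set k : nat | (1 <= k)%N])
        eisenstein k tau *: sqL ((2 * k)%N%:Z - 2) v).

(* A continuously differentiable path eta in H with derivative deta.  Paths are
   parametrized by all of R, and their endpoints are eta 0 and eta 1: every C^1
   path on [0, 1] extends. *)
Definition C1_path (eta : R -> upper R) (deta : R -> C) : Prop :=
  (forall t, curve_derivative (fun u => val (eta u)) t (deta t)) /\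
  continuous deta.

(* s is a nabla-parallel section along eta: since d/dtau = 2 pi i xi, its
   covariant derivative pairs with v to
   d/dt <s(t)|v> - 2 pi i eta'(t) <s(t)|connection_op v>. *)
Definition parallel_along (eta : R -> upper R) (deta : R -> C)
    (s : R -> W -> C) : Prop :=
  (forall t, conformal_block (eta t) (s t)) /\
  forall t v, curve_derivative (fun u => s u v) t
    (twopii * deta t * s t (connection_op (eta t) v)).

(* Phi_gamma(tau) *)
Definition equivariance (gamma : SL2Z) (tau : upper R) (psi : W -> C) : W -> C :=
  fun v => psi (sqL0_pow (automorphy gamma tau) v).

End ConformalBlocks.

Section Representations.
Context {R : realType}.

Record SL2Z_rep (F : lmodType R[i]) := MkRep {
  rep_map :> SL2Z -> {linear F -> F};
  rep_one : forall x, rep_map 1%g x = x;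
  rep_mul : forall g h x, rep_map (g * h)%g x = rep_map g (rep_map h x)
}.

Definition equivalent_rep (F F' : lmodType R[i])
    (rho : SL2Z_rep F) (rho' : SL2Z_rep F') : Prop :=
  exists T : {linear F -> F'},
    bijective T /\ forall g x, T (rho g x) = rho' g (T x).

End Representations.

Section TwoRepresentations.
Context {R : realType} {V : VOA R} (W : admissible_module V) (hW : int).
Local Notation C := R[i].

Definition is_trace_function (phi : upper R -> W -> C) : Prop :=
  exists (M : admissible_module V) (hM : C) (I : W -> int -> M -> M),
    [/\ irreducible M, conformal_weight M hM,
        intertwining_operator hW%:~R I & phi = trace_function hM I].

Definition trace_space : set (upper R -> W -> C) :=
  span [set phi | is_trace_function phi].

(* rho is tilde rho_tau = ev_tau o tilde rho o ev_tau^{-1}; all clauses but the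
   last say that this formula makes sense. *)
Definition is_trace_representation (tau : upper R) (rho : SL2Z_rep (fiber W tau))
    : Prop :=
  [/\ (forall (M : admissible_module V) (hM : C) (I : W -> int -> M -> M),
        irreducible M -> conformal_weight M hM ->
        intertwining_operator hW%:~R I ->
        forall tau' v, cvgn (series (trace_term hM I tau' v))),
      (forall phi, trace_space phi -> holomorphic_section phi),
      (forall g phi, trace_space phi -> trace_space (sl2_action g phi)),
      (forall phi, trace_space phi -> phi tau = 0 -> phi = 0) /\
      (forall psi : fiber W tau, exists2 phi, trace_space phi & phi tau = psi)
    & forall g phi (psi : fiber W tau), trace_space phi -> phi tau = psi ->
        fiber_val (rho g psi) = sl2_action g phi tau].

(* rho (gamma^{-1}) is Phi_gamma(tau) o P_eta for every path eta from tau to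
   gamma tau, P_eta being the nabla-parallel transport along eta.  The first
   clause is the existence of the transport; as Phi_gamma(tau) is injective, the
   second includes its uniqueness. *)
Definition is_monodromy_representation (tau : upper R)
    (rho : SL2Z_rep (fiber W tau)) : Prop :=
  forall (gamma : SL2Z) (eta : R -> upper R) (deta : R -> C),
    C1_path eta deta -> eta 0 = tau -> eta 1 = moebius gamma tau ->
    forall psi : fiber W tau,
      (exists s, parallel_along eta deta s /\ s 0 = psi) /\
      forall s, parallel_along eta deta s -> s 0 = psi ->
        fiber_val (rho (gamma^-1)%g psi) = equivariance gamma tau (s 1).

End TwoRepresentations.

(* Main.v *)
(** Trace functions are parallel sections: Zhu's recursion for the Virasoro vector
    expresses the derivative of the trace function of [v] along the upper half
    plane as its value on the connection form applied to [v].  Since evaluation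
    at [tau] is an isomorphism from the space of trace functions to the fiber,
    the parallel transport of [phi(tau)] along a path from [tau] to [gamma tau]
    is [phi(gamma tau)], and composing with the equivariance map gives the value
    at [tau] of [gamma^(-1).phi].  So the two representations coincide.

    Zhu's recursion: the commutator of [L(m)] with a mode of [v] does not depend
    on the mode up to degree, so cyclicity of the trace computes the trace of
    [L(-m) J_m], where [J_m] lowers degrees by [m], as a sum over the divisors
    of the degree; this gives the divisor sums of the Eisenstein series, and their
    constant terms come from [x / (e^x - 1)] through Euler's formula for
    [zeta(2k)].

    Parallel transport is unique because, modulo the conformal block relations,
    [W] is generated by finitely many vectors over functions bounded on half
    planes [Im tau >= y > 0]; a parallel section is thus determined by a solution
    of a finite linear differential system, to which Gronwall's inequality
    applies. *)

Require Import Defs.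
From HB Require Import structures.
From mathcomp Require Import all_boot all_order all_algebra.
From mathcomp Require Import all_classical all_reals all_analysis.
From mathcomp Require Import complex ring lra zify.
Set Implicit Arguments. Unset Strict Implicit. Unset Printing Implicit Defensive.
Import Order.TTheory GRing.Theory Num.Theory.
Import numFieldNormedType.Exports.
Local Open Scope classical_set_scope.
Local Open Scope ring_scope.
Local Open Scope complex_scope.

Local Notation subspace := Defs.subspace.
Local Notation span := Defs.span.

(** * Formal power series *)

(** Two preliminaries make the traces usable. Convergence is given only pointwise in tau; since |q|
    takes every value in ]0, 1[, it forces the coefficients of a trace function to form a series of
    radius at least 1, and the parallel equation becomes an identity of power series in q, checked
    coefficient by coefficient. That modes of intertwining operators shift degrees is derived from
    L(0)-eigenvalues, and that graded pieces are finite-dimensional from the complement of C_2;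
    cyclicity of traces needs both. The recursion is found with ordinary modes, in the coordinate w,
    while the connection uses z with w = e^(2 pi i z) - 1. For omega, of weight 2, two residue
    identities translate: the kernel (1 + w)^(m+1) dw becomes 2 pi i e^(2 pi i m z) dz, and (1 + w)
    w^(-1) dw becomes 2 pi i dz / (e^(2 pi i z) - 1). The first kernel, antisymmetrised in m, keeps
    only the odd powers of m, which add up to sigma_(2k-1) over divisors; the second has Bernoulli
    coefficients, which give the constant terms 2 zeta(2k). *)

Definition fps (K : comNzRingType) := nat -> K.

Section FormalPowerSeries.
Variable K : comNzRingType.
Implicit Types f g h : fps K.

HB.instance Definition _ := GRing.Zmodule.copy (fps K) (nat -> K).

Definition fps_one : fps K := fun n => (n == 0%N)%:R.
Definition fps_mul f g : fps K := fun n => \sum_(i < n.+1) f i * g (n - i)%N.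

Let trunc n f := \poly_(i < n.+1) f i.

Let truncE n m f : (m <= n)%N -> (trunc n f)`_m = f m.
Proof. by move=> mn; rewrite coef_poly ltnS mn. Qed.

(** Coefficients up to n only see truncations at n, so associativity and commutativity are inherited
    from polynomials. *)
Let fps_mul_trunc n f g m : (m <= n)%N ->
  fps_mul f g m = (trunc n f * trunc n g)`_m.
Proof.
move=> mn; rewrite coefM; apply: eq_bigr => i _.
by rewrite !truncE// (leq_trans _ mn)// ?leq_subr// -ltnS.
Qed.

Fact fps_mulA : associative fps_mul.
Proof.
move=> f g h; apply/funext => n.
transitivity ((trunc n f * (trunc n g * trunc n h))`_n).
  rewrite coefM; apply: eq_bigr => i _.
  by rewrite truncE ?(fps_mul_trunc (n := n)) ?leq_subr// -ltnS.
rewrite mulrA coefM; apply: eq_bigr => i _.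
by rewrite (fps_mul_trunc (n := n)) ?truncE ?leq_subr// -ltnS.
Qed.

Fact fps_mulC : commutative fps_mul.
Proof.
by move=> f g; apply/funext => n; rewrite !(fps_mul_trunc (n := n))// mulrC.
Qed.

Fact fps_mul1 : left_id fps_one fps_mul.
Proof.
move=> f; apply/funext => n; rewrite /fps_mul big_ord_recl mul1r subn0.
by rewrite big1 ?addr0// => i _; rewrite /fps_one mul0r.
Qed.

Fact fps_mulDl : left_distributive fps_mul +%R.
Proof.
move=> f g h; apply/funext => n.
transitivity (fps_mul f h n + fps_mul g h n) => //.
by rewrite /fps_mul -big_split; apply: eq_bigr => i _; apply: mulrDl.
Qed.

Fact fps_1neq0 : fps_one != 0 :> fps K.
Proof.
by apply/eqP => /(congr1 (fun f : fps K => f 0%N))/eqP; rewrite oner_eq0.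
Qed.

HB.instance Definition _ := GRing.Zmodule_isComNzRing.Build (fps K)
  fps_mulA fps_mulC fps_mul1 fps_mulDl fps_1neq0.

Lemma fpsM f g n : (f * g) n = \sum_(i < n.+1) f i * g (n - i)%N.
Proof. by []. Qed.

Lemma fps1 n : (1 : fps K) n = (n == 0%N)%:R. Proof. by []. Qed.

Lemma fpsD f g n : (f + g) n = f n + g n. Proof. by []. Qed.

Lemma fpsN f n : (- f) n = - f n. Proof. by []. Qed.

Lemma fps_sum I (r : seq I) (P : pred I) (F : I -> fps K) n :
  (\sum_(i <- r | P i) F i) n = \sum_(i <- r | P i) F i n.
Proof. by apply: (big_morph (fun f : fps K => f n)). Qed.

Lemma fps_ext f g : (forall n, f n = g n) -> f = g.
Proof. by move=> fg; apply/funext. Qed.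

Definition fpsC (a : K) : fps K := fun n => if n == 0%N then a else 0.

Lemma fpsCM a f n : (fpsC a * f) n = a * f n.
Proof.
rewrite fpsM big_ord_recl subn0 big1 ?addr0// => i _.
by rewrite /fpsC mul0r.
Qed.

Lemma fpsM_eq f f' g n : (forall m, (m <= n)%N -> f m = f' m) ->
  (f * g) n = (f' * g) n.
Proof.
by move=> ff'; rewrite !fpsM; apply: eq_bigr => i _; rewrite ff'// -ltnS.
Qed.

Lemma fpsM0 f g : (f * g) 0%N = f 0%N * g 0%N.
Proof. by rewrite fpsM big_ord1. Qed.

Definition fpsX : fps K := fun n => (n == 1%N)%:R.

Lemma fpsXM0 f : (fpsX * f) 0%N = 0. Proof. by rewrite fpsM0 mul0r. Qed.

Lemma fpsXM f n : (fpsX * f) n.+1 = f n.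
Proof.
rewrite fpsM big_ord_recl mul0r add0r big_ord_recl mul1r subn1/=.
by rewrite big1 ?addr0// => i _; rewrite mul0r.
Qed.

Lemma fps_order f i n : f 0%N = 0 -> (n < i)%N -> (f ^+ i) n = 0.
Proof.
move=> f0; elim: i n => // i IHi n ni; rewrite exprS fpsM.
apply: big1 => -[[|m] mn] _ /=; first by rewrite f0 mul0r.
by rewrite IHi ?mulr0//; lia.
Qed.

(** Identifies the truncated polynomials in the definition of [expm1_coef] with powers of a genuine
    series. *)
Lemma fps_trunc_expr f n i m : (m <= n)%N ->
  ((\poly_(l < n.+1) f l) ^+ i)`_m = (f ^+ i) m.
Proof.
elim: i m => [|i IHi] m mn; first by rewrite !expr0 coef1.
rewrite !exprS coefM fpsM; apply: eq_bigr => j _.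
by rewrite IHi ?truncE// ?(leq_trans _ mn)// ?leq_subr// -ltnS.
Qed.

(* The Euler operator [x d/dx]. *)
Definition fps_theta f : fps K := fun n => n%:R * f n.

Lemma fps_thetaM f g : fps_theta (f * g) = fps_theta f * g + f * fps_theta g.
Proof.
apply: fps_ext => n; rewrite fpsD /fps_theta !fpsM mulr_sumr -big_split /=.
apply: eq_bigr => i _.
have -> : n%:R = (i%:R + (n - i)%N%:R) :> K by rewrite -natrD subnKC// -ltnS.
by ring.
Qed.

Lemma fps_thetaD f g : fps_theta (f + g) = fps_theta f + fps_theta g.
Proof. by apply: fps_ext => n; rewrite /fps_theta !fpsD mulrDr. Qed.

Lemma fps_theta1 : fps_theta 1 = 0.
Proof.
by apply: fps_ext => -[|n]; rewrite /fps_theta ?mul0r// fps1 mulr0.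
Qed.

Lemma fps_thetaX : fps_theta fpsX = fpsX.
Proof.
apply: fps_ext => -[|[|n]]; rewrite /fps_theta /fpsX ?mul0r ?mul1r//.
by rewrite mulr0.
Qed.

End FormalPowerSeries.
Arguments fpsX {K}.

(** * The exponential series and the integral powers of (e^x - 1)/x *)

Section ExponentialSeries.
Variable R : realType.
Local Notation K := R[i].

Lemma char0C n : n.+1%:R != 0 :> K.
Proof. by rewrite pnatr_eq0. Qed.

Lemma factC_neq0 n : n`!%:R != 0 :> K.
Proof. by rewrite pnatr_eq0 -lt0n fact_gt0. Qed.

Definition fps_exp (a : K) : fps K := fun r => a ^+ r / r`!%:R.

Lemma fps_expD a b : fps_exp (a + b) = fps_exp a * fps_exp b.
Proof.
apply: fps_ext => n; rewrite fpsM /fps_exp addrC exprDn mulr_suml.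
apply: eq_bigr => i _.
have iN : (i <= n)%N by rewrite -ltnS.
have C0 : 'C(n, i)%:R != 0 :> K.
  have : (0 < 'C(n, i))%N by rewrite bin_gt0.
  by case: 'C(n, i) => // k _; apply: char0C.
rewrite -(bin_fact iN) -mulr_natr !natrM.
move: (factC_neq0 i) (factC_neq0 (n - i)) C0.
move: (i`!%:R) ((n - i)`!%:R) ('C(n, i)%:R) => x y z x0 y0 z0; field.
by rewrite x0 y0 z0.
Qed.

Lemma fps_exp0 : fps_exp 0 = 1.
Proof.
by apply: fps_ext => -[|n]; rewrite /fps_exp fps1 ?expr0n/= ?mul0r ?divr1.
Qed.

Lemma fps_theta_exp a : fps_theta (fps_exp a) = fpsC a * (fpsX * fps_exp a).
Proof.
apply: fps_ext => -[|n]; rewrite fpsCM /fps_theta ?mul0r ?fpsXM0 ?mulr0//.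
rewrite fpsXM /fps_exp exprS factS natrM.
move: (char0C n) (factC_neq0 n); move: (n.+1%:R) (n`!%:R) => x y x0 y0; field.
by rewrite x0 y0.
Qed.

End ExponentialSeries.

Section ExpPowers.
Variable R : realType.
Local Notation C := R[i].

Lemma binz0 (m : int) : binz m 0 = 1 :> C.
Proof. by rewrite /binz big_ord0 fact0 divr1. Qed.

Lemma binzS (m : int) j : binz (m + 1) j.+1 = binz m j.+1 + binz m j :> C.
Proof.
rewrite /binz [X in X / _ = _]big_ord_recl [X in _ = X / _ + _]big_ord_recr /=.
rewrite subr0 (eq_bigr (fun i : 'I_j => (m - i%:Z)%:~R : C)); last first.
  by move=> i _; congr (_%:~R); rewrite /bump /= add1n -[i.+1]addn1 PoszD; ring.
rewrite factS natrM !rmorphB !rmorphD /= -[j%:~R]/(j%:R).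
move: (\prod_(i < j) _) => P; field.
by rewrite factC_neq0 nat1r char0C.
Qed.

Lemma binz_small (n : nat) j : (n < j)%N -> binz n j = 0 :> C.
Proof.
move=> nj; rewrite /binz (bigD1 (Ordinal nj)) //= subrr.
by rewrite !mul0r.
Qed.

Lemma binz1 (m : int) : binz m 1 = m%:~R :> C.
Proof. by rewrite /binz big_ord1 divr1 subr0. Qed.

Lemma binzN1 j : binz (-1) j = (-1) ^+ j :> C.
Proof.
elim: j => [|j IHj]; first by rewrite binz0.
have := binzS (-1) j; rewrite addNr binz_small// IHj exprS => /eqP.
by rewrite eq_sym addr_eq0 mulN1r => /eqP.
Qed.

(* [((e^x - 1) / x)^p] *)
Definition expm1_pow (p : int) : fps C := fun j => expm1_coef p j.

Let u : fps C := fun l => if l == 0%N then 0 else l.+1`!%:R^-1.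

Let E p N : fps C := \sum_(i < N.+1) fpsC (binz p i) * u ^+ i.

(** With u = (e^x - 1)/x - 1, the power u^i has order at least i, so binomial terms with i > j do
    not reach degree j. One truncation N thus serves all coefficients up to N. *)
Let powE p N j : (j <= N)%N -> expm1_pow p j = E p N j.
Proof.
move=> jN; rewrite /E fps_sum /expm1_pow /expm1_coef.
rewrite (eq_bigr (fun i : 'I_j.+1 => binz p i * (u ^+ i) j)); last first.
  by move=> i _; rewrite -(fps_trunc_expr u i (leqnn j)).
rewrite (big_ord_widen N.+1 (fun i => binz p i * (u ^+ i) j))//= big_mkcond.
apply: eq_bigr => i _; rewrite fpsCM; case: ifPn => //.
by rewrite -leqNgt => /fps_order -> //; rewrite mulr0.
Qed.

Lemma expm1_pow1E j : expm1_pow 1 j = j.+1`!%:R^-1.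
Proof.
have -> : expm1_pow 1 j = (1 + u) j.
  rewrite (@powE 1 j.+1)// /E fps_sum 2!big_ord_recl /= !fpsCM expr0.
  rewrite binz0 mul1r binz1 mul1r expr1 big1 ?addr0// => i _.
  by rewrite fpsCM binz_small ?mul0r.
by rewrite fpsD fps1 /u; case: j => [|j] /=; rewrite ?addr0 ?fact0 ?invr1 ?add0r.
Qed.

Lemma expm1_pow0 : expm1_pow 0 = 1.
Proof.
apply: fps_ext => j; rewrite (@powE _ j)// /E fps_sum big_ord_recl fpsCM.
rewrite binz0 mul1r expr0 big1 ?addr0// => i _.
by rewrite fpsCM binz_small ?mul0r.
Qed.

Lemma expm1_powS p : expm1_pow (p + 1) = expm1_pow p * expm1_pow 1.
Proof.
have -> : expm1_pow 1 = 1 + u.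
  apply: fps_ext => j; rewrite expm1_pow1E fpsD fps1 /u.
  by case: j => [|j] /=; rewrite ?addr0 ?fact0 ?invr1 ?add0r.
apply: fps_ext => j; rewrite (@powE _ j)//.
rewrite (@fpsM_eq _ _ (E p j)) => [|m mj]; last by rewrite (@powE _ j).
rewrite mulrDr mulr1 fpsD {1 2}/E !fps_sum !big_ord_recl -addrA.
congr (_ + _); first by rewrite !fpsCM !binz0.
rewrite /E mulr_suml fps_sum big_ord_recr /=.
rewrite [X in _ = _ + (_ + X)](_ : _ = 0); last first.
  by rewrite -mulrA -exprSr fpsCM fps_order ?mulr0.
rewrite addr0 -big_split /=; apply: eq_bigr => i _.
rewrite -mulrA -exprSr !fpsCM /bump /= add1n -mulrDl -binzS.
by congr (binz _ _ * _); rewrite -addn1 PoszD.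
Qed.

Lemma fpsX_expm1_pow1 : fpsX * expm1_pow 1 = fps_exp 1 - 1 :> fps C.
Proof.
apply: fps_ext => -[|j]; rewrite fpsD fpsN fps1 /fps_exp expr1n mul1r.
  by rewrite fpsXM0 fact0 invr1 subrr.
by rewrite fpsXM expm1_pow1E subr0.
Qed.

Lemma expm1_powV : expm1_pow (-1) * expm1_pow 1 = 1.
Proof. by rewrite -expm1_powS addNr expm1_pow0. Qed.

Lemma expm1_pow_head p : expm1_pow p 0%N = 1.
Proof. by rewrite /expm1_pow /expm1_coef big_ord1 binz0 expr0 coef1 mul1r. Qed.

(** This is x d/dx (e^x - 1)^p = p x e^x (e^x - 1)^(p-1), divided by x^p. The identities for q and q
    + 1 are equivalent by the product rule, which allows induction in both directions from the
    trivial case 0. *)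
Lemma theta_expm1_pow p :
  fps_theta (expm1_pow p) + fpsC p%:~R * expm1_pow p
  = fpsC p%:~R * (expm1_pow (p - 1) * fps_exp 1).
Proof.
have ringhom : forall a b : C, fpsC (a + b) = fpsC a + fpsC b.
  by move=> a b; apply: fps_ext => -[|n]; rewrite fpsD /fpsC ?addr0.
have C1 : fpsC (1 : C) = 1 by apply: fps_ext => -[|n].
have theta1 : fps_theta (expm1_pow 1) + expm1_pow 1 = fps_exp 1.
  apply: fps_ext => j; rewrite fpsD /fps_theta expm1_pow1E /fps_exp expr1n.
  rewrite factS natrM -[j.+1%:R]natr1.
  by field; rewrite factC_neq0 ?nat1r ?natr1 char0C.
have step q : (fps_theta (expm1_pow q) + fpsC q%:~R * expm1_pow q
    = fpsC q%:~R * (expm1_pow (q - 1) * fps_exp 1)) <->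
    (fps_theta (expm1_pow (q + 1)) + fpsC (q + 1)%:~R * expm1_pow (q + 1)
    = fpsC (q + 1)%:~R * (expm1_pow (q + 1 - 1) * fps_exp 1)).
  rewrite addrK expm1_powS fps_thetaM rmorphD /= ringhom C1.
  have Eq : expm1_pow q = expm1_pow (q - 1) * expm1_pow 1.
    by rewrite -expm1_powS subrK.
  have V := expm1_powV.
  split=> H.
  - transitivity ((fps_theta (expm1_pow q) + fpsC q%:~R * expm1_pow q)
      * expm1_pow 1 + expm1_pow q * (fps_theta (expm1_pow 1) + expm1_pow 1)).
      by ring.
    by rewrite H theta1 Eq; ring.
  - transitivity ((fps_theta (expm1_pow q) * expm1_pow 1 +
        expm1_pow q * fps_theta (expm1_pow 1) +
        (fpsC q%:~R + 1) * (expm1_pow q * expm1_pow 1)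
        - expm1_pow q * (fps_theta (expm1_pow 1) + expm1_pow 1))
        * expm1_pow (-1)).
      transitivity ((fps_theta (expm1_pow q) + fpsC q%:~R * expm1_pow q)
         * (expm1_pow (-1) * expm1_pow 1)); last by ring.
      by rewrite V mulr1.
    rewrite H theta1 {1}Eq.
    transitivity (fpsC q%:~R * (expm1_pow (q - 1) * fps_exp 1)
      * (expm1_pow (-1) * expm1_pow 1) +
      fps_exp 1 * expm1_pow (-1) * (expm1_pow (q-1) * expm1_pow 1 - expm1_pow q)).
      by ring.
    by rewrite V -Eq subrr mulr0 addr0 mulr1.
have base : fps_theta (expm1_pow 0) + fpsC 0%:~R * expm1_pow 0
    = fpsC 0%:~R * (expm1_pow (0 - 1) * fps_exp 1).
  have -> : fpsC (0%:~R : C) = 0 by apply: fps_ext => -[|n].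
  by rewrite !mul0r addr0 expm1_pow0 fps_theta1.
elim/int_ind: p => [//|n IHn|n IHn].
  by move/step: IHn; rewrite -PoszD addn1.
apply/step.
by rewrite (_ : - n.+1%:Z + 1 = - n%:Z)//; lia.
Qed.

(* [Res_x (e^x - 1)^(-s-1) e^(k x) = binom(k - 1, s)]: Pascal's rule together
   with the vanishing of the residue of a derivative, for [k = 1]. *)
Lemma residue_expm1_pow s (k : int) :
  (fps_exp k%:~R * expm1_pow (- s%:Z - 1)) s = binz (k - 1) s.
Proof.
elim: s k => [|s IHs] k.
  by rewrite fpsM0 oppr0 add0r expm1_pow_head binz0 /fps_exp expr0 fact0 divr1 mulr1.
set F := expm1_pow _.
have step (l : int) : (fps_exp (l + 1)%:~R * F) s.+1 =
    (fps_exp l%:~R * F) s.+1 + binz (l - 1) s.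
  rewrite -IHs rmorphD /= mulr1z fps_expD.
  have -> : expm1_pow (- s%:Z - 1) = F * expm1_pow 1.
    by rewrite -expm1_powS; congr expm1_pow; lia.
  rewrite -[(fps_exp l%:~R * (F * expm1_pow 1)) s]fpsXM.
  have -> : fpsX * (fps_exp l%:~R * (F * expm1_pow 1))
    = fps_exp l%:~R * F * (fpsX * expm1_pow 1) by ring.
  rewrite fpsX_expm1_pow1 -fpsD; apply: (congr1 (fun f : fps C => f s.+1)); ring.
(* In [theta_expm1_pow] with exponent -(s+1) the two terms on the left cancel in degree s+1: this is
   the vanishing residue. *)
have base : (fps_exp 1%:~R * F) s.+1 = binz 0 s.+1.
  have := congr1 (fun f : fps C => f s.+1) (theta_expm1_pow (- s.+1%:Z)).
  rewrite fpsD /fps_theta !fpsCM rmorphN /= mulNr subrr => /esym/eqP.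
  rewrite mulNr oppr_eq0 mulf_eq0 pnatr_eq0 /= mulrC => /eqP ->.
  by rewrite binz_small.
rewrite -[k](subrK 1); move: (k - 1) => {}k; rewrite addrK.
elim/int_ind: k => [//|n IHn|n IHn].
  rewrite -addn1 PoszD step IHn addrK binzS.
  by [].
have := step (- n.+1%:Z + 1).
rewrite (_ : - n.+1%:Z + 1 = - n%:Z); last by lia.
rewrite IHn.
have -> : - n%:Z = - n.+1%:Z + 1 by lia.
by rewrite binzS addrK => /addIr ->.
Qed.

Lemma laurent_coefE p k j :
  laurent_coef p k j = (fps_exp k%:R * expm1_pow p) j :> C.
Proof.
by rewrite fpsM; apply: eq_bigr => r _; rewrite mulrC.
Qed.

(** Substituting w = e^x - 1 gives e^(mx) e^(2x) dx = (1 + w)^(m+1) dw, where e^(2x) is the weight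
    factor of omega; the coefficient of w^s is the binomial on the right. *)
Lemma sum_laurent_coef_exp (m : int) s :
  \sum_(r < s.+1) m%:~R ^+ r / r`!%:R * laurent_coef (- s%:Z - 1) 2 (s - r)
  = binz (m + 1) s :> C.
Proof.
transitivity ((fps_exp m%:~R * (fps_exp 2 * expm1_pow (- s%:Z - 1))) s).
  by rewrite fpsM; apply: eq_bigr => r _; rewrite laurent_coefE.
rewrite mulrA -fps_expD -[2]/(2%:~R) -rmorphD residue_expm1_pow.
by congr binz; ring.
Qed.

(** The same substitution for the kernel 1/(e^x - 1), which becomes (1 + w) w^(-1) dw: only t = 0
    and t = 1 survive. *)
Lemma sum_laurent_coef_expm1_powV t :
  \sum_(r < t.+1) expm1_pow (-1) r * laurent_coef (- t%:Z) 2 (t - r)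
  = binz 1 t :> C.
Proof.
transitivity ((expm1_pow (-1) * (fps_exp 2 * expm1_pow (- t%:Z))) t).
  by rewrite fpsM; apply: eq_bigr => r _; rewrite laurent_coefE.
have -> : expm1_pow (-1) * (fps_exp 2 * expm1_pow (- t%:Z))
   = fps_exp 2%:~R * expm1_pow (- t%:Z - 1).
  rewrite -[X in _ * (_ * expm1_pow X)](subrK 1) expm1_powS.
  transitivity (fps_exp 2 * expm1_pow (- t%:Z - 1)
    * (expm1_pow (-1) * expm1_pow 1)); first by ring.
  by rewrite expm1_powV mulr1.
by rewrite residue_expm1_pow.
Qed.

End ExpPowers.

(** * Even zeta values *)

Lemma big_ord_double (V : nmodType) n (F : nat -> V) :
  \sum_(i < n.*2) F i = \sum_(k < n) (F k.*2 + F k.*2.+1).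
Proof.
elim: n => [|n IHn]; first by rewrite !big_ord0.
by rewrite doubleS !big_ord_recr /= IHn addrA.
Qed.

Section Cotangent.
Variable R : realType.
Local Notation C := R[i].

Lemma sin_le_id (x : R) : 0 <= x -> sin x <= x.
Proof.
move=> x0; have [|c _] := @MVT_segment R sin cos 0 x x0.
  by apply: continuous_subspaceT; apply: continuous_sin.
rewrite sin0 !subr0 => ->.
by rewrite ler_piMl// cos_le1.
Qed.

Lemma id_le_tan (x : R) : 0 <= x < pi / 2 -> x <= tan x.
Proof.
move=> /andP[x0 xpi]; have cpos c : c \in `[0, x] -> 0 < cos c.
  rewrite in_itv/= => /andP[c0 cx]; apply: cos_gt0_pihalf.
  rewrite (le_lt_trans cx)// andbT (lt_le_trans _ c0)// oppr_lt0.
  by rewrite divr_gt0// pi_gt0.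
have [||c cx] := @MVT_segment R tan (fun c => cos c ^- 2) 0 x x0.
- move=> c c0x; apply: is_derive_tan.
  by rewrite gt_eqF// cpos//; move: c0x; rewrite !in_itv/= => /andP[? ?]; rewrite !ltW.
- apply: derivable_within_continuous => c c0x.
  by apply: derivable_tan; rewrite gt_eqF// cpos.
rewrite tan0 !subr0 => ->.
rewrite ler_peMl//.
have := cpos _ cx; have := cos_le1 c => c1 c0.
by rewrite invf_ge1 ?exprn_gt0// exprn_ile1// ltW.
Qed.

Lemma de_Moivre (x : R) n :
  (cos x +i* sin x) ^+ n = cos (x *+ n) +i* sin (x *+ n) :> C.
Proof.
elim: n => [|n IHn]; first by rewrite expr0 mulr0n cos0 sin0.
rewrite exprS IHn mulrS cosD sinD; apply/eqP; rewrite eq_complex /=.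
by rewrite eqxx /= addrC eqxx.
Qed.

(** Since 1 + i tan x = e^(ix) / cos x, the power (1 + i tan x)^(2m+1) has imaginary part
    proportional to sin((2m+1)x). *)
Lemma sum_odd_bin_tan (x : R) m : cos x != 0 -> sin (x *+ m.*2.+1) = 0 ->
  \sum_(k < m.+1) 'C(m.*2.+1, k.*2.+1)%:R * (- tan x ^+ 2) ^+ k * tan x = 0.
Proof.
move=> cx sx; set t := tan x.
have Im0 : complex.Im ((1 +i* t : C) ^+ m.*2.+1) = 0.
  have -> : 1 +i* t = (cos x)%:C^-1 * (cos x +i* sin x) :> C.
    rewrite -fmorphV; apply/eqP; rewrite eq_complex /= !mul0r subr0 addr0.
    by rewrite mulVf// /t /tan mulrC !eqxx.
  rewrite exprMn de_Moivre sx -fmorphV -rmorphXn /=.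
  by rewrite mulr0 add0r mul0r.
rewrite -[RHS]Im0.
have -> : 1 +i* t = 1 + 'i%C * t%:C :> C.
  by apply/eqP; rewrite eq_complex /= !(mul0r, mul1r, mulr0, subr0, addr0, add0r) !eqxx.
rewrite exprDn.
under [in RHS]eq_bigr do rewrite expr1n mul1r.
rewrite -doubleS.
rewrite (big_ord_double _ (fun i => ('i%C * t%:C) ^+ i *+ 'C(m.*2.+1, i))).
rewrite (_ : complex.Im _ = \sum_(k < m.+1) complex.Im
   (('i%C * t%:C) ^+ k.*2 *+ 'C(m.*2.+1, k.*2) +
    ('i%C * t%:C) ^+ k.*2.+1 *+ 'C(m.*2.+1, k.*2.+1) : C)); last first.
  by apply: (big_morph (@complex.Im R)) => // -[? ?] [? ?].
apply: eq_bigr => k _.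
have E : ('i%C * t%:C) ^+ k.*2 = ((- t ^+ 2) ^+ k)%:C :> C.
  rewrite -mul2n exprM rmorphXn /=; congr (_ ^+ k).
  by rewrite expr2 expr2; apply/eqP; rewrite eq_complex /=
    !(mul0r, mul1r, mulr0, subr0, addr0, add0r, sub0r, oppr0) !eqxx.
move: 'C(m.*2.+1, k.*2) 'C(m.*2.+1, k.*2.+1) => a b.
rewrite (exprSr _ k.*2) {}E; move: (_ ^+ k) => y.
have ImD (z w : C) : complex.Im (z + w) = complex.Im z + complex.Im w.
  by case: z w => [? ?] [? ?].
have ImMn (z : C) n : complex.Im (z *+ n) = complex.Im z *+ n.
  by elim: n => [|n IHn] //; rewrite !mulrS ImD IHn.
rewrite ImD !ImMn /=.
rewrite !(mul0r, mul1r, mulr0, mulr1, subr0, addr0, add0r, sub0r, oppr0).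
by rewrite mul0rn add0r -mulrA mulr_natl.
Qed.

End Cotangent.

Section Zeta.
Variable R : realType.

(* [b x / (1 + b x)], the logarithmic derivative of [1 + b x] for [x d/dx] *)
Definition geo_log (b : R) : fps R := fun k => if k == 0%N then 0 else - (- b) ^+ k.

Lemma theta_linear (b : R) :
  fps_theta (1 + fpsC b * fpsX) = (1 + fpsC b * fpsX) * geo_log b.
Proof.
rewrite fps_thetaD fps_theta1 add0r fps_thetaM fps_thetaX.
have -> : fps_theta (fpsC b) = 0.
  by apply: fps_ext => -[|n]; rewrite /fps_theta /fpsC ?mul0r ?mulr0.
rewrite mul0r add0r mulrDl mul1r; apply: fps_ext => -[|[|n]];
  rewrite fpsD -mulrA !fpsCM ?fpsXM0 ?fpsXM /geo_log /= ?mulr0 ?addr0//.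
  by rewrite /fpsX expr1 opprK mulr1.
by rewrite exprS; ring.
Qed.

(** Logarithmic derivative of a product of linear factors; comparing coefficients gives Newton's
    identities between elementary symmetric functions and power sums of the [b j]. *)
Lemma newton_identity (I : Type) (r : seq I) (b : I -> R) :
  fps_theta (\prod_(j <- r) (1 + fpsC (b j) * fpsX))
  = \prod_(j <- r) (1 + fpsC (b j) * fpsX) * \sum_(j <- r) geo_log (b j).
Proof.
elim: r => [|j r IHr]; first by rewrite !big_nil mulr0 fps_theta1.
by rewrite !big_cons fps_thetaM IHr theta_linear; ring.
Qed.

(** The shift makes j < m run over the m multiples of pi/(2m+1) inside ]0, pi/2[. *)
Definition cot_angle m j : R := pi *+ j.+1 / m.*2.+1%:R.
Definition cot_sqr m j : R := (tan (cot_angle m j)) ^- 2.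

Lemma cot_angle_gt0 m j : 0 < cot_angle m j.
Proof. by rewrite /cot_angle divr_gt0 ?ltr0Sn// pmulrn_lgt0 ?pi_gt0. Qed.

Lemma cot_angle_lt m j : (j < m)%N -> cot_angle m j < pi / 2.
Proof.
move=> jm; rewrite /cot_angle -[pi *+ _]mulr_natr -mulrA ltr_pM2l ?pi_gt0//.
rewrite ltr_pdivrMr ?ltr0n// mulrC ltr_pdivlMr ?ltr0n//.
by rewrite -natrM ltr_nat; lia.
Qed.

Lemma cot_angle_cos m j : (j < m)%N -> 0 < cos (cot_angle m j).
Proof.
move=> jm; apply: cos_gt0_pihalf; rewrite cot_angle_lt// andbT.
by rewrite (lt_trans _ (cot_angle_gt0 m j))// oppr_lt0 divr_gt0 ?pi_gt0.
Qed.

Lemma cot_angle_tan m j : (j < m)%N -> 0 < tan (cot_angle m j).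
Proof.
move=> jm; apply: lt_le_trans (cot_angle_gt0 m j) _; apply: id_le_tan.
by rewrite ltW ?cot_angle_gt0//= cot_angle_lt.
Qed.

(** With N = 2m+1, these are the coefficients of Im (1 + i t)^N / (N t) as a polynomial in -t^2,
    normalised to constant term 1. *)
Definition bin_series m : fps R :=
  fun k => 'C(m.*2.+1, k.*2.+1)%:R / m.*2.+1%:R.

(* The imaginary part of [(1 + i t)^N] vanishes at [t = tan (j pi / N)]. *)
Lemma bin_series_prod m :
  bin_series m = \prod_(j <- iota 0 m) (1 + fpsC (cot_sqr m j) * fpsX).
Proof.
pose Q := \poly_(k < m.+1) (bin_series m k : R).
have coefQ k : Q`_k = bin_series m k.
  rewrite coef_poly; case: ltnP => // mk; rewrite /bin_series bin_small ?mul0r//.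
  by rewrite ltnS ltn_double.
have N0 : m.*2.+1%:R != 0 :> R by rewrite pnatr_eq0.
have sizeQ : size Q = m.+1.
  by apply: size_poly_eq; rewrite /bin_series binn mul1r invr_eq0.
pose z j := - tan (cot_angle m j) ^+ 2.
have tan0 j : j \in iota 0 m -> tan (cot_angle m j) != 0.
  by rewrite mem_iota/= add0n => jm; rewrite gt_eqF// cot_angle_tan.
have rootQ : all (root Q) (map z (iota 0 m)).
  apply/allP => _ /mapP[j jm ->]; have tj := tan0 _ jm.
  have {}jm : (j < m)%N by rewrite mem_iota in jm.
  have := @sum_odd_bin_tan R (cot_angle m j) m.
  rewrite gt_eqF ?cot_angle_cos// => /(_ isT) E.
  apply/rootP/(mulIf tj); rewrite mul0r horner_poly mulr_suml.
  apply: (mulIf N0); rewrite mul0r mulr_suml -[RHS]E; last first.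
    rewrite /cot_angle -[_ *+ m.*2.+1]mulr_natr divfK//.
    by elim: (j.+1) => [|n IHn]; rewrite ?mulr0n ?sin0// mulrSr sinDpi IHn oppr0.
  by apply: eq_bigr => k _; rewrite /bin_series; field.
have uniqz : uniq_roots (map z (iota 0 m)).
  rewrite uniq_rootsE map_inj_in_uniq ?iota_uniq// => i j.
  rewrite !mem_iota !add0n/= => im jm /eqP.
  rewrite eqr_opp eqf_sqr => /orP[/eqP|/eqP tij]; last first.
    have := cot_angle_tan im; rewrite tij oppr_gt0 => /lt_trans.
    by move=> /(_ _ (cot_angle_tan jm)); rewrite ltxx.
  have in_pihalf k : (k < m)%N -> cot_angle m k \in `](- (pi / 2)), (pi / 2)[.
    move=> km; rewrite in_itv/= cot_angle_lt// andbT.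
    by rewrite (lt_trans _ (cot_angle_gt0 m k))// oppr_lt0 divr_gt0 ?pi_gt0.
  move/tan_inj => /(_ (in_pihalf _ im) (in_pihalf _ jm)).
  have pi0 : pi != 0 :> R by rewrite gt_eqF ?pi_gt0.
  rewrite /cot_angle => /(mulIf (invr_neq0 N0)).
  rewrite -[_ *+ i.+1]mulr_natr -[_ *+ j.+1]mulr_natr => /(mulfI pi0)/eqP.
  by rewrite eqr_nat eqSS => /eqP.
have Qprod : Q = (lead_coef Q * \prod_(j <- iota 0 m) - z j) *:
    \prod_(j <- iota 0 m) (1 + (cot_sqr m j)%:P * 'X).
  rewrite [LHS](all_roots_prod_XsubC _ rootQ uniqz) ?size_map ?size_iota//.
  rewrite -scalerA; congr (_ *: _); rewrite -mul_polyC rmorph_prod -big_split /=.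
  rewrite big_map; apply: eq_big_seq => j /tan0 tj.
  rewrite mulrDr mulr1 mulrA -polyCM /cot_sqr /z opprK mulfV ?expf_neq0//.
  by rewrite mul1r polyCN opprK addrC.
have c1 : lead_coef Q * \prod_(j <- iota 0 m) - z j = 1.
  have := congr1 (fun p : {poly R} => p.[0]) Qprod.
  rewrite hornerZ horner_prod [X in _ * X]big1 => [|j _]; last first.
    by rewrite hornerD hornerM hornerX mulr0 addr0 hornerC.
  by rewrite mulr1 horner_coef0 coefQ /bin_series bin1 mulfV.
rewrite c1 scale1r in Qprod.
pose toF := fun p : {poly R} => (fun k => p`_k) : fps R.
have toFM : {morph toF : p q / p * q >-> p * q}.
  by move=> p q; apply: fps_ext => k; rewrite /toF coefM.
have toF1 : toF 1 = 1 by apply: fps_ext => k; rewrite /toF coef1.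
have -> : bin_series m = toF Q by apply: fps_ext => k; rewrite /toF coefQ.
rewrite Qprod (big_morph toF toFM toF1); apply: eq_bigr => j _.
apply: fps_ext => k; rewrite /toF coefD coefCM coef1 coefX fpsD fpsCM.
by rewrite /fpsX.
Qed.

Lemma cot_sqr_identity m k :
  k%:R * bin_series m k =
  \sum_(i < k.+1) bin_series m i * \sum_(j < m) geo_log (cot_sqr m j) (k - i)%N.
Proof.
have := congr1 (fun f : fps R => f k)
  (@newton_identity nat (iota 0 m) (cot_sqr m)).
rewrite -bin_series_prod fpsM {1}/fps_theta => ->; apply: eq_bigr => i _; congr (_ * _).
rewrite -(big_mkord xpredT (fun j => geo_log (cot_sqr m j) (k - i)%N)).
by rewrite /index_iota subn0 fps_sum.
Qed.

End Zeta.

Section ZetaLimit.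
Variable R : realType.

(** The partial sum of n terms is at most 2 - 1/n for n >= 1, because 1/(n+1)^2 <= 1/n - 1/(n+1)
    telescopes. *)
Lemma is_cvg_zeta (s : nat) : (2 <= s)%N ->
  cvgn (series (fun n => (n.+1%:R : R) ^- s)).
Proof.
move=> s2; apply: nondecreasing_is_cvgn.
  apply/nondecreasing_seqP => n; rewrite /series /= big_nat_recr//= lerDl.
  by rewrite invr_ge0 exprn_ge0.
exists 2 => _ [n _ <-].
suff : series (fun n => (n.+1%:R : R) ^- s) n.+1 <= 2 - n.+1%:R^-1.
  rewrite /series /= big_nat_recr//= => H.
  have := ltW (exprn_gt0 s (ltr0Sn R n)); rewrite -invr_ge0 => H1.
  have : 0 <= n.+1%:R^-1 :> R by rewrite invr_ge0.
  move: H1 H; rewrite /series /=; move: (\sum_(_ <= _ < _) _) => S.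
  by move: (n.+1%:R ^- s) (n.+1%:R^-1) => a b; lra.
elim: n => [|n IHn].
  by rewrite /series /= big_nat1 expr1n invr1; lra.
rewrite /series /= big_nat_recr//=.
move: IHn; rewrite /series /= => /lerD => /(_ _ (n.+2%:R ^- s) (lexx _)) /le_trans.
apply; have n1 : 0 < n.+1%:R :> R by [].
have n2 : 0 < n.+2%:R :> R by [].
have le2 : n.+2%:R ^- s <= n.+2%:R ^- 2 :> R.
  rewrite lef_pV2 ?posrE ?exprn_gt0// -(subnKC s2) exprD ler_peMr ?exprn_ge0//.
  by rewrite exprn_ege1// ler1n.
have : n.+2%:R ^- 2 <= n.+1%:R^-1 - n.+2%:R^-1 :> R.
  have -> : n.+1%:R^-1 - n.+2%:R^-1 = (n.+1%:R * n.+2%:R)^-1 :> R.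
    move: n1; have -> : n.+2%:R = n.+1%:R + 1 :> R by rewrite natr1.
    by move: (n.+1%:R) => a a0; field; rewrite !gt_eqF// addr_gt0.
  rewrite lef_pV2 ?posrE ?mulr_gt0 ?exprn_gt0// expr2 ler_wpM2r ?ler_nat//.
move: le2; move: (n.+2%:R ^- s) (n.+2%:R ^- 2) (n.+1%:R^-1) (n.+2%:R^-1).
by move=> a b c d; lra.
Qed.

Let N m : R := m.*2.+1%:R.

Let N_gt0 m : 0 < N m. Proof. by []. Qed.

Lemma cvg_invN : (N m)^-1 @[m --> \oo] --> (0 : R).
Proof.
apply: (@squeeze_cvgr _ _ _ _ (fun=> 0) (@harmonic R)).
- near=> m; rewrite invr_ge0 ltW //= /harmonic /= lef_pV2 ?posrE//.
  by rewrite ler_nat; lia.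
- exact: cvg_cst.
- exact: cvg_harmonic.
Unshelve. all: end_near. Qed.

Lemma cvg_ffact r : ((m.*2.+1) ^_ r)%:R / N m ^+ r @[m --> \oo] --> (1 : R).
Proof.
elim: r => [|r IHr].
  under eq_cvg do rewrite ffactn0 expr0 divr1.
  exact: cvg_cst.
have H : (((m.*2.+1) ^_ r)%:R / N m ^+ r) * (1 - r%:R * (N m)^-1)
    @[m --> \oo] --> (1 * (1 - r%:R * 0) : R).
  apply: cvgM => //; apply: cvgB; first exact: cvg_cst.
  by apply: cvgM; [exact: cvg_cst|exact: cvg_invN].
rewrite mulr0 subr0 mulr1 in H.
apply: cvg_trans H; apply: near_eq_cvg; near=> m.
rewrite ffactnSr natrM natrB; last first.
  by near: m; exists r => // m /=; lia.
have : N m != 0 by rewrite gt_eqF.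
rewrite exprSr -/(N m); move: (N m) => a a0; field.
by rewrite expf_neq0 ?a0.
Unshelve. all: end_near. Qed.

Lemma cvg_bin_series k :
  bin_series R m k / N m ^+ k.*2 @[m --> \oo] --> (k.*2.+1`!%:R^-1 : R).
Proof.
have : ((m.*2.+1) ^_ k.*2.+1)%:R / N m ^+ k.*2.+1 * k.*2.+1`!%:R^-1
    @[m --> \oo] --> (1 * k.*2.+1`!%:R^-1 : R).
  by apply: cvgM; [exact: cvg_ffact|exact: cvg_cst].
rewrite mul1r; apply: cvg_trans; apply: near_eq_cvg; near=> m.
have f0 : k.*2.+1`!%:R != 0 :> R by rewrite pnatr_eq0 -lt0n fact_gt0.
have Nn0 : N m != 0 by rewrite gt_eqF.
rewrite /bin_series -bin_ffact natrM exprSr -/(N m).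
move: Nn0 f0; move: (N m) (k.*2.+1`!%:R) => a b a0 b0.
by field; rewrite expf_neq0 ?a0 ?b0.
Unshelve. all: end_near. Qed.

Definition zeta_real (s : nat) : R := limn (series (fun n => (n.+1%:R : R) ^- s)).

Lemma subrX_le (l : nat) (x y : R) : 0 <= y -> y <= x -> x <= 1 ->
  x ^+ l - y ^+ l <= l%:R * (x - y).
Proof.
move=> y0 yx x1; elim: l => [|l IHl]; first by rewrite !expr0 subrr mul0r.
have -> : x ^+ l.+1 - y ^+ l.+1 = x ^+ l * (x - y) + y * (x ^+ l - y ^+ l).
  by rewrite !exprS; ring.
rewrite -natr1 mulrDl mul1r addrC lerD//.
  apply: le_trans IHl; rewrite ler_piMl ?(le_trans yx)//.
  by rewrite subr_ge0 lerXn2r ?nnegrE// (le_trans y0).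
by rewrite ler_piMl ?subr_ge0// exprn_ile1// (le_trans y0).
Qed.

(** From sin x <= x <= tan x one gets 1/x^2 - 1 <= cot^2 x <= 1/x^2; at x = (j+1) pi / N, division
    by N^2 leaves an error of at most N^(-2). *)
Lemma cot_sqr_bounds m j : (j < m)%N ->
  [/\ 0 <= cot_sqr R m j / N m ^+ 2,
      cot_sqr R m j / N m ^+ 2 <= (pi *+ j.+1) ^- 2,
      (pi *+ j.+1) ^- 2 - N m ^- 2 <= cot_sqr R m j / N m ^+ 2
    & (pi *+ j.+1 : R) ^- 2 <= 1].
Proof.
move=> jm; have t0 := cot_angle_tan R jm; have a0 := cot_angle_gt0 R m j.
have c0 := cot_angle_cos R jm.
have Nn0 : N m != 0 by rewrite gt_eqF.
have p0 : 0 < pi *+ j.+1 :> R by rewrite pmulrn_lgt0// pi_gt0.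
have E : (pi *+ j.+1 : R) ^- 2 = (cot_angle R m j) ^- 2 / N m ^+ 2.
  by rewrite /cot_angle -/(N m) expr_div_n invf_div mulrAC divff ?expf_neq0// mul1r.
have at1 : cot_angle R m j <= tan (cot_angle R m j).
  by apply: id_le_tan; rewrite ltW//= cot_angle_lt.
have N2 : 0 <= N m ^- 2 by rewrite invr_ge0 exprn_ge0 ?ltW.
split.
- by rewrite divr_ge0 ?exprn_ge0 ?invr_ge0 ?exprn_ge0// ltW.
- by rewrite E ler_wpM2r// lef_pV2 ?posrE ?exprn_gt0// lerXn2r ?nnegrE ?(ltW a0) ?(ltW t0).
- rewrite E -[X in _ - X]mul1r -mulrBl ler_wpM2r//.
  have s0 : 0 < sin (cot_angle R m j).
    by move: t0; rewrite /tan pmulr_lgt0 ?invr_gt0.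
  have -> : cot_sqr R m j = (sin (cot_angle R m j)) ^- 2 - 1.
    rewrite /cot_sqr /tan expr_div_n invf_div cos2sin2; field.
    by rewrite gt_eqF.
  rewrite lerB// lef_pV2 ?posrE ?exprn_gt0// lerXn2r ?nnegrE ?(ltW a0) ?(ltW s0)//.
  by rewrite sin_le_id// ltW.
- rewrite invf_le1 ?exprn_gt0// exprn_ege1//.
  apply: (@le_trans _ _ pi); first by rewrite (le_trans _ (pi_ge2 R))// ler1n.
  by rewrite mulrS lerDl mulrn_wge0// pi_ge0.
Qed.

(** Up to sign the sum is compared with a partial sum of zeta(2l) / pi^(2l). Each of the m < N terms
    is off by at most l N^(-2), the factor l coming from [subrX_le], so the total error is below
    l/N. The sign is that of [geo_log]. *)
Lemma cvg_cot_sum l : (0 < l)%N ->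
  \sum_(j < m) geo_log (cot_sqr R m j) l / N m ^+ l.*2 @[m --> \oo]
    --> - (-1) ^+ l * (zeta_real l.*2 / pi ^+ l.*2).
Proof.
move=> l0.
pose x m := \sum_(j < m) ((pi *+ j.+1 : R) ^- 2) ^+ l.
have cx : x m @[m --> \oo] --> zeta_real l.*2 / pi ^+ l.*2.
  have -> : x = (fun m => series (fun n => (n.+1%:R : R) ^- l.*2) m * pi ^- l.*2).
    apply/funext => m; rewrite /x /series /= big_mkord mulr_suml.
    apply: eq_bigr => j _; rewrite exprVn -exprM mul2n.
    by rewrite -[pi *+ _]mulr_natr exprMn invfM mulrC.
  by apply: cvgM; [apply: is_cvg_zeta; lia|exact: cvg_cst].
pose y m := \sum_(j < m) (cot_sqr R m j / N m ^+ 2) ^+ l.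
have cd : x m - y m @[m --> \oo] --> (0 : R).
  apply: (@squeeze_cvgr _ _ _ _ (fun=> 0) (fun m => l%:R * (N m)^-1)).
  - near=> m; rewrite /x /y -sumrB; apply/andP; split.
      apply: sumr_ge0 => j _; have [? ? ? ?] := cot_sqr_bounds (ltn_ord j).
      rewrite subr_ge0 lerXn2r ?nnegrE//.
      by rewrite invr_ge0 exprn_ge0// mulrn_wge0// pi_ge0.
    apply: (@le_trans _ _ (\sum_(j < m) l%:R * N m ^- 2)).
      apply: ler_sum => j _; have [? ? ? ?] := cot_sqr_bounds (ltn_ord j).
      by apply: (le_trans (subrX_le _ _ _ _)) => //; rewrite ler_wpM2l//; rewrite lerBlDr -lerBlDl.
    rewrite sumr_const card_ord -[_ *+ m]mulr_natr -mulrA ler_wpM2l//.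
    have Nn0 : N m != 0 by rewrite gt_eqF.
    have -> : (N m)^-1 = N m ^- 2 * N m.
      by move: Nn0; move: (N m) => a a0; field.
    rewrite ler_wpM2l ?invr_ge0 ?exprn_ge0 ?(ltW (N_gt0 m))// /N ler_nat; lia.
  - exact: cvg_cst.
  - rewrite -[X in _ --> X](mulr0 l%:R).
    by apply: cvgM; [exact: cvg_cst|exact: cvg_invN].
have cy : y m @[m --> \oo] --> zeta_real l.*2 / pi ^+ l.*2.
  have : x m - (x m - y m) @[m --> \oo] --> zeta_real l.*2 / pi ^+ l.*2 - 0.
    exact: cvgB.
  rewrite subr0; apply: cvg_trans; apply: near_eq_cvg.
  by near=> m; rewrite /= subKr.
have : (- (-1) ^+ l) * y m @[m --> \oo] -->
   - (-1) ^+ l * (zeta_real l.*2 / pi ^+ l.*2) by exact: cvgMl_tmp.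
apply: cvg_trans; apply: near_eq_cvg; near=> m.
rewrite /= /y mulr_sumr; apply: eq_bigr => j _.
rewrite /geo_log; case: l l0 {x cx y cd cy} => // l _ /=.
rewrite [(- cot_sqr _ _ _) ^+ _]exprNn expr_div_n -exprM mul2n mulrA.
by rewrite mulNr.
Unshelve. all: end_near. Qed.

(* Newton's identities for the numbers [cot^2 (j pi / N) / N^2], in the limit
   [N -> oo]. *)
Lemma zeta_newton k :
  k%:R / k.*2.+1`!%:R = \sum_(i < k.+1) i.*2.+1`!%:R^-1 *
   (if (k - i == 0)%N then 0
    else - (-1) ^+ (k - i)%N * (zeta_real (k - i)%N.*2 / pi ^+ (k - i)%N.*2)).
Proof.
have c1 : k%:R * (bin_series R m k / N m ^+ k.*2) @[m --> \oo] -->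
    (k%:R / k.*2.+1`!%:R : R) by apply: cvgM; [exact: cvg_cst|exact: cvg_bin_series].
have c2 : \sum_(i < k.+1) (bin_series R m i / N m ^+ i.*2) *
      (\sum_(j < m) geo_log (cot_sqr R m j) (k - i)%N / N m ^+ (k - i)%N.*2)
      @[m --> \oo] -->
    \sum_(i < k.+1) i.*2.+1`!%:R^-1 *
   (if (k - i == 0)%N then 0
    else - (-1) ^+ (k - i)%N * (zeta_real (k - i)%N.*2 / pi ^+ (k - i)%N.*2)).
  have : forall i : 'I_k.+1, (bin_series R m i / N m ^+ i.*2) *
      (\sum_(j < m) geo_log (cot_sqr R m j) (k - i)%N / N m ^+ (k - i)%N.*2)
      @[m --> \oo] --> i.*2.+1`!%:R^-1 *
   (if (k - i == 0)%N then 0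
    else - (-1) ^+ (k - i)%N * (zeta_real (k - i)%N.*2 / pi ^+ (k - i)%N.*2)).
    move=> i; apply: cvgM; first exact: cvg_bin_series.
    case: eqP => [->|/eqP ki]; last by apply: cvg_cot_sum; rewrite lt0n.
    apply: cvg_trans (@cvg_cst R 0 nat (\oo) _); apply: near_eq_cvg.
    by near=> m; rewrite big1// => j _; rewrite mul0r.
  move=> Hi; elim: (index_enum _) => [|i r IHr].
    by under eq_cvg do rewrite big_nil; rewrite big_nil; exact: cvg_cst.
  under eq_cvg do rewrite big_cons; rewrite big_cons; exact: cvgD.
apply: (cvg_unique _ c1 _) => //=.
apply: cvg_trans c2; apply: near_eq_cvg; near=> m.
rewrite /= mulrA cot_sqr_identity mulr_suml; apply: eq_bigr => i _.
have -> : N m ^+ k.*2 = N m ^+ i.*2 * N m ^+ (k - i)%N.*2.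
  by rewrite -exprD -doubleD subnKC// -ltnS.
rewrite -mulr_suml invfM; ring.
Unshelve. all: end_near. Qed.

End ZetaLimit.

(** * Euler's formula: the coefficients of x/(e^x - 1) in terms of zeta values *)

Section Euler.
Variable R : realType.
Local Notation C := R[i].

(* [S = sinh x / x] and, by the lemma below, [H = x coth x - 1]. *)
Let S : fps C := fun n => if odd n then 0 else n.+1`!%:R^-1.
Let H : fps C := fun n => if odd n || (n == 0)%N then 0 else
  - 2 * (-1) ^+ n./2 * (zeta_real R n / pi ^+ n)%:C.

(** In degree 2k this is twice [zeta_newton]; in odd degrees both sides vanish by parity. *)
Let theta_S : fps_theta S = S * H.
Proof.
apply: fps_ext => n; rewrite fpsM /fps_theta.
have [on|en] := boolP (odd n).
  rewrite {1}/S on mulr0 big1// => i _; rewrite /S /H.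
  case: ifPn => oi; first by rewrite mul0r.
  by rewrite oddB -1?ltnS// on (negbTE oi) mulr0.
rewrite -[n]odd_double_half (negbTE en) add0n; move: (n./2) => k {n en}.
rewrite big_ord_recr /= subnn {2}/H /= mulr0 addr0.
rewrite (big_ord_double k (fun i => S i * H (k.*2 - i)%N)).
have := congr1 (fun x : R => x%:C) (zeta_newton R k).
rewrite big_ord_recr /= subnn eqxx mulr0 addr0 rmorph_sum /= fmorph_div /=.
rewrite !rmorph_nat => E.
transitivity (2 * (k%:R / k.*2.+1`!%:R) : C).
  by rewrite {1}/S odd_double mulrA -natrM mul2n.
rewrite E mulr_sumr; apply: eq_bigr => i _.
have ki : (k - i == 0)%N = false by rewrite subn_eq0 leqNgt ltn_ord.
rewrite {2}/S /= odd_double mul0r addr0 {1}/S odd_double -doubleB /H.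
rewrite odd_double double_eq0 ki /= half_double.
rewrite !rmorphM rmorphN rmorphXn rmorphN1 fmorphV rmorph_nat.
by ring.
Qed.

Let S_sinh : fpsX * S = fpsC (2^-1) * (fps_exp 1 - fps_exp (-1)).
Proof.
apply: fps_ext => -[|n]; rewrite fpsCM fpsD fpsN /fps_exp ?fpsXM0 ?fpsXM.
  by rewrite !expr0 subrr mulr0.
rewrite -[-1]/(-1) -signr_odd /= expr1n /S.
case: ifPn => on /=; first by rewrite expr0 subrr mulr0.
by rewrite expr1 mulN1r opprK mul1r; field; rewrite factC_neq0.
Qed.

Definition fps_scale2 (f : fps C) : fps C := fun n => 2 ^+ n * f n.

Lemma fps_scale2M f g : fps_scale2 (f * g) = fps_scale2 f * fps_scale2 g.
Proof.
apply: fps_ext => n; rewrite fpsM /fps_scale2 fpsM mulr_sumr.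
apply: eq_bigr => i _.
have -> : (2 : C) ^+ n = 2 ^+ i * 2 ^+ (n - i)%N.
  by rewrite -exprD subnKC// -ltnS.
by ring.
Qed.

(** The series 2x/(e^(2x) - 1). Doubling the variable makes it x coth x - x, which can be compared
    with [H]. *)
Let B : fps C := fps_scale2 (expm1_pow R (-1)).

Let B_exp : B * (fps_exp 2 - 1) = fpsC 2 * fpsX.
Proof.
have -> : fps_exp 2 - 1 = fpsC 2 * fpsX * fps_scale2 (expm1_pow R 1).
  have -> : fpsC 2 * fpsX = fps_scale2 fpsX.
    apply: fps_ext => n; rewrite fpsCM /fps_scale2 /fpsX.
    by case: eqP => [->|]; rewrite ?mulr0.
  rewrite -fps_scale2M fpsX_expm1_pow1; apply: fps_ext => n.
  rewrite /fps_scale2 !fpsD !fpsN fps1 /fps_exp expr1n mul1r mulrBr.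
  by case: n => [|n]; rewrite ?expr0 ?mul1r// mulr0 subr0.
transitivity (fpsC 2 * fpsX * (fps_scale2 (expm1_pow R (-1) * expm1_pow R 1))).
  by rewrite fps_scale2M /B; ring.
rewrite expm1_powV (_ : fps_scale2 1 = 1) ?mulr1//.
by apply: fps_ext => -[|n]; rewrite /fps_scale2 fps1 ?mulr0 ?mulr1.
Qed.

Let fpsX_inj (f g : fps C) : fpsX * f = fpsX * g -> f = g.
Proof.
by move=> E; apply: fps_ext => n; rewrite -[LHS]fpsXM E fpsXM.
Qed.

Let fps_inv (f : fps C) : f 0%N = 0 -> S * f = 0 -> f = 0.
Proof.
move=> f0 Sf; apply: fps_ext => n; elim/ltn_ind: n => n IHn.
have := congr1 (fun h : fps C => h n) Sf.
rewrite fpsM big_ord_recl /= subn0 big1 => [|i _].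
  by rewrite addr0 /S /= invr1 mul1r.
by have ? := ltn_ord i; rewrite IHn ?mulr0// /bump /= add1n; lia.
Qed.

Let half2 : fpsC (2^-1 : C) * fpsC 2 = 1.
Proof.
apply: fps_ext => n; rewrite fpsCM fps1 /fpsC.
by case: eqP; rewrite ?mulr0// mulVf ?pnatr_eq0.
Qed.

(** Everything is multiplied by S = sinh x / x, which is invertible: S B = e^(-x), while applying x
    d/dx to x S = sinh x and using [theta_S] gives S (1 + H) = cosh x. It remains that e^(-x) = cosh
    x - sinh x. *)
Lemma bernoulli_eq : B = 1 + H - fpsX.
Proof.
have e2 : fps_exp 2 = fps_exp 1 * fps_exp 1 :> fps C.
  by rewrite -fps_expD -[2%:R]/(1 + 1).
have e0 : fps_exp 1 * fps_exp (-1) = 1 :> fps C.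
  by rewrite -fps_expD subrr fps_exp0.
have SB : S * B = fps_exp (-1).
  apply: fpsX_inj; rewrite mulrA S_sinh.
  transitivity (fpsC 2^-1 * fps_exp (-1) * (B * (fps_exp 2 - 1))
     + fpsC 2^-1 * B * (fps_exp 1 - fps_exp (-1) - fps_exp (-1) * fps_exp 2 + fps_exp (-1))).
    by ring.
  rewrite B_exp e2 mulrA [fps_exp (-1) * fps_exp 1]mulrC e0 mul1r.
  transitivity (fpsC 2^-1 * fpsC 2 * (fpsX * fps_exp (-1)) : fps C); first by ring.
  by rewrite half2 mul1r.
have SH : S * (1 + H) = fpsC 2^-1 * (fps_exp 1 + fps_exp (-1)).
  apply: fpsX_inj.
  have := congr1 (@fps_theta _) S_sinh.
  rewrite !fps_thetaM fps_thetaX theta_S fps_thetaD.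
  have thetaC a : fps_theta (fpsC a : fps C) = 0.
    by apply: fps_ext => -[|n]; rewrite /fps_theta ?mul0r ?mulr0.
  have thetaN (f : fps C) : fps_theta (- f) = - fps_theta f.
    by apply: fps_ext => n; rewrite /fps_theta !fpsN mulrN.
  rewrite thetaC thetaN !fps_theta_exp mul0r add0r.
  have CN1 : fpsC (-1) = -1 :> fps C.
    by apply: fps_ext => -[|n]; rewrite fpsN fps1 /fpsC ?oppr0.
  have C1 : fpsC 1 = 1 :> fps C by apply: fps_ext => -[|n].
  rewrite CN1 C1 => E.
  transitivity (fpsX * S + fpsX * (S * H)); first by ring.
  by rewrite E; ring.
suff : B - (1 + H - fpsX) = 0 by move/eqP; rewrite subr_eq0 => /eqP.
apply: fps_inv.
  rewrite fpsD fpsN !fpsD fpsN fps1 /B /fps_scale2 expm1_pow_head /H /fpsX /=.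
  by rewrite expr0 mulr1 addr0 subr0 subrr.
transitivity (S * B - S * (1 + H) + fpsX * S); first by ring.
rewrite SB SH S_sinh.
transitivity (fps_exp (-1) - fpsC 2^-1 * (1 + 1) * fps_exp (-1) : fps C).
  by ring.
have -> : 1 + 1 = fpsC 2 :> fps C.
  by apply: fps_ext => -[|n]; rewrite fpsD !fps1 /fpsC //= addr0.
by rewrite half2 mul1r subrr.
Qed.

(** Since x coth x is even, the only odd term of x/(e^x - 1) has degree 1, so the vanishing starts
    at degree 3. *)
Lemma expm1_powN1_odd k : expm1_pow R (-1) k.*2.+3 = 0.
Proof.
have /eqP := congr1 (fun f : fps C => f k.*2.+3) bernoulli_eq.
rewrite !fpsD fpsN fps1 /H /fpsX /B /fps_scale2 /= odd_double /= !addr0 subr0.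
by rewrite mulf_eq0 expf_eq0 pnatr_eq0 /= => /eqP.
Qed.

Lemma expm1_powN1_even k :
  twopii ^+ k.+1.*2 * expm1_pow R (-1) k.+1.*2 = - 2 * zeta k.+1.*2.
Proof.
have := congr1 (fun f : fps C => f k.+1.*2) bernoulli_eq.
rewrite !fpsD fpsN fps1 /H /fpsX /B /fps_scale2 odd_double double_eq0.
rewrite (_ : (k.+1.*2 == 1)%N = false)// add0r subr0 doubleK /=.
rewrite -[zeta _]/((zeta_real R k.+1.*2)%:C).
rewrite rmorphM fmorphV rmorphXn /=.
have : (pi%:C : C) ^+ k.+1.*2 != 0.
  by rewrite expf_neq0// eq_complex /= gt_eqF ?pi_gt0.
have -> : twopii = 2 * (pi%:C * 'i%C) :> C.
  apply/eqP; rewrite mulr_natl mulr2n eq_complex /= !(mul0r, mulr0, mulr1, addr0, subr0, add0r).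
  by rewrite -mulr2n mulr_natl oppr0 !eqxx.
have i2 : ('i%C : C) ^+ k.+1.*2 = (-1) ^+ k.+1.
  rewrite -mul2n exprM; congr (_ ^+ _).
  by rewrite expr2; apply/eqP; rewrite eq_complex /=
    !(mul0r, mulr0, mulr1, addr0, subr0, add0r, sub0r) oppr0 !eqxx.
rewrite [X in _ -> _ -> X * _ = _]exprMn [X in _ -> _ -> _ * X * _ = _]exprMn i2.
have : (-1) ^+ k.+1 * (-1) ^+ k.+1 = 1 :> C by rewrite -exprMn mulrNN mulr1 expr1n.
move: (zeta_real R _)%:C (pi%:C ^+ _) ((-1) ^+ _) (2 ^+ _) (expm1_pow _ _ _).
move=> z p s t e ss p0 te; rewrite mulrC mulrA [e * t]mulrC te.
rewrite -[RHS]mulr1 -ss; field.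
exact: p0.
Qed.

End Euler.

(** * Complex power series *)

Section ComplexSequences.
Variable R : realType.
Local Notation C := R[i].
Implicit Types (z w l : C) (u : nat -> C).

(** The norm of [R[i]] takes values in [R[i]]; the estimates need a modulus in the totally ordered,
    complete field [R]. *)
Definition cabs z : R := complex.Re `|z|.

Lemma cabsE z : (cabs z)%:C = `|z|.
Proof. by rewrite /cabs normc_def. Qed.

Lemma cabs_def z : cabs z = Num.sqrt ((complex.Re z) ^+ 2 + (complex.Im z) ^+ 2).
Proof. by rewrite /cabs normc_def. Qed.

Lemma cabs_ge0 z : 0 <= cabs z.
Proof. by rewrite cabs_def sqrtr_ge0. Qed.

Lemma cabsM z w : cabs (z * w) = cabs z * cabs w.
Proof. by apply: (@complexI R); rewrite rmorphM /= !cabsE normrM. Qed.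

Lemma cabsD z w : cabs (z + w) <= cabs z + cabs w.
Proof. by rewrite -lecR rmorphD /= !cabsE ler_normD. Qed.

Lemma cabsN z : cabs (- z) = cabs z.
Proof. by apply: (@complexI R); rewrite !cabsE normrN. Qed.

Lemma cabsX z n : cabs (z ^+ n) = cabs z ^+ n.
Proof. by apply: (@complexI R); rewrite rmorphXn /= !cabsE normrX. Qed.

Lemma cabs0 : cabs 0 = 0.
Proof. by apply: (@complexI R); rewrite !cabsE normr0. Qed.

Lemma cabs1 : cabs 1 = 1.
Proof. by apply: (@complexI R); rewrite !cabsE normr1. Qed.

Lemma cabs_nat n : cabs n%:R = n%:R.
Proof. by apply: (@complexI R); rewrite cabsE normr_nat rmorph_nat. Qed.

Lemma cabsR (x : R) : cabs x%:C = `|x|.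
Proof. by rewrite cabs_def /= expr0n /= addr0 sqrtr_sqr. Qed.

Lemma cabs_sum I (r : seq I) (F : I -> C) :
  cabs (\sum_(i <- r) F i) <= \sum_(i <- r) cabs (F i).
Proof.
elim: r => [|i r IHr]; first by rewrite !big_nil cabs0.
by rewrite !big_cons (le_trans (cabsD _ _))// lerD2l.
Qed.

Lemma cabs_eq0 z : cabs z = 0 -> z = 0.
Proof. by move=> z0; apply/eqP; rewrite -normr_eq0 -cabsE z0. Qed.

Lemma cabs_sqr z : cabs z ^+ 2 = complex.Re z ^+ 2 + complex.Im z ^+ 2.
Proof. by rewrite cabs_def sqr_sqrtr// addr_ge0 ?sqr_ge0. Qed.

Lemma Re_le_cabs z : `|complex.Re z| <= cabs z.
Proof. by rewrite cabs_def -sqrtr_sqr ler_wsqrtr// lerDl sqr_ge0. Qed.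

Lemma Im_le_cabs z : `|complex.Im z| <= cabs z.
Proof. by rewrite cabs_def -sqrtr_sqr ler_wsqrtr// lerDr sqr_ge0. Qed.

Lemma cabs_le_ReIm z : cabs z <= `|complex.Re z| + `|complex.Im z|.
Proof.
have -> : z = (complex.Re z)%:C + 'i%C * (complex.Im z)%:C by rewrite -complexE.
apply: le_trans (cabsD _ _) _; rewrite cabsM !cabsR /=.
rewrite [cabs 'i%C]cabs_def /= expr0n expr1n add0r sqrtr1 mul1r.
by rewrite !(mul0r, mulr0, mul1r, subr0, addr0, add0r).
Qed.

Lemma cvgC_cabs u l :
  (u @ \oo --> l) <-> ((fun n => cabs (l - u n)) @ \oo --> (0 : R)).
Proof.
split => [/cvgrPdist_lt H|/cvgrPdist_lt H]; apply/cvgrPdist_lt => e e0.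
  have /H : 0 < e%:C by rewrite ltcR.
  apply: filterS => n; rewrite -cabsE ltcR sub0r normrN ger0_norm//.
  exact: cabs_ge0.
have eE : e = (complex.Re e)%:C.
  by case: e e0 => a b; rewrite ltcE /= => /andP[/eqP -> _].
have /H : 0 < complex.Re e by rewrite -ltcR -eE.
apply: filterS => n; rewrite -cabsE eE ltcR sub0r normrN ger0_norm//.
exact: cabs_ge0.
Qed.

Lemma cvgC_ReIm u l :
  ((fun n => complex.Re (u n)) @ \oo --> complex.Re l) ->
  ((fun n => complex.Im (u n)) @ \oo --> complex.Im l) -> (u @ \oo --> l).
Proof.
move=> ur ui; apply/cvgC_cabs.
apply: (@squeeze_cvgr _ _ _ _ (fun=> 0) (fun n => `|complex.Re l - complex.Re (u n)|
   + `|complex.Im l - complex.Im (u n)|)).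
- near=> n; rewrite cabs_ge0 /=; apply: le_trans (cabs_le_ReIm _) _.
  by case: l {ur ui} => a b; case: (u n).
- exact: cvg_cst.
- rewrite -[X in _ --> X]addr0 -[X in X + _](@normr0 _ R) -[X in _ + X](@normr0 _ R).
  apply: cvgD; apply: cvg_norm.
    by rewrite -(subrr (complex.Re l)); apply: cvgB => //; exact: cvg_cst.
  by rewrite -(subrr (complex.Im l)); apply: cvgB => //; exact: cvg_cst.
Unshelve. all: end_near. Qed.

Lemma cvgC_lim u l : (u @ \oo --> l) -> limn u = l.
Proof. by move=> ul; apply: (@cvg_lim C (@norm_hausdorff _ C) nat \oo _ u l ul). Qed.

Lemma cvgC_unique u (l l' : C) : (u @ \oo --> l) -> (u @ \oo --> l') -> l = l'.
Proof. by move=> ul ul'; rewrite -(cvgC_lim ul) -(cvgC_lim ul'). Qed.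

Lemma cvgC_D u u' (l l' : C) : (u @ \oo --> l) -> (u' @ \oo --> l') ->
  ((fun n => u n + u' n) @ \oo --> l + l').
Proof.
move=> /cvgC_cabs ul /cvgC_cabs ul'; apply/cvgC_cabs.
apply: (@squeeze_cvgr _ _ _ _ (fun=> 0)
  (fun n => cabs (l - u n) + cabs (l' - u' n))).
- near=> n; rewrite cabs_ge0 /=; apply: le_trans (cabsD _ _).
  by rewrite opprD addrACA.
- exact: cvg_cst.
- by rewrite -[X in _ --> X]addr0; apply: cvgD.
Unshelve. all: end_near. Qed.

Lemma cvgC_M u u' (l l' : C) : (u @ \oo --> l) -> (u' @ \oo --> l') ->
  ((fun n => u n * u' n) @ \oo --> l * l').
Proof.
move=> /cvgC_cabs ul /cvgC_cabs ul'; apply/cvgC_cabs.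
apply: (@squeeze_cvgr _ _ _ _ (fun=> 0)
  (fun n => cabs l * cabs (l' - u' n) + cabs l' * cabs (l - u n)
     + cabs (l - u n) * cabs (l' - u' n))).
- near=> n; rewrite cabs_ge0 -!cabsM -[cabs ((l - _) * _)]cabsN /=.
  have -> : l * l' - u n * u' n = l * (l' - u' n) + l' * (l - u n)
    - (l - u n) * (l' - u' n) by ring.
  by apply: le_trans (cabsD _ _) _; rewrite lerD2r cabsD.
- exact: cvg_cst.
- have -> : 0 = cabs l * 0 + cabs l' * 0 + 0 * 0 :> R by rewrite !mulr0 !addr0.
  by apply: cvgD; [apply: cvgD|]; apply: cvgM => //; exact: cvg_cst.
Unshelve. all: end_near. Qed.

Lemma cabs_lim_le u l B : (u @ \oo --> l) -> (forall n, cabs (u n) <= B) ->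
  cabs l <= B.
Proof.
move=> /cvgC_cabs ul uB; have H n : cabs l - B <= cabs (l - u n).
  rewrite lerBlDr -{1}[l](subrK (u n)) (le_trans (cabsD _ _))// lerD2l//.
rewrite -subr_le0; have <- : limn (fun n => cabs (l - u n)) = 0.
  exact: (cvg_lim (@norm_hausdorff _ R) ul).
by apply: limr_ge; [exact: cvgP ul|exact: nearW].
Qed.

End ComplexSequences.

Section PowerSeries.
Variable R : realType.
Local Notation C := R[i].
Implicit Types (z w : C) (a b : fps C).

(** The constant x/(y - x) comes from the form n x^n (y - x) <= x y^n, which passes through the
    induction on n. *)
Lemma natr_expr_le (x y : R) : 0 <= x < y ->
  exists2 K, 0 <= K & forall n, n%:R * x ^+ n <= K * y ^+ n.
Proof.
move=> /andP[x0 xy]; have y0 : 0 <= y by rewrite (le_trans x0)// ltW.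
have d0 : 0 < y - x by rewrite subr_gt0.
exists (x / (y - x)) => [|n]; first by rewrite divr_ge0// ltW.
rewrite mulrAC ler_pdivlMr//; elim: n => [|n IHn].
  by rewrite !mul0r expr0 mulr1.
have -> : n.+1%:R * x ^+ n.+1 * (y - x) =
    x * (n%:R * x ^+ n * (y - x)) + x * (x ^+ n * (y - x)).
  by rewrite -natr1 exprS; ring.
apply: le_trans (_ : x * (x * y ^+ n) + x * (y ^+ n * (y - x)) <= _).
  apply: lerD; apply: ler_wpM2l => //; apply: ler_wpM2r; first exact: ltW.
  by rewrite lerXn2r// ltW.
by rewrite -mulrDr [y ^+ n * _]mulrC -mulrDl addrC subrK -exprS.
Qed.

Lemma series_recr (f : nat -> C) n : series f n.+1 = series f n + f n.
Proof. by rewrite /series /= big_nat_recr. Qed.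

Lemma series0n (f : nat -> C) : series f 0%N = 0.
Proof. by rewrite /series /= big_geq. Qed.

Lemma series_geo_le (f : nat -> C) (A x : R) m N : 0 <= A -> 0 <= x < 1 ->
  (forall n, cabs (f n) <= A * x ^+ n) ->
  cabs (series f (N + m)%N - series f m) <= A * x ^+ m / (1 - x).
Proof.
move=> A0 /andP[x0 x1] fA.
have x1' : 0 < 1 - x by rewrite subr_gt0.
suff H : cabs (series f (N + m)%N - series f m) <=
    A * x ^+ m * (1 - x ^+ N) / (1 - x).
  apply: le_trans H _; rewrite ler_pM2r ?invr_gt0// ler_piMr//.
    by rewrite mulr_ge0// exprn_ge0.
  by rewrite lerBlDr lerDl exprn_ge0.
rewrite ler_pdivlMr//; elim: N => [|N IHN].
  by rewrite ?add0n subrr cabs0 expr0 subrr mulr0 mul0r.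
have -> : series f (N.+1 + m)%N - series f m = series f (N + m)%N - series f m + f (N + m)%N.
  by rewrite addSn series_recr; ring.
apply: (@le_trans _ _ ((cabs (series f (N + m)%N - series f m) + cabs (f (N + m)%N)) * (1 - x))).
  by rewrite ler_pM2r// cabsD.
rewrite mulrDl.
apply: le_trans (_ : A * x ^+ m * (1 - x ^+ N) + A * x ^+ (N + m) * (1 - x) <= _).
  by apply: lerD => //; rewrite ler_pM2r.
by rewrite exprD exprS le_eqVlt; apply/orP; left; apply/eqP; ring.
Qed.

(** Completeness is applied to real and imaginary parts separately. The explicit tail is what the
    bounds on [psum] and the proof of [psumM] use. *)
Lemma cvgC_geo (f : nat -> C) (A x : R) : 0 <= A -> 0 <= x < 1 ->
  (forall n, cabs (f n) <= A * x ^+ n) ->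
  exists2 l : C, series f @ \oo --> l &
    forall m, cabs (l - series f m) <= A * x ^+ m / (1 - x).
Proof.
move=> A0 x01 fA.
have /andP[x0 x1] := x01.
have cvgR (g : nat -> R) : (forall n, `|g n| <= cabs (f n)) -> cvgn (series g).
  move=> gf; apply: normed_cvg.
  apply: (@series_le_cvg _ _ (geometric A x)) => //.
  - by move=> n; apply: normr_ge0.
  - by move=> n; rewrite /geometric /= mulr_ge0// exprn_ge0.
  - by move=> n; apply: le_trans (gf n) (fA n).
  - by apply: is_cvg_geometric_series; rewrite ger0_norm.
have cr := cvgR (fun n => complex.Re (f n)) (fun n => Re_le_cabs _).
have ci := cvgR (fun n => complex.Im (f n)) (fun n => Im_le_cabs _).
pose l : C := limn (series (fun n => complex.Re (f n)))
  +i* limn (series (fun n => complex.Im (f n))).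
have fl : series f @ \oo --> l.
  apply: cvgC_ReIm.
    have -> : (fun n => complex.Re (series f n)) = series (fun n => complex.Re (f n)).
      apply/funext => n; rewrite /series /=.
      by apply: (big_morph (@complex.Re R)) => // -[? ?] [? ?].
    exact: cr.
  have -> : (fun n => complex.Im (series f n)) = series (fun n => complex.Im (f n)).
    apply/funext => n; rewrite /series /=.
    by apply: (big_morph (@complex.Im R)) => // -[? ?] [? ?].
  exact: ci.
exists l => // m.
apply: (@cabs_lim_le _ (fun N => series f (N + m)%N - series f m)) => [|N].
  apply/cvgC_cabs; move/cvgC_cabs : fl => fl.
  have -> : (fun n => cabs (l - series f m - (series f (n + m)%N - series f m)))
     = (fun n => cabs (l - series f (n + m)%N)).
    by apply/funext => n; congr cabs; ring.
  by rewrite (cvg_shiftn m (fun n => cabs (l - series f n))).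
exact: series_geo_le.
Qed.

(** Radius of convergence at least 1, encoded by boundedness in the manner of Abel: this form is
    stable under sums, products and [fps_theta] without taking limits. *)
Definition rad1 (a : fps C) : Prop :=
  forall r : R, 0 <= r < 1 -> exists B, forall n, cabs (a n) * r ^+ n <= B.

Definition psum (a : fps C) (z : C) : C := limn (series (fun n => a n * z ^+ n)).

Lemma rad1_geo a (r : R) : rad1 a -> 0 <= r < 1 -> exists A x,
  [/\ 0 <= A, 0 <= x < 1 & forall n, cabs (a n) * r ^+ n <= A * x ^+ n].
Proof.
move=> ra /andP[r0 r1]; pose s := (1 + r) / 2.
have s0 : 0 < s by rewrite /s; lra.
have rs : r < s by rewrite /s; lra.
have s1 : s < 1 by rewrite /s; lra.
have [|B aB] := ra s; first by rewrite ltW.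
exists B, (r / s); split.
- by apply: le_trans (aB 0%N); rewrite expr0 mulr1 cabs_ge0.
- by rewrite divr_ge0 ?(ltW s0)//= ltr_pdivrMr// mul1r.
- move=> n; rewrite expr_div_n mulrA ler_pdivlMr ?exprn_gt0// mulrAC.
  by rewrite ler_wpM2r ?exprn_ge0.
Qed.

Lemma rad1_geo_disc a (r : R) : rad1 a -> 0 <= r < 1 -> exists A x,
  [/\ 0 <= A, 0 <= x < 1 & forall z, cabs z <= r -> forall n,
    cabs (a n * z ^+ n) <= A * x ^+ n].
Proof.
move=> ra r01; have [A [x [A0 x01 aA]]] := rad1_geo ra r01.
exists A, x; split => // z zr n; apply: le_trans (aA n).
rewrite cabsM cabsX ler_wpM2l ?cabs_ge0// lerXn2r ?nnegrE ?cabs_ge0//.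
by case/andP: r01.
Qed.

Lemma psumP a z : rad1 a -> cabs z < 1 ->
  series (fun n => a n * z ^+ n) @ \oo --> psum a z.
Proof.
move=> ra z1; have [|A [x [A0 x01 aA]]] := rad1_geo_disc ra (r := cabs z).
  by rewrite cabs_ge0.
have [l fl _] := cvgC_geo A0 x01 (aA _ (lexx _)).
by rewrite /psum (cvgC_lim fl).
Qed.

Lemma psum_bounded a (r : R) : rad1 a -> 0 <= r < 1 ->
  exists B, forall z, cabs z <= r -> cabs (psum a z) <= B.
Proof.
move=> ra r01; have [A [x [A0 x01 aA]]] := rad1_geo_disc ra r01.
exists (A * x ^+ 0 / (1 - x)) => z zr.
have [l fl tl] := cvgC_geo A0 x01 (aA _ zr).
rewrite /psum (cvgC_lim fl); have := tl 0%N.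
by rewrite series0n subr0.
Qed.

Lemma rad1_sumR a (r : R) : rad1 a -> 0 <= r < 1 ->
  exists B, forall N, \sum_(0 <= n < N) cabs (a n) * r ^+ n <= B.
Proof.
move=> ra r01; have [A [x [A0 x01 aA]]] := rad1_geo ra r01.
exists (A * x ^+ 0 / (1 - x)) => N.
have H n : cabs ((cabs (a n) * r ^+ n)%:C) <= A * x ^+ n.
  rewrite cabsR ger0_norm// mulr_ge0 ?cabs_ge0// exprn_ge0//.
  by case/andP: r01.
have := series_geo_le 0 N A0 x01 H.
rewrite addn0 /series /= [X in _ - X]big_geq// subr0 -rmorph_sum cabsR.
exact/le_trans/ler_norm.
Qed.

Lemma rad1_le a b : rad1 b -> (forall n, cabs (a n) <= cabs (b n)) -> rad1 a.
Proof.
move=> rb ab r r01; have [B bB] := rb r r01; exists B => n.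
apply: le_trans (bB n); rewrite ler_wpM2r// exprn_ge0//.
by case/andP: r01.
Qed.

Lemma rad1D a b : rad1 a -> rad1 b -> rad1 (a + b).
Proof.
move=> ra rb r r01; have [A aA] := ra r r01; have [B bB] := rb r r01.
exists (A + B) => n; apply: le_trans (lerD (aA n) (bB n)).
rewrite -mulrDl ler_wpM2r ?cabsD// exprn_ge0//.
by case/andP: r01.
Qed.

Lemma rad1C (c : C) a : rad1 a -> rad1 (fpsC c * a).
Proof.
move=> ra r r01; have [A aA] := ra r r01; exists (cabs c * A) => n.
by rewrite fpsCM cabsM -mulrA ler_wpM2l ?cabs_ge0.
Qed.

Lemma rad1_0 : rad1 0.
Proof. by move=> r r01; exists 0 => n; rewrite cabs0 mul0r. Qed.

Lemma rad1_const : rad1 (fun=> 1).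
Proof.
move=> r /andP[r0 r1]; exists 1 => n; rewrite cabs1 mul1r.
by rewrite exprn_ile1// ltW.
Qed.

Lemma rad1_theta a : rad1 a -> rad1 (fps_theta a).
Proof.
move=> ra r r01; have [A [x [A0 x01 aA]]] := rad1_geo ra r01.
have [K K0 xK] : exists2 K, 0 <= K & forall n, n%:R * x ^+ n <= K * 1 ^+ n.
  exact: natr_expr_le.
exists (A * K) => n; rewrite /fps_theta cabsM cabs_nat -mulrA.
apply: le_trans (_ : n%:R * (A * x ^+ n) <= _); first by rewrite ler_wpM2l.
by rewrite mulrCA ler_wpM2l// (le_trans (xK n))// expr1n mulr1.
Qed.

Lemma rad1M a b : rad1 a -> rad1 b -> rad1 (a * b).
Proof.
move=> ra rb r r01; have /andP[r0 r1] := r01.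
have [A [x [A0 /andP[x0 x1] aA]]] := rad1_geo ra r01.
have [B [y [B0 /andP[y0 y1] bB]]] := rad1_geo rb r01.
pose s := Num.max x y.
have s0 : 0 <= s by rewrite le_max x0.
have s1 : s < 1 by rewrite gt_max x1.
have [K K0 sK] : exists2 K, 0 <= K & forall n, n%:R * s ^+ n <= K * 1 ^+ n.
  by apply: natr_expr_le; rewrite s0.
exists (A * B * (K + 1)) => n.
rewrite fpsM.
apply: (@le_trans _ _ (\sum_(i < n.+1) A * B * s ^+ n)).
  apply: le_trans (_ : (\sum_(i < n.+1) cabs (a i * b (n - i)%N)) * r ^+ n <= _).
    by rewrite ler_wpM2r ?exprn_ge0// cabs_sum.
  rewrite mulr_suml; apply: ler_sum => i _.
  have iN : (i <= n)%N by rewrite -ltnS.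
  have split_expr (c : R) : c ^+ n = c ^+ i * c ^+ (n - i).
    by rewrite -exprD subnKC.
  rewrite !split_expr cabsM mulrACA [A * B * _]mulrACA.
  by apply: ler_pM; rewrite ?mulr_ge0 ?cabs_ge0 ?exprn_ge0//;
    [apply: le_trans (aA i) _|apply: le_trans (bB _) _];
    apply: ler_wpM2l => //; apply: lerXn2r; rewrite ?nnegrE// le_max lexx ?orbT.
rewrite sumr_const card_ord -[_ *+ _]mulr_natr -mulrA ler_wpM2l ?mulr_ge0//.
rewrite -natr1 mulrDr mulr1; apply: lerD; last by rewrite exprn_ile1// ltW.
by rewrite mulrC (le_trans (sK n))// expr1n mulr1.
Qed.

Lemma psumD a b z : rad1 a -> rad1 b -> cabs z < 1 ->
  psum (a + b) z = psum a z + psum b z.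
Proof.
move=> ra rb z1; apply: cvgC_lim.
rewrite (_ : series _ = (fun n => series (fun n => a n * z ^+ n) n +
  series (fun n => b n * z ^+ n) n)); first by apply: cvgC_D; exact: psumP.
apply/funext => n; rewrite /series /= -big_split; apply: eq_bigr => i _.
by rewrite fpsD mulrDl.
Qed.

(** The partial sum of the Cauchy product is the sum of a_i z^i times partial sums of length N - i
    of the second series. Replacing these by their limit costs at most a constant times s^i s^(N-i)
    for each i, that is N s^N in all, which [natr_expr_le] bounds by a geometric sequence. *)
Lemma psumM a b z : rad1 a -> rad1 b -> cabs z < 1 ->
  psum (a * b) z = psum a z * psum b z.
Proof.
move=> ra rb z1.
apply: (cvgC_unique (psumP (rad1M ra rb) z1)).
pose Z n := series (fun n => b n * z ^+ n) n.
have tri N : series (fun n => (a * b) n * z ^+ n) N =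
    \sum_(i < N) a i * z ^+ i * Z (N - i)%N.
  elim: N => [|N IHN]; first by rewrite series0n big_ord0.
  rewrite series_recr IHN.
  have -> : (a * b) N * z ^+ N = \sum_(i < N.+1) a i * z ^+ i * (b (N - i)%N * z ^+ (N - i)).
    rewrite fpsM mulr_suml; apply: eq_bigr => i _.
    have iN : (i <= N)%N by rewrite -ltnS.
    have -> : z ^+ N = z ^+ i * z ^+ (N - i) by rewrite -exprD subnKC.
    by ring.
  have -> : \sum_(i < N) a i * z ^+ i * Z (N - i)%N
      = \sum_(i < N.+1) a i * z ^+ i * Z (N - i)%N.
    by rewrite big_ord_recr /= subnn {3}/Z series0n mulr0 addr0.
  rewrite -big_split /=; apply: eq_bigr => i _.
  rewrite -mulrDr; congr (_ * _).
  by rewrite subSn -1?ltnS// /Z series_recr.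
apply/cvgC_cabs.
have [|A [x [A0 /andP[x0 x1] aA]]] := rad1_geo_disc ra (r := cabs z).
  by rewrite cabs_ge0.
have [|B [y [B0 /andP[y0 y1] bB]]] := rad1_geo_disc rb (r := cabs z).
  by rewrite cabs_ge0.
have y01 : 0 <= y < 1 by rewrite y0.
have [l bl tl] := cvgC_geo B0 y01 (bB _ (lexx _)).
have lE : psum b z = l by rewrite /psum (cvgC_lim bl).
pose s := Num.max x y.
have s0 : 0 <= s by rewrite le_max x0.
have s1 : s < 1 by rewrite gt_max x1.
pose t := (1 + s) / 2.
have t01 : 0 <= s < t by rewrite /t; apply/andP; split; lra.
have [K K0 sK] := natr_expr_le t01.
pose B' := B / (1 - y).
have B'0 : 0 <= B' by rewrite divr_ge0// subr_ge0 ltW.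
have tail N : cabs (series (fun n => a n * z ^+ n) N * l -
     series (fun n => (a * b) n * z ^+ n) N) <= A * B' * K * t ^+ N.
  rewrite tri /series /= big_mkord mulr_suml -sumrB.
  apply: le_trans (cabs_sum _ _) _.
  apply: (@le_trans _ _ (\sum_(i < N) A * B' * s ^+ N)).
    apply: ler_sum => i _; rewrite -mulrBr cabsM.
    have iN : (i <= N)%N by rewrite ltnW.
    have -> : s ^+ N = s ^+ i * s ^+ (N - i) by rewrite -exprD subnKC.
    rewrite [A * B' * _]mulrACA.
    apply: ler_pM; rewrite ?cabs_ge0//.
      apply: le_trans (aA _ (lexx _) i) _; rewrite ler_wpM2l//.
      by rewrite lerXn2r ?nnegrE// le_max lexx.
    apply: le_trans (tl _) _; rewrite mulrAC ler_wpM2l//.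
    by rewrite lerXn2r ?nnegrE// le_max lexx orbT.
  rewrite sumr_const card_ord -[_ *+ N]mulr_natr -(mulrA (A * B')) -(mulrA (A * B')).
  rewrite ler_wpM2l ?(mulr_ge0 A0 B'0)//.
  by rewrite mulrC sK.
rewrite lE.
have H2 : (fun N => series (fun n => a n * z ^+ n) N * l) @ \oo --> psum a z * l.
  apply: cvgC_M; first exact: psumP.
  by apply/cvgC_cabs; rewrite subrr cabs0; exact: cvg_cst.
move/cvgC_cabs : H2 => H2.
apply: (@squeeze_cvgr _ _ _ _ (fun=> 0) (fun N =>
  cabs (psum a z * l - series (fun n => a n * z ^+ n) N * l) + A * B' * K * t ^+ N)).
- near=> N; rewrite cabs_ge0 /=; apply: le_trans (lerD (lexx _) (tail N)).
  apply: le_trans (cabsD _ _).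
  by rewrite addrA subrK.
- exact: cvg_cst.
- rewrite -[X in _ --> X]addr0; apply: cvgD => //.
  rewrite -(mulr0 (A * B' * K)); apply: cvgM; first exact: cvg_cst.
  apply: cvg_expr; case/andP: t01 => _ st.
  by rewrite ger0_norm; rewrite /t; lra.
Unshelve. all: end_near. Qed.

End PowerSeries.

(** * Derivatives along real curves *)

Section RealDerivatives.
Variable R : realType.
Implicit Types (f g : R -> R) (t a b : R).

Let dD t f g a b : is_derive t 1 f a -> is_derive t 1 g b ->
  is_derive t 1 (fun u => f u + g u) (a + b).
Proof. by move=> ? ?; apply: is_deriveD. Qed.

Let dN t f a : is_derive t 1 f a -> is_derive t 1 (fun u => - f u) (- a).
Proof. by move=> ?; apply: is_deriveN. Qed.

Lemma is_derive1M t f g a b : is_derive t 1 f a -> is_derive t 1 g b ->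
  is_derive t 1 (fun u => f u * g u) (f t * b + g t * a).
Proof. by move=> ? ?; apply: is_deriveM. Qed.

Let dcst t (k : R) : is_derive t 1 (fun=> k) 0.
Proof. exact: is_derive_cst. Qed.

(** The domination forces e(t) = 0, so the difference quotients of [e] at t are dominated by those
    of [E]. This converts error estimates into derivatives. *)
Lemma is_derive_dominated t (e E : R -> R) :
  (\forall u \near t, `|e u| <= E u) -> E t = 0 -> is_derive t 1 E 0 ->
  is_derive t 1 e 0.
Proof.
move=> eE Et dE.
have et : e t = 0.
  by apply/eqP; rewrite -normr_le0 -Et; exact: nbhs_singleton eE.
have H : h^-1 *: ((e \o shift t) (h *: 1) - e t) @[h --> 0^'] --> (0 : R).
  have cE : h^-1 *: ((E \o shift t) (h *: 1) - E t) @[h --> 0^'] --> (0 : R).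
    have : h^-1 *: ((E \o shift t) (h *: 1) - E t) @[h --> 0^'] --> 'D_1 E t.
      by case: dE.
    by rewrite derive_val.
  apply/cvgr0Pnorm_lt => eps eps0.
  move/cvgr0Pnorm_lt : cE => /(_ _ eps0) cE.
  have nE : \forall h \near 0^', `|e (h + t)| <= E (h + t).
    have : \forall h \near (0 : R), `|e (h + t)| <= E (h + t).
      have sh : (h + t) @[h --> (0 : R)] --> t.
        rewrite -[X in _ --> X]add0r; apply: cvgD; [exact: cvg_id|exact: cvg_cst].
      exact: sh eE.
    by apply: cvg_within.
  near=> h.
  have h1 : `|e (h + t)| <= E (h + t) by near: h.
  have h2 : `|h^-1 *: ((E \o shift t) (h *: 1) - E t)| < eps by near: h.
  apply: le_lt_trans h2.
  rewrite Et et !subr0 /= /GRing.scale /= !mulr1 !normrM ler_wpM2l//.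
  by apply: le_trans h1 _; exact: ler_norm.
apply: DeriveDef; first by apply/cvg_ex; exists 0.
by apply/cvg_lim => //.
Unshelve. all: end_near. Qed.

Local Notation C := R[i].
Implicit Types (F G : R -> C).

Lemma curve_derivativeD t F G (l m : C) :
  curve_derivative F t l -> curve_derivative G t m ->
  curve_derivative (fun u => F u + G u) t (l + m).
Proof.
move=> [F1 F2] [G1 G2]; split.
  rewrite (_ : (fun u => _) = (fun u => complex.Re (F u) + complex.Re (G u))).
    by case: l m F1 G1 {F2 G2} => [? ?] [? ?] ? ?; apply: dD.
  by apply/funext => u; case: (F u) (G u) => [? ?] [? ?].
rewrite (_ : (fun u => _) = (fun u => complex.Im (F u) + complex.Im (G u))).
  by case: l m F2 G2 {F1 G1} => [? ?] [? ?] ? ?; apply: dD.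
by apply/funext => u; case: (F u) (G u) => [? ?] [? ?].
Qed.

Lemma curve_derivative_cst t (k : C) : curve_derivative (fun=> k) t 0.
Proof. by split; apply: dcst. Qed.

Lemma curve_derivativeM t F G (l m : C) :
  curve_derivative F t l -> curve_derivative G t m ->
  curve_derivative (fun u => F u * G u) t (l * G t + F t * m).
Proof.
have ReM (x y : C) : complex.Re (x * y) =
    complex.Re x * complex.Re y - complex.Im x * complex.Im y.
  by case: x y => [? ?] [? ?].
have ImM (x y : C) : complex.Im (x * y) =
    complex.Re x * complex.Im y + complex.Im x * complex.Re y.
  by case: x y => [? ?] [? ?].
have ReD (x y : C) : complex.Re (x + y) = complex.Re x + complex.Re y.
  by case: x y => [? ?] [? ?].
have ImD (x y : C) : complex.Im (x + y) = complex.Im x + complex.Im y.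
  by case: x y => [? ?] [? ?].
move=> [F1 F2] [G1 G2]; split.
  rewrite (_ : (fun u => _) = (fun u => complex.Re (F u) * complex.Re (G u)
     + - (complex.Im (F u) * complex.Im (G u)))); last first.
    by apply/funext => u; rewrite ReM.
  apply: is_derive_eq (dD (is_derive1M F1 G1) (dN (is_derive1M F2 G2))) _.
  by rewrite ReD !ReM; ring.
rewrite (_ : (fun u => _) = (fun u => complex.Re (F u) * complex.Im (G u)
    + complex.Im (F u) * complex.Re (G u))); last first.
  by apply/funext => u; rewrite ImM.
apply: is_derive_eq (dD (is_derive1M F1 G2) (is_derive1M F2 G1)) _.
by rewrite ImD !ImM; ring.
Qed.

Lemma curve_derivative_eq t F (l m : C) :
  curve_derivative F t l -> l = m -> curve_derivative F t m.
Proof. by move=> ? <-. Qed.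

Lemma curve_derivativeZ t F (k l : C) :
  curve_derivative F t l -> curve_derivative (fun u => k * F u) t (k * l).
Proof.
move=> Fl; apply: (curve_derivative_eq (curve_derivativeM (curve_derivative_cst t k) Fl)).
by rewrite mul0r add0r.
Qed.

Lemma curve_derivative_near t F G (l : C) :
  (\forall u \near t, F u = G u) -> curve_derivative F t l ->
  curve_derivative G t l.
Proof.
move=> FG [F1 F2]; split; [apply: near_eq_is_derive F1|apply: near_eq_is_derive F2];
  by apply: filterS FG => u ->.
Qed.

(** A chain rule: [c] plays the part of the complex derivative of F with respect to G. The error is
    dominated by B |G(u) - G(t)|^2, a function whose value and derivative vanish at t. *)
Lemma curve_derivative_quadratic t F G (c l : C) (B : R) :
  (\forall u \near t, cabs (F u - F t - (G u - G t) * c) <= B * cabs (G u - G t) ^+ 2) ->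
  curve_derivative G t l -> curve_derivative F t (l * c).
Proof.
move=> FG dG.
have dG' : curve_derivative (fun u => G u - G t) t l.
  apply: curve_derivative_eq; first exact: (curve_derivativeD dG (curve_derivative_cst t _)).
  by rewrite addr0.
have dL : curve_derivative (fun u => c * (G u - G t)) t (l * c).
  by apply: curve_derivative_eq (curve_derivativeZ c dG') _; rewrite mulrC.
pose e u := F u - F t - (G u - G t) * c.
have de : curve_derivative e t 0.
  pose E u := B * (complex.Re (G u - G t) * complex.Re (G u - G t) +
     complex.Im (G u - G t) * complex.Im (G u - G t)).
  have Et : E t = 0 by rewrite /E subrr /= !mulr0 addr0 mulr0.
  have dE : is_derive t 1 E 0.
    case: dG' => d1 d2.
    apply: is_derive_eq (is_derive1M (dcst t B)
      (dD (is_derive1M d1 d1) (is_derive1M d2 d2))) _.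
    by rewrite subrr /= !(mul0r, mulr0, addr0).
  have eE : \forall u \near t, cabs (e u) <= E u.
    by apply: filterS FG => u; rewrite cabs_sqr /E !expr2.
  split; apply: (is_derive_dominated _ Et dE); apply: filterS eE => u.
    exact: le_trans (Re_le_cabs _).
  exact: le_trans (Im_le_cabs _).
have := curve_derivativeD (curve_derivativeD dL (curve_derivative_cst t (F t))) de.
rewrite !addr0; apply: curve_derivative_near; near=> u.
by rewrite /e; ring.
Unshelve. all: end_near. Qed.

Lemma cexpD (z w : C) : cexp (z + w) = cexp z * cexp w.
Proof.
case: z w => [a b] [c d]; rewrite /cexp /= expRD cosD sinD.
by apply/eqP; rewrite eq_complex /=; apply/andP; split; apply/eqP; ring.
Qed.

Lemma cexp0 : cexp 0 = 1 :> C.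
Proof. by rewrite /cexp /= expR0 cos0 sin0 mulr1 mulr0. Qed.

Lemma cexpMn (z : C) n : cexp (z * n%:R) = cexp z ^+ n.
Proof.
elim: n => [|n IHn]; first by rewrite mulr0 cexp0.
by rewrite -natr1 mulrDr mulr1 cexpD IHn exprSr.
Qed.

Lemma cabs_cexp (z : C) : cabs (cexp z) = expR (complex.Re z).
Proof.
rewrite cabs_def /cexp /= !exprMn -mulrDr cos2Dsin2 mulr1 sqrtr_sqr.
by rewrite ger0_norm// expR_ge0.
Qed.

Lemma curve_derivative_cexp t F (l : C) :
  curve_derivative F t l ->
  curve_derivative (fun u => cexp (F u)) t (l * cexp (F t)).
Proof.
case: l => a b [/= F1 F2].
have dexp := is_derive1_comp (is_derive_expR (complex.Re (F t))) F1.
have dcos := is_derive1_comp (is_derive_cos (complex.Im (F t))) F2.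
have dsin := is_derive1_comp (is_derive_sin (complex.Im (F t))) F2.
by split => /=; [apply: is_derive_eq (is_derive1M dexp dcos) _
  |apply: is_derive_eq (is_derive1M dexp dsin) _] => /=; ring.
Qed.

End RealDerivatives.

Section PowerSeriesDerivative.
Variable R : realType.
Local Notation C := R[i].
Implicit Types (z w : C) (a b : fps C).

Definition fps_deriv a : fps C := fun n => n.+1%:R * a n.+1.

Lemma rad1_deriv a : rad1 a -> rad1 (fps_deriv a).
Proof.
move=> /rad1_theta ra r /andP[r0 r1]; pose s := Num.max r (1 / 2).
have s0 : 0 < s by rewrite lt_max; apply/orP; right; lra.
have s1 : s < 1 by rewrite gt_max r1; lra.
have [|B aB] := ra s; first by rewrite ltW.
exists (B / s) => n; rewrite ler_pdivlMr//; apply: le_trans (aB n.+1).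
rewrite exprSr mulrA ler_wpM2r ?(ltW s0)// ler_wpM2l ?cabs_ge0//.
by rewrite lerXn2r ?nnegrE ?(ltW s0)// le_max lexx.
Qed.

Lemma psum_deriv a z : rad1 a -> cabs z < 1 ->
  z * psum (fps_deriv a) z = psum (fps_theta a) z.
Proof.
move=> ra z1; apply/esym.
have H := psumP (rad1_theta ra) z1.
apply: (@cvgC_unique _ (fun n => series (fun n => fps_theta a n * z ^+ n) (n + 1)%N)).
  apply/cvgC_cabs; move/cvgC_cabs : H => H.
  by rewrite (cvg_shiftn 1 (fun n => cabs (psum (fps_theta a) z -
    series (fun n => fps_theta a n * z ^+ n) n))).
rewrite (_ : (fun n => _) = (fun n => z * series (fun n => fps_deriv a n * z ^+ n) n)).
  apply: cvgC_M; last by apply: psumP => //; apply: rad1_deriv.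
  by apply/cvgC_cabs; rewrite subrr cabs0; exact: cvg_cst.
apply/funext; elim=> [|n IHn].
  by rewrite add0n series_recr !series0n /fps_theta !mul0r mulr0 addr0.
rewrite addSn series_recr IHn series_recr mulrDr; congr (_ + _).
by rewrite addn1 /fps_theta /fps_deriv exprS; ring.
Qed.

(** The natural bound is n^2 r^(n-2) |w - z|^2; the factor r^2 on the left avoids negative exponents
    for n < 2. The induction writes the remainder of degree n+1 as w times that of degree n plus n
    z^(n-1) (w - z)^2. *)
Lemma expr_remainder (r : R) z w n : 0 <= r -> cabs z <= r -> cabs w <= r ->
  r ^+ 2 * cabs (w ^+ n - z ^+ n - n%:R * z ^+ n.-1 * (w - z))
  <= n%:R ^+ 2 * r ^+ n * cabs (w - z) ^+ 2.
Proof.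
move=> r0 zr wr; elim: n => [|n IHn].
  by rewrite !expr0 subrr !mul0r subr0 cabs0 mulr0 expr0n !mul0r.
have -> : w ^+ n.+1 - z ^+ n.+1 - n.+1%:R * z ^+ n.+1.-1 * (w - z) =
   w * (w ^+ n - z ^+ n - n%:R * z ^+ n.-1 * (w - z))
   + n%:R * z ^+ n.-1 * (w - z) ^+ 2.
  case: n {IHn} => [|n]; first by rewrite !expr1 !expr0; ring.
  by rewrite /= !exprS -natr1; ring.
apply: (@le_trans _ _ (r * (n%:R ^+ 2 * r ^+ n * cabs (w - z) ^+ 2)
   + n%:R * r ^+ n.+1 * cabs (w - z) ^+ 2)).
  apply: le_trans (ler_wpM2l (exprn_ge0 _ r0) (cabsD _ _)) _.
  rewrite mulrDr; apply: lerD.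
    rewrite cabsM mulrCA; apply: ler_pM; rewrite ?mulr_ge0 ?cabs_ge0 ?exprn_ge0//.
  case: n {IHn} => [|n]; first by rewrite !mul0r cabs0 mulr0.
  rewrite cabsM [cabs (_ ^+ 2)]cabsX cabsM cabsX cabs_nat mulrA ler_wpM2r ?exprn_ge0 ?cabs_ge0//.
  rewrite mulrCA ler_wpM2l// -[n.+2]add2n exprD ler_wpM2l ?exprn_ge0//.
  by rewrite lerXn2r ?nnegrE ?cabs_ge0.
have -> : r * (n%:R ^+ 2 * r ^+ n * cabs (w - z) ^+ 2)
   + n%:R * r ^+ n.+1 * cabs (w - z) ^+ 2 =
   (n%:R ^+ 2 + n%:R) * r ^+ n.+1 * cabs (w - z) ^+ 2 by rewrite [r ^+ n.+1]exprS; ring.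
rewrite ler_wpM2r ?exprn_ge0 ?cabs_ge0// ler_wpM2r ?exprn_ge0//.
have : 0 <= n%:R :> R by [].
rewrite -natr1; move: (n%:R) => x x0; rewrite sqrrD expr1n mulr1 -addrA lerD2l.
by rewrite mulr2n -addrA lerDl addr_ge0.
Qed.

Lemma psum_remainder a (r : R) : rad1 a -> 0 < r < 1 ->
  exists B, forall z w, cabs z <= r -> cabs w <= r ->
  cabs (psum a w - psum a z - (w - z) * psum (fps_deriv a) z)
    <= B * cabs (w - z) ^+ 2.
Proof.
move=> ra /andP[r0 r1]; have r01 : 0 <= r < 1 by rewrite ltW.
(* Two applications of [fps_theta] supply the factor n^2 of [expr_remainder]. *)
have [M aM] := rad1_sumR (rad1_theta (rad1_theta ra)) r01.
exists (M / r ^+ 2) => z w zr wr.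
have z1 := le_lt_trans zr r1; have w1 := le_lt_trans wr r1.
pose u N : C := \sum_(0 <= n < N.+1) a n * (w ^+ n - z ^+ n - n%:R * z ^+ n.-1 * (w - z)).
have uE : u = (fun N => series (fun n => a n * w ^+ n) (N + 1)%N
    - series (fun n => a n * z ^+ n) (N + 1)%N
    - (w - z) * series (fun n => fps_deriv a n * z ^+ n) N).
  apply/funext; elim=> [|N IHN].
    rewrite /u big_nat1 add0n !series_recr !series0n.
    by rewrite !mul0r !subr0 mulr0 subr0; ring.
  rewrite /u big_nat_recr//= -/(u N) IHN addSn !series_recr addn1.
  by rewrite /fps_deriv /=; ring.
apply: (@cabs_lim_le _ u) => [|N].
  rewrite uE.
  have shift1 b x : rad1 b -> cabs x < 1 ->
     (fun N => series (fun n => b n * x ^+ n) (N + 1)%N) @ \oo --> psum b x.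
    move=> rb x1; apply/cvgC_cabs.
    rewrite (cvg_shiftn 1 (fun N => cabs (psum b x - series (fun n => b n * x ^+ n) N))).
    exact/cvgC_cabs/psumP.
  have cC k f l : f @ \oo --> l -> (fun N => k * f N : C) @ \oo --> k * l.
    apply: cvgC_M; apply/cvgC_cabs; rewrite subrr cabs0; exact: cvg_cst.
  have -> : psum a w - psum a z - (w - z) * psum (fps_deriv a) z =
    psum a w + (-1) * psum a z + (- (w - z)) * psum (fps_deriv a) z by ring.
  have -> : (fun N => series (fun n => a n * w ^+ n) (N + 1)%N
    - series (fun n => a n * z ^+ n) (N + 1)%N
    - (w - z) * series (fun n => fps_deriv a n * z ^+ n) N) =
   (fun N => series (fun n => a n * w ^+ n) (N + 1)%N
    + (-1) * series (fun n => a n * z ^+ n) (N + 1)%N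
    + (- (w - z)) * series (fun n => fps_deriv a n * z ^+ n) N).
    by apply/funext => N; ring.
  apply: cvgC_D; first apply: cvgC_D.
  - exact: shift1.
  - exact/cC/shift1.
  - by apply: cC; apply: psumP => //; apply: rad1_deriv.
apply: le_trans (cabs_sum _ _) _.
rewrite mulrAC ler_pdivlMr ?exprn_gt0//.
apply: (@le_trans _ _ ((\sum_(0 <= n < N.+1)
    cabs (fps_theta (fps_theta a) n) * r ^+ n) * cabs (w - z) ^+ 2)); last first.
  by rewrite ler_wpM2r ?exprn_ge0 ?cabs_ge0.
rewrite !mulr_suml; apply: ler_sum => n _.
rewrite cabsM mulrC mulrCA.
apply: le_trans (ler_wpM2l (cabs_ge0 _) (expr_remainder n (ltW r0) zr wr)) _.
by rewrite /fps_theta !cabsM cabs_nat le_eqVlt; apply/orP; left; apply/eqP; ring.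
Qed.

Lemma curve_derivative_continuous t (g : R -> C) (l : C) (e : R) :
  curve_derivative g t l -> 0 < e -> \forall u \near t, cabs (g u - g t) < e.
Proof.
move=> [g1 g2] e0.
have cont (f : R -> R) d : is_derive t 1 f d -> f u @[u --> t] --> f t.
  by move=> [df _]; apply: differentiable_continuous; apply/derivable1_diffP.
have e2 : 0 < e / 2 by rewrite divr_gt0.
move/cont/cvgrPdist_lt/(_ _ e2) : g1 => g1.
move/cont/cvgrPdist_lt/(_ _ e2) : g2 => g2.
near=> u; apply: le_lt_trans (cabs_le_ReIm _) _.
have h1 : `|complex.Re (g t) - complex.Re (g u)| < e / 2 by near: u.
have h2 : `|complex.Im (g t) - complex.Im (g u)| < e / 2 by near: u.
rewrite distrC in h1; rewrite distrC in h2.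
rewrite [ltRHS](splitr e).
by case: (g u) (g t) h1 h2 => [? ?] [? ?] /=; exact: ltrD.
Unshelve. all: end_near. Qed.

Lemma curve_derivative_psum a t (g : R -> C) (l : C) : rad1 a ->
  cabs (g t) < 1 -> curve_derivative g t l ->
  curve_derivative (fun u => psum a (g u)) t (l * psum (fps_deriv a) (g t)).
Proof.
move=> ra gt1 dg; pose r := (1 + cabs (g t)) / 2.
have g0 := cabs_ge0 (g t).
have r0 : 0 < r by rewrite /r; lra.
have rg : 0 < r - cabs (g t) by rewrite /r; lra.
have [|B aB] := psum_remainder (r := r) ra.
  by rewrite r0 /r; lra.
apply: (@curve_derivative_quadratic _ t _ g _ l B) => //.
near=> u; apply: aB; first by rewrite -subr_ge0 ltW.
have h : cabs (g u - g t) < r - cabs (g t).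
  by near: u; exact: curve_derivative_continuous dg rg.
by rewrite -[g u](subrK (g t)) (le_trans (cabsD _ _))// -lerBrDr ltW.
Unshelve. all: end_near. Qed.

End PowerSeriesDerivative.

(** * Eisenstein series as power series in the nome *)

Section QSeries.
Variable R : realType.
Local Notation C := R[i].
Implicit Types (tau : upper R) (a b : fps C).

Definition nome tau : C := qpow tau 1.

Lemma qpowE tau n (s : C) : qpow tau (n%:R + s) = qpow tau s * nome tau ^+ n.
Proof.
rewrite /nome /qpow mulrDr cexpD mulrC; congr (_ * _).
by rewrite cexpMn mulr1.
Qed.

Lemma nomeX tau n : qpow tau n%:R = nome tau ^+ n.
Proof. by rewrite -[n%:R]addr0 qpowE /qpow mulr0 cexp0 mul1r. Qed.

Lemma cabs_nome tau : cabs (nome tau) = expR (- (2 * pi * complex.Im (val tau))).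
Proof.
rewrite /nome /qpow cabs_cexp mulr1; congr expR.
by case: (val tau) => a b /=; rewrite mul0r sub0r.
Qed.

Lemma cabs_nome_lt1 tau : cabs (nome tau) < 1.
Proof.
rewrite cabs_nome -expR0 ltr_expR oppr_lt0 !mulr_gt0 ?pi_gt0//.
exact: (valP tau).
Qed.

Lemma cabs_nome_le (y : R) tau : y <= complex.Im (val tau) ->
  cabs (nome tau) <= expR (- (2 * pi * y)).
Proof.
by move=> yt; rewrite cabs_nome ler_expR lerN2 ler_wpM2l// mulr_ge0 ?pi_ge0.
Qed.

Lemma nome_surj (r : R) : 0 < r < 1 -> exists tau, cabs (nome tau) = r.
Proof.
move=> /andP[r0 r1]; pose y := - ln r / (2 * pi).
have p0 : 0 < 2 * pi :> R by rewrite mulr_gt0 ?pi_gt0.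
have y0 : 0 < complex.Im (0 +i* y : C).
  by rewrite /= divr_gt0// oppr_gt0 ln_lt0 ?r0.
exists (exist _ (0 +i* y : C) y0 : upper R); rewrite cabs_nome /=.
by rewrite mulrC divfK ?gt_eqF// opprK lnK.
Qed.

(** For tau with |q| = max(r, 1/2) the terms of the series tend to 0, hence are bounded, and |q| >=
    r. The maximum with 1/2 is there because q never vanishes. *)
Lemma cvg_rad1 a (s : C) :
  (forall tau, cvgn (series (fun n => a n * qpow tau (n%:R + s)))) -> rad1 a.
Proof.
move=> ca r /andP[r0 r1]; pose t := Num.max r (1 / 2).
have t0 : 0 < t by rewrite lt_max; apply/orP; right; lra.
have t1 : t < 1 by rewrite gt_max r1; lra.
have [|tau qt] := nome_surj (r := t); first by rewrite t0.
have /cvgC_cabs/cvgrPdist_lt := cvg_series_cvg_0 (ca tau).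
move=> /(_ 1 ltr01)[N _ NH].
have q0 : 0 < cabs (qpow tau s) by rewrite cabs_cexp expR_gt0.
exists ((1 + \sum_(n < N) cabs (a n * qpow tau (n%:R + s))) / cabs (qpow tau s)) => n.
rewrite ler_pdivlMr//.
apply: (@le_trans _ _ (cabs (a n * qpow tau (n%:R + s)))).
  rewrite qpowE !cabsM cabsX qt -!mulrA ler_wpM2l ?cabs_ge0// mulrC.
  rewrite ler_wpM2l ?cabs_ge0// lerXn2r ?nnegrE ?(ltW t0)//.
  by rewrite le_max lexx.
have [nN|Nn] := ltnP n N.
  rewrite (bigD1 (Ordinal nN))//= addrCA lerDl addr_ge0// sumr_ge0// => i _.
  exact: cabs_ge0.
have := NH n Nn; rewrite /= sub0r normrN sub0r cabsN ger0_norm ?cabs_ge0// => H.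
by rewrite ler_wpDr// ?sumr_ge0 1?ltW// => i _; exact: cabs_ge0.
Qed.

Lemma qseries_lim a s tau : rad1 a ->
  limn (series (fun n => a n * qpow tau (n%:R + s))) = qpow tau s * psum a (nome tau).
Proof.
move=> ra; apply: cvgC_lim.
rewrite (_ : series _ = (fun N => qpow tau s * series (fun n => a n * nome tau ^+ n) N)).
  apply: cvgC_M; last exact/psumP/cabs_nome_lt1.
  by apply/cvgC_cabs; rewrite subrr cabs0; exact: cvg_cst.
apply/funext => N; rewrite /series /= mulr_sumr; apply: eq_bigr => n _.
by rewrite qpowE mulrCA.
Qed.

Lemma psumZ (c : C) a z : rad1 a -> cabs z < 1 -> psum (fpsC c * a) z = c * psum a z.
Proof.
move=> ra z1; apply: cvgC_lim.
rewrite (_ : series _ = (fun N => c * series (fun n => a n * z ^+ n) N)).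
  apply: cvgC_M; last exact/psumP.
  by apply/cvgC_cabs; rewrite subrr cabs0; exact: cvg_cst.
apply/funext => N; rewrite /series /= mulr_sumr; apply: eq_bigr => n _.
by rewrite fpsCM mulrA.
Qed.

Lemma rad1_fpsC (c : C) : rad1 (fpsC c).
Proof.
move=> r /andP[r0 r1]; exists (cabs c) => -[|n]; first by rewrite expr0 mulr1.
by rewrite /fpsC cabs0 mul0r cabs_ge0.
Qed.

Lemma psum_fpsC (c z : C) : psum (fpsC c) z = c.
Proof.
apply: cvgC_lim; apply/cvgC_cabs.
rewrite -(cvg_shiftn 1).
rewrite (_ : (fun n => _) = (fun=> 0)); first exact: cvg_cst.
apply/funext; elim=> [|n].
  by rewrite add0n series_recr series0n expr0 mulr1 add0r subrr cabs0.
by rewrite addSn series_recr addn1 /= {3}/fpsC mul0r addr0.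
Qed.

(** d/dtau is 2 pi i q d/dq, which acts on the coefficients of q^s f(q) as s plus the Euler
    operator. *)
Lemma qseries_curve a s t (eta : R -> upper R) (l : C) : rad1 a ->
  curve_derivative (fun u => val (eta u)) t l ->
  curve_derivative (fun u => qpow (eta u) s * psum a (nome (eta u))) t
   (twopii * l * (qpow (eta t) s * psum (fpsC s * a + fps_theta a) (nome (eta t)))).
Proof.
move=> ra de.
have dq c : curve_derivative (fun u => qpow (eta u) c) t (twopii * l * c * qpow (eta t) c).
  apply: curve_derivative_cexp.
  rewrite (_ : (fun u => _) = (fun u => twopii * c * val (eta u))).
    by apply: curve_derivative_eq (curve_derivativeZ _ de) _; ring.
  by apply/funext => u; rewrite mulrAC.
have q1 := cabs_nome_lt1 (eta t).
have dp := curve_derivative_psum ra q1 (dq 1).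
apply: curve_derivative_eq (curve_derivativeM (dq s) dp) _.
rewrite (psumD (rad1C s ra) (rad1_theta ra) q1) -psum_deriv// psumZ//.
rewrite -/(nome (eta t)); ring.
Qed.

Lemma rad1_expn p : rad1 (fun n => (n%:R : C) ^+ p).
Proof.
elim: p => [|p IHp].
  rewrite (_ : (fun n => _) = (fun=> 1)); first exact: rad1_const.
  by apply/funext => n; rewrite expr0.
rewrite (_ : (fun n => _) = fps_theta (fun n => (n%:R : C) ^+ p)).
  exact: rad1_theta.
by apply/funext => n; rewrite exprS.
Qed.

Lemma sigmaE p n : (0 < n)%N ->
  sigma p n = (\sum_(1 <= d < n.+1 | (d %| n)%N) d ^ p)%N.
Proof.
move=> n0; rewrite /sigma -[RHS]big_filter; apply: perm_big.
apply: uniq_perm; rewrite ?divisors_uniq ?filter_uniq ?iota_uniq// => d.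
rewrite -dvdn_divisors// mem_filter mem_index_iota; case dn: (d %| n)%N => //=.
by rewrite ltnS (dvdn_leq n0 dn) (dvdn_gt0 n0 dn).
Qed.

Lemma sigma_le p n : (sigma p n.+1 <= n.+1 ^ p.+1)%N.
Proof.
rewrite sigmaE// big_mkcond /=.
apply: leq_trans (_ : \sum_(1 <= d < n.+2) n.+1 ^ p <= _)%N.
  rewrite big_nat_cond [X in (_ <= X)%N]big_nat_cond.
  apply: leq_sum => d /andP[/andP[_ dn] _].
  by case: ifP => // _; case: p => // p; rewrite leq_exp2r.
by rewrite sum_nat_const_nat subn1 /= expnS.
Qed.

Definition eisenstein_fps k : fps C := fun n =>
  if n == 0%N then 2 * zeta (2 * k)%N
  else 2 * twopii ^+ (2 * k)%N / ((2 * k - 1)`!)%N%:R * (sigma (2 * k - 1)%N n)%:R.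

Lemma rad1_eisenstein k : rad1 (eisenstein_fps k).
Proof.
pose p := (2 * k - 1)%N.
pose c : C := 2 * twopii ^+ (2 * k)%N / (p`!)%N%:R.
have -> : eisenstein_fps k = fpsC (2 * zeta (2 * k)%N) +
    fpsC c * (fun n => if n == 0%N then 0 else (sigma p n)%:R).
  apply: fps_ext => n; rewrite fpsD fpsCM /eisenstein_fps /fpsC.
  case: n => [|n] /=; last by rewrite add0r.
  by rewrite mulr0 addr0.
apply: rad1D.
  exact: rad1_fpsC.
apply: rad1C; apply: rad1_le (rad1_expn p.+1) _ => -[|n].
  by rewrite cabs0 cabs_ge0.
by rewrite cabsX !cabs_nat -natrX ler_nat sigma_le.
Qed.

Lemma eisensteinE k tau : eisenstein k tau = psum (eisenstein_fps k) (nome tau).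
Proof.
pose p := (2 * k - 1)%N.
pose c : C := 2 * twopii ^+ (2 * k)%N / (p`!)%N%:R.
pose b : fps C := fun n => (sigma p n.+1)%:R.
have q1 := cabs_nome_lt1 tau.
have H := psumP (rad1_eisenstein k) q1.
have bE : c * limn (series (fun n => b n * qpow tau n.+1%:R)) + 2 * zeta (2 * k)%N
    = psum (eisenstein_fps k) (nome tau).
  have rb : rad1 (fpsX * b).
    apply: rad1_le (rad1_expn p.+1) _ => -[|n].
      by rewrite fpsXM0 cabs0 cabs_ge0.
    by rewrite fpsXM cabsX !cabs_nat -natrX ler_nat sigma_le.
  have S1 N : series (fun n => b n * qpow tau n.+1%:R) N
      = series (fun n => (fpsX * b) n * nome tau ^+ n) (N + 1)%N.
    elim: N => [|N IHN].
      by rewrite add0n series_recr !series0n fpsXM0 mul0r addr0.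
    by rewrite addSn !series_recr IHN addn1 fpsXM nomeX.
  have L1 : series (fun n => b n * qpow tau n.+1%:R) @ \oo --> psum (fpsX * b) (nome tau).
    rewrite (_ : series _ = (fun N =>
      series (fun n => (fpsX * b) n * nome tau ^+ n) (N + 1)%N)); last first.
      exact/funext/S1.
    apply/cvgC_cabs; rewrite (cvg_shiftn 1 (fun N => cabs (psum (fpsX * b) (nome tau)
       - series (fun n => (fpsX * b) n * nome tau ^+ n) N))).
    exact/cvgC_cabs/psumP.
  rewrite (cvgC_lim L1).
  have -> : eisenstein_fps k = fpsC c * (fpsX * b) + fpsC (2 * zeta (2 * k)%N).
    apply: fps_ext => -[|n]; rewrite fpsD fpsCM /fpsC /=.
      by rewrite fpsXM0 mulr0 add0r.
    by rewrite fpsXM addr0.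
  rewrite psumD ?psumZ ?psum_fpsC//; [exact: rad1C|exact: rad1_fpsC].
by rewrite -bE addrC /eisenstein.
Qed.

Lemma eisenstein_bounded k (y : R) : 0 < y ->
  exists B, forall tau, y <= complex.Im (val tau) -> cabs (eisenstein k tau) <= B.
Proof.
move=> y0; have [|B eB] := psum_bounded (r := expR (- (2 * pi * y))) (rad1_eisenstein k).
  by rewrite expR_ge0 /= -expR0 ltr_expR oppr_lt0 !mulr_gt0 ?pi_gt0.
by exists B => tau /cabs_nome_le; rewrite eisensteinE; apply: eB.
Qed.

End QSeries.

(** * Traces on finite-dimensional subspaces *)

Section FiniteSums.
Variables (E : nmodType).

Lemma fsbig_nat_trunc (F : nat -> E) N : (forall j, (N <= j)%N -> F j = 0) ->
  \sum_(j \in [set: nat]) F j = \sum_(j < N) F j.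
Proof.
move=> FN; rewrite fsbig_ord; apply/esym/fsbig_widen => // j [_ /= /negP].
by rewrite -leqNgt => /FN.
Qed.

Lemma fsbig_pos_trunc (F : nat -> E) N : (forall j, (N < j)%N -> F j = 0) ->
  \sum_(j \in [set k : nat | (1 <= k)%N]) F j = \sum_(j < N) F j.+1.
Proof.
move=> FN; pose G j := if (0 < j)%N then F j else 0.
transitivity (\sum_(j \in [set: nat]) G j).
  rewrite fsbig_mkcond; apply: eq_fsbigr => j _.
  rewrite /patch /G; case: ifPn => [|].
    by rewrite inE /= => ->.
  by rewrite notin_setE /= => /negP/negbTE ->.
rewrite (@fsbig_nat_trunc _ N.+1) => [|j Nj]; last first.
  by rewrite /G; case: ifP => // _; exact: FN.
by rewrite big_ord_recl /= add0r.
Qed.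

End FiniteSums.

Section LinearMaps.
Variable K : nzRingType.
Variables (E F : lmodType K) (f : E -> F).
Hypothesis lf : linear f.

Lemma lin0 : f 0 = 0.
Proof.
have := lf 1 0 0; rewrite !scale1r addr0 => /eqP.
by rewrite -subr_eq subrr eq_sym => /eqP.
Qed.

Lemma linD x y : f (x + y) = f x + f y.
Proof. by have := lf 1 x y; rewrite !scale1r. Qed.

Lemma linZ a x : f (a *: x) = a *: f x.
Proof. by have := lf a x 0; rewrite lin0 !addr0. Qed.

Lemma linN x : f (- x) = - f x.
Proof. by rewrite -scaleN1r linZ scaleN1r. Qed.

Lemma linB x y : f (x - y) = f x - f y.
Proof. by rewrite linD linN. Qed.

Lemma lin_sum I (r : seq I) (P : pred I) (G : I -> E) :
  f (\sum_(i <- r | P i) G i) = \sum_(i <- r | P i) f (G i).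
Proof. by apply: (big_morph f) => [x y|]; rewrite ?linD ?lin0. Qed.

End LinearMaps.

Section Span.
Variable R : realType.
Local Notation C := R[i].
Variable E : lmodType C.
Implicit Types (S T : set E) (s : seq E).

Lemma subspaceD S x y : subspace S -> S x -> S y -> S (x + y).
Proof. by move=> [_ SD] Sx Sy; rewrite -[x]scale1r; apply: SD. Qed.

Lemma subspaceZ S a x : subspace S -> S x -> S (a *: x).
Proof. by move=> [S0 SD] Sx; rewrite -[_ *: _]addr0; apply: SD. Qed.

Lemma subspace_sum S I (r : seq I) (P : pred I) (G : I -> E) : subspace S ->
  (forall i, P i -> S (G i)) -> S (\sum_(i <- r | P i) G i).
Proof.
move=> sS SG; apply: big_ind => //; first by case: sS.
by move=> x y; apply: subspaceD.
Qed.

Lemma span_subspace S : subspace (span S).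
Proof.
split; first by move=> T [T0 _] _.
move=> a x y Sx Sy T sT ST; case: (sT) => _; apply; first exact: Sx.
exact: Sy.
Qed.

Lemma span_incl S : S `<=` span S.
Proof. by move=> x Sx T _; apply. Qed.

Lemma span_min S T : subspace T -> S `<=` T -> span S `<=` T.
Proof. by move=> sT ST x; apply. Qed.

Lemma span_mono S T : S `<=` T -> span S `<=` span T.
Proof.
move=> ST; apply: span_min; first exact: span_subspace.
by apply: subset_trans ST _; exact: span_incl.
Qed.

Lemma span_seq s x : span [set y | y \in s] x ->
  exists c : 'I_(size s) -> C, x = \sum_i c i *: s`_i.
Proof.
pose T := [set x | exists c : 'I_(size s) -> C, x = \sum_i c i *: s`_i].
apply: (span_min (T := T)).
  split; first by exists (fun=> 0); rewrite big1// => i _; rewrite scale0r.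
  move=> a _ _ [c ->] [d ->]; exists (fun i => a * c i + d i).
  rewrite scaler_sumr -big_split; apply: eq_bigr => i _.
  by rewrite scalerDl scalerA.
move=> y /= ys; have iy : (index y s < size s)%N by rewrite index_mem.
exists (fun i => (i == Ordinal iy)%:R).
rewrite (bigD1 (Ordinal iy))//= eqxx scale1r nth_index// big1 ?addr0// => i.
by move=> /negbTE ->; rewrite scale0r.
Qed.

Lemma generators_basis S d (g : 'I_d -> E) :
  S = [set x | exists c : 'I_d -> C, x = \sum_i c i *: g i] ->
  exists d' (b : 'I_d' -> E), is_basis S b.
Proof.
elim: d g => [|d IHd] g Sg.
  by exists 0%N, g; split => // c _ [].
have [ind|] := pselect (forall c : 'I_d.+1 -> C, \sum_i c i *: g i = 0 -> forall i, c i = 0).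
  by exists d.+1, g.
move=> /existsNP[c /not_implyP[c0 /existsNP[k /eqP ck]]].
apply: (IHd (fun j => g (lift k j))).
rewrite Sg; apply/seteqP; split => x /= [a ->]; last first.
  exists (fun i => if unlift k i is Some j then a j else 0).
  rewrite [RHS](bigD1_ord k)//= unlift_none scale0r add0r.
  by apply: eq_bigr => j _; rewrite liftK.
have gk : g k = - \sum_j ((c k)^-1 * c (lift k j)) *: g (lift k j).
  move: c0; rewrite (bigD1_ord k)//= => /eqP; rewrite addr_eq0 => /eqP E1.
  rewrite -[g k]scale1r -(mulVf ck) -scalerA E1 scalerN scaler_sumr.
  by congr (- _); apply: eq_bigr => j _; rewrite scalerA.
exists (fun j => a (lift k j) - a k * ((c k)^-1 * c (lift k j))).
rewrite (bigD1_ord k)//= gk scalerN scaler_sumr addrC -sumrB.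
by apply: eq_bigr => j _; rewrite scalerBl scalerA.
Qed.

Lemma basis_mem S d (b : 'I_d -> E) i : is_basis S b -> S (b i).
Proof.
move=> [-> _]; exists (fun j => (j == i)%:R).
rewrite (bigD1 i)//= eqxx scale1r big1 ?addr0// => j /negbTE ->.
by rewrite scale0r.
Qed.

Lemma basis_subspace S d (b : 'I_d -> E) : is_basis S b -> subspace S.
Proof.
move=> [-> _]; split; first by exists (fun=> 0); rewrite big1// => i _; rewrite scale0r.
move=> a _ _ [c ->] [e ->]; exists (fun i => a * c i + e i).
rewrite scaler_sumr -big_split; apply: eq_bigr => i _.
by rewrite scalerDl scalerA.
Qed.

Lemma basis_coords S d (b : 'I_d -> E) : is_basis S b ->
  exists c : 'I_d -> E -> C, (forall x, S x -> x = \sum_i c i x *: b i) /\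
    forall (a : 'I_d -> C) i, c i (\sum_j a j *: b j) = a i.
Proof.
move=> [SE ind].
pose P x (a : 'I_d -> C) := S x -> x = \sum_i a i *: b i.
have [c cP] : {c : E -> 'I_d -> C & forall x, P x (c x)}.
  apply: choice => x; have [Sx|nSx] := pselect (S x).
    by move: (Sx); rewrite {1}SE => -[a ->]; exists a => _.
  by exists (fun=> 0) => /nSx.
exists (fun i x => c x i); split=> [x|a i]; first exact: cP.
have Sa : S (\sum_j a j *: b j) by rewrite SE; exists a.
have /eqP := cP _ Sa; rewrite -subr_eq0 -sumrB => /eqP E1.
have := ind (fun j => a j - c (\sum_j a j *: b j) j) _ i.
rewrite (_ : \sum_i _ = 0) => [|]; first by move=> /(_ erefl)/eqP; rewrite subr_eq0 => /eqP.
by rewrite -[RHS]E1; apply: eq_bigr => j _; rewrite scalerBl.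
Qed.

End Span.

Section Trace.
Variable R : realType.
Local Notation C := R[i].

Let coord_sum (E : lmodType C) (S : set E) d (b : 'I_d -> E)
  (c : 'I_d -> E -> C) (bS : is_basis S b)
  (cS : forall x, S x -> x = \sum_i c i x *: b i)
  (cE : forall (a : 'I_d -> C) i, c i (\sum_j a j *: b j) = a i)
  n (a : 'I_n -> C) (x : 'I_n -> E) i : (forall j, S (x j)) ->
  c i (\sum_j a j *: x j) = \sum_j a j * c i (x j).
Proof.
move=> Sx; under eq_bigr => j _ do rewrite (cS _ (Sx j)) scaler_sumr.
rewrite exchange_big /=.
under eq_bigr => k _ do under eq_bigr => j _ do rewrite scalerA.
under eq_bigr => k _ do rewrite -scaler_suml.
by rewrite cE.
Qed.

(* Both sides are the trace of the product of the matrices of [f] and [g], up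
   to the order of the factors. *)
Let coord_cyclic (E E' : lmodType C) (S : set E) (S' : set E')
  d (b : 'I_d -> E) (c : 'I_d -> E -> C)
  d' (b' : 'I_d' -> E') (c' : 'I_d' -> E' -> C)
  (bS : is_basis S b) (cS : forall x, S x -> x = \sum_i c i x *: b i)
  (cE : forall (a : 'I_d -> C) i, c i (\sum_j a j *: b j) = a i)
  (bS' : is_basis S' b') (cS' : forall x, S' x -> x = \sum_i c' i x *: b' i)
  (cE' : forall (a : 'I_d' -> C) i, c' i (\sum_j a j *: b' j) = a i)
  (f : E -> E') (g : E' -> E) : linear f -> linear g ->
  (forall x, S x -> S' (f x)) -> (forall x, S' x -> S (g x)) ->
  \sum_i c i (g (f (b i))) = \sum_i c' i (f (g (b' i))).
Proof.
move=> lf lg fS gS.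
transitivity (\sum_i \sum_j c' j (f (b i)) * c i (g (b' j))).
  apply: eq_bigr => i _; rewrite {1}(cS' (f (b i))); last exact/fS/(basis_mem i bS).
  rewrite (lin_sum lg); under eq_bigr => j _ do rewrite (linZ lg).
  by apply: (coord_sum bS cS cE) => j; apply: gS; apply: basis_mem bS'.
rewrite exchange_big /=; apply: eq_bigr => j _.
rewrite {2}(cS (g (b' j))); last exact/gS/(basis_mem j bS').
rewrite (lin_sum lf); under [in RHS]eq_bigr => i _ do rewrite (linZ lf).
rewrite (coord_sum bS' cS' cE'); first by apply: eq_bigr => i _; rewrite mulrC.
by move=> i; apply: fS; apply: basis_mem bS.
Qed.

(** [trace_on] chooses some value realised by a basis. Independence of the basis is [coord_cyclic]
    for the maps [id] and [f] and two bases of the same subspace. *)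
Lemma trace_onE (E : lmodType C) (S : set E) d (b : 'I_d -> E)
  (c : 'I_d -> E -> C) (bS : is_basis S b)
  (cS : forall x, S x -> x = \sum_i c i x *: b i)
  (cE : forall (a : 'I_d -> C) i, c i (\sum_j a j *: b j) = a i)
  (f : E -> E) : linear f -> (forall x, S x -> S (f x)) ->
  trace_on S f = \sum_i c i (f (b i)).
Proof.
move=> lf fS; rewrite /trace_on; set X := [set t | _].
have X1 t : X t -> t = \sum_i c i (f (b i)).
  move=> [d' [b' [A [bS' fA ->]]]].
  have [c' [cS' cE']] := basis_coords bS'.
  have -> : \tr A = \sum_j c' j (f (b' j)).
    by apply: eq_bigr => j _; rewrite fA cE'.
  by apply: (coord_cyclic bS' cS' cE' bS cS cE (f := id) (g := f)).
have X0 : X (\sum_i c i (f (b i))).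
  exists d, b, (\matrix_(i, j) c i (f (b j))); split => //.
    move=> j; rewrite {1}(cS (f (b j))); last exact/fS/(basis_mem j bS).
    by apply: eq_bigr => i _; rewrite mxE.
  by apply: eq_bigr => i _; rewrite mxE.
by apply: X1; apply: (xgetPex 0); exists (\sum_i c i (f (b i))).
Qed.

Definition has_basis (E : lmodType C) (S : set E) :=
  exists d (b : 'I_d -> E), is_basis S b.

Lemma trace_on_cyclic (E E' : lmodType C) (S : set E) (S' : set E')
    (f : E -> E') (g : E' -> E) : has_basis S -> has_basis S' ->
  linear f -> linear g ->
  (forall x, S x -> S' (f x)) -> (forall x, S' x -> S (g x)) ->
  trace_on S (fun x => g (f x)) = trace_on S' (fun x => f (g x)).
Proof.
move=> [d [b bS]] [d' [b' bS']] lf lg fS gS.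
have [c [cS cE]] := basis_coords bS; have [c' [cS' cE']] := basis_coords bS'.
rewrite (trace_onE bS cS cE); last 2 first.
- by move=> a x y; rewrite lf lg.
- by move=> x /fS/gS.
rewrite (trace_onE bS' cS' cE'); last 2 first.
- by move=> a x y; rewrite lg lf.
- by move=> x /gS/fS.
exact: (coord_cyclic bS cS cE bS' cS' cE' lf lg fS gS).
Qed.

Lemma trace_on_eq (E : lmodType C) (S : set E) (f g : E -> E) : has_basis S ->
  linear f -> linear g -> (forall x, S x -> S (f x)) ->
  (forall x, S x -> f x = g x) -> trace_on S f = trace_on S g.
Proof.
move=> [d [b bS]] lf lg fS fg; have [c [cS cE]] := basis_coords bS.
rewrite !(trace_onE bS cS cE)//; last by move=> x Sx; rewrite -fg//; exact: fS.
by apply: eq_bigr => i _; rewrite fg//; apply: basis_mem bS.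
Qed.

Lemma trace_on_comb (E : lmodType C) (S : set E) n (a : 'I_n -> C)
    (f : 'I_n -> E -> E) : has_basis S ->
  (forall i, linear (f i)) -> (forall i x, S x -> S (f i x)) ->
  trace_on S (fun x => \sum_i a i *: f i x) = \sum_i a i * trace_on S (f i).
Proof.
move=> [d [b bS]] lf fS; have [c [cS cE]] := basis_coords bS.
rewrite (trace_onE bS cS cE); last 2 first.
- move=> k x y; rewrite scaler_sumr -big_split; apply: eq_bigr => i _.
  by rewrite lf scalerDr !scalerA mulrC.
- move=> x Sx; apply: subspace_sum => [|i _]; first exact: basis_subspace bS.
  by apply: subspaceZ; [exact: basis_subspace bS|exact: fS].
under [RHS]eq_bigr => i _ do rewrite (trace_onE bS cS cE (lf i) (fS i)) mulr_sumr.
rewrite exchange_big /=; apply: eq_bigr => j _.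
by apply: (coord_sum bS cS cE) => i; apply: fS; apply: basis_mem bS.
Qed.

Lemma trace_onD (E : lmodType C) (S : set E) (f g : E -> E) : has_basis S ->
  linear f -> linear g -> (forall x, S x -> S (f x)) -> (forall x, S x -> S (g x)) ->
  trace_on S (fun x => f x + g x) = trace_on S f + trace_on S g.
Proof.
move=> hS lf lg fS gS.
pose h (i : 'I_2) := if i == 0 then f else g.
have := @trace_on_comb E S 2 (fun=> 1) h hS.
rewrite !big_ord_recl !big_ord0 !addr0 !mul1r /= => <-.
- congr trace_on; apply/funext => x.
  by rewrite !big_ord_recl big_ord0 addr0 !scale1r.
- by move=> i; rewrite /h; case: ifP.
- by move=> i x; rewrite /h; case: ifP => _; auto.
Qed.

Lemma trace_on_scale (E : lmodType C) (S : set E) (k : C) : has_basis S ->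
  forall f, linear f -> (forall x, S x -> S (f x)) ->
  trace_on S (fun x => k *: f x) = k * trace_on S f.
Proof.
move=> hS f lf fS.
have := @trace_on_comb E S 1 (fun=> k) (fun=> f) hS (fun=> lf) (fun=> fS).
by rewrite big_ord1 => <-; congr trace_on; apply/funext => x; rewrite big_ord1.
Qed.

Lemma trace_on0 (E : lmodType C) (S : set E) (f : E -> E) : has_basis S ->
  linear f -> (forall x, S x -> f x = 0) -> trace_on S f = 0.
Proof.
move=> hS lf f0; have [d [b bS]] := hS.
have [S0 _] := basis_subspace bS.
have lz : linear (fun x => 0 *: f x) by move=> a x y; rewrite !scale0r scaler0 addr0.
rewrite (@trace_on_eq E S f (fun x => 0 *: f x)) => //.
- by rewrite trace_on_scale ?mul0r// => x /f0 ->.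
- by move=> x /f0 ->.
- by move=> x /f0 ->; rewrite scaler0.
Qed.

End Trace.

(** * Graded modules and square-bracket modes *)

Section Gradings.
Variable R : realType.
Local Notation C := R[i].
Variables (E : lmodType C) (G : grading E).

Lemma gproj_piece n x : gpiece G n (gproj G n x).
Proof. by rewrite /gpiece /= gprojK eqxx. Qed.

Lemma gproj_id m n x : gpiece G n x -> gproj G m x = if m == n then x else 0.
Proof. by move=> xn; rewrite -[in LHS]xn gprojK; case: eqP => // ->. Qed.

Lemma gpiece_subspace n : subspace (gpiece G n).
Proof.
split; first exact/lin0/gproj_linear.
by move=> a x y xn yn; rewrite /gpiece /= (gproj_linear G) xn yn.
Qed.

Lemma gproj_finite x : exists N, forall n, (N <= n)%N -> gproj G n x = 0.
Proof.
have [N xE] := gproj_sum G x; exists N => n Nn.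
rewrite xE (lin_sum (gproj_linear G n)) big1// => i _.
by rewrite gprojK gtn_eqF// (leq_trans (ltn_ord i)).
Qed.

Lemma gproj_sum_trunc x N : (forall n, (N <= n)%N -> gproj G n x = 0) ->
  x = \sum_(n < N) gproj G n x.
Proof.
move=> xN; have [N' xE] := gproj_sum G x.
rewrite [LHS]xE -!(big_mkord xpredT (fun n => gproj G n x)).
have [NN|NN] := leqP N N'.
  rewrite (big_cat_nat (leq0n N) NN) /= [X in _ + X]big_nat_cond [X in _ + X]big1 ?addr0//.
  by move=> i /andP[/andP[/xN]].
rewrite [RHS](big_cat_nat (leq0n N') (ltnW NN)) /=.
rewrite [X in _ + X]big_nat_cond [X in _ + X]big1 ?addr0//.
move=> i /andP[/andP[Ni _] _]; rewrite xE (lin_sum (gproj_linear G i)) big1// => j _.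
by rewrite gprojK gtn_eqF// (leq_trans (ltn_ord j)).
Qed.

Lemma gpiecez_neg d x : gpiecez G d x -> d < 0 -> x = 0.
Proof. by case: d. Qed.

Lemma gpiecez_nat d n x : gpiecez G d x -> d = n%:Z -> gpiece G n x.
Proof. by move=> + dn; rewrite dn. Qed.

End Gradings.

Section Modules.
Variable R : realType.
Local Notation C := R[i].
Variables (V : VOA R) (M : admissible_module V).

Lemma mmode_linl n u : linear (fun a : V => mmode a n u : M).
Proof. by case: (mmode_bilinear M) => + _; apply. Qed.

Lemma mmode_linr (a : V) n : linear (mmode a n : M -> M).
Proof. by case: (mmode_bilinear M) => _; apply. Qed.

Lemma mmode0l n u : mmode (0 : V) n u = 0 :> M.
Proof. exact: (lin0 (mmode_linl n u)). Qed.

Lemma mmode_trunc_nat (a : V) (k : int) (u : M) :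
  exists N, forall j, (N <= j)%N -> mmode a (k + j%:Z) u = 0.
Proof.
have [N H] := mmode_truncated a u; exists `|N - k|%N => j Nj; apply: H; lia.
Qed.

(** The step of an induction on degrees: if wt a = k and deg w = l, then a_(-2) w has degree k + 1 +
    l, so l < n. It serves twice, for the dimension of M(n) and for the generation of conformal
    blocks. *)
Lemma C2_piece (U : set M) n (Q : set M) : graded (mgrading M) U ->
  (forall x, exists u y, [/\ U u, C2 (M := M) y & x = u + y]) ->
  subspace Q -> (forall u, U u -> gpiece (mgrading M) n u -> Q u) ->
  (forall k l a w, gpiece (vgrading V) k a -> gpiece (mgrading M) l w ->
     (k + 1 + l = n)%N -> Q (mmode a (-2) w)) ->
  forall x, gpiece (mgrading M) n x -> Q x.
Proof.
move=> gU decU sQ QU QC x xn.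
have lg := gproj_linear (mgrading M) n.
have [u [y [Uu Cy xE]]] := decU x.
rewrite -xn xE (linD lg); apply: subspaceD => //.
  by apply: QU; [exact: gU|exact: gproj_piece].
move: y Cy {xE}; apply: span_min => [|_ [a [v ->]] /=].
  split; first by rewrite (lin0 lg); case: sQ.
  by move=> k y z Qy Qz; rewrite lg; case: sQ => _; apply.
have [K /gproj_sum_trunc aE] := gproj_finite (vgrading V) a.
have [L /gproj_sum_trunc vE] := gproj_finite (mgrading M) v.
rewrite aE (lin_sum (mmode_linl _ _)) (lin_sum lg).
apply: subspace_sum => // k _; rewrite vE (lin_sum (mmode_linr _ _)) (lin_sum lg).
apply: subspace_sum => // l _.
have pk := gproj_piece (vgrading V) k a; have pl := gproj_piece (mgrading M) l v.
have := mmode_degree (-2) pk pl; move=> /(gpiecez_nat (n := (k + 1 + l)%N)) H.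
rewrite (gproj_id _ (H _)); last by lia.
by case: eqP => [nE|_]; [apply: QC pk pl _|case: sQ].
Qed.

Let FG (E : lmodType C) (T : set E) := exists s : seq E, T `<=` span [set x | x \in s].

Let FG_union (E : lmodType C) n (T : 'I_n -> set E) : (forall i, FG (T i)) ->
  exists s : seq E, forall i, T i `<=` span [set x | x \in s].
Proof.
elim: n T => [|n IHn] T FT; first by exists [::] => -[].
have [s sP] := IHn (fun i => T (lift ord0 i)) (fun i => FT _).
have [r rP] := FT ord0.
exists (r ++ s) => i; case: (unliftP ord0 i) => [j ->|->].
  apply: subset_trans (sP j) _; apply: span_mono => x /= xs.
  by rewrite mem_cat xs orbT.
apply: subset_trans rP _; apply: span_mono => x /= xr.
by rewrite mem_cat xr.
Qed.

Let FG_bilinear (E E' F : lmodType C) (f : E -> E' -> F) (T : set E) (T' : set E') :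
  (forall y, linear (f^~ y)) -> (forall x, linear (f x)) -> FG T -> FG T' ->
  FG [set z | exists x y, [/\ T x, T' y & z = f x y]].
Proof.
move=> fl fr [s sP] [s' sP']; exists [seq f x y | x <- s, y <- s'].
move=> _ [x [y [/sP Tx /sP' Ty ->]]].
set Q := span _; have sQ : subspace Q by apply: span_subspace.
have := span_min (T := [set x | Q (f x y)]) _ _ Tx; apply.
  split; first by rewrite /= (lin0 (fl y)); case: sQ.
  by move=> a u v Qu Qv; rewrite /= fl; case: sQ => _; apply.
move=> {Tx} {}x xs /=.
have := span_min (T := [set y | Q (f x y)]) _ _ Ty; apply.
  split; first by rewrite /= (lin0 (fr x)); case: sQ.
  by move=> a u v Qu Qv; rewrite /= fr; case: sQ => _; apply.
move=> {Ty} {}y ys /=; apply: span_incl => /=.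
exact: allpairs_f.
Qed.

(** M(n) is covered by the finite-dimensional complement together with the products a_(-2) w, where
    w has smaller degree and a lies in one of finitely many finite-dimensional V_k. *)
Lemma mpiece_basis n : vir_C2_complement M -> has_basis (gpiece (mgrading M) n).
Proof.
move=> [U [sU [sU0 UE] gU _ [decU _]]].
suff [s sP] : FG (gpiece (mgrading M) n).
  (* The vectors of [s] need not be homogeneous; their components of degree n lie in the piece and
     span it. *)
  apply: (@generators_basis _ _ _ (size s) (fun i => gproj (mgrading M) n s`_i)).
  apply/seteqP; split=> [x xn /=|_ [c ->]].
    have [c cE] := span_seq (sP x xn); exists c.
    rewrite -[LHS]xn {1}cE (lin_sum (gproj_linear _ _)).
    by apply: eq_bigr => i _; rewrite (linZ (gproj_linear _ _)).
  apply: subspace_sum; first exact: gpiece_subspace.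
  by move=> i _; apply: subspaceZ; [exact: gpiece_subspace|exact: gproj_piece].
elim/ltn_ind: n => n IHn.
have FV k : FG (gpiece (vgrading V) k) by have [s ->] := @vgrading_finite _ V k; exists s.
pose T (i : 'I_n) := [set z | exists (x : V) (y : M), [/\ gpiece (vgrading V) (n - i.+1)%N x,
   gpiece (mgrading M) i y & z = mmode x (-2) y]].
have [s sP] : exists s : seq M, forall i, T i `<=` span [set x | x \in s].
  apply: FG_union => i.
  apply: (FG_bilinear (f := fun (x : V) (y : M) => mmode x (-2) y)) => //.
  - by move=> y; apply: mmode_linl.
  - by move=> x; apply: mmode_linr.
  - exact: IHn.
exists (sU0 ++ s) => x xn; apply: (C2_piece gU decU _ _ _ xn).
- exact: span_subspace.
- move=> u; rewrite UE => + _; apply: span_mono => y /= yU.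
  by rewrite mem_cat yU.
- move=> k l a w ak wl kl; have ln : (l < n)%N by lia.
  have /(@span_mono _ _ _ [set x | x \in sU0 ++ s]) H :
      [set y | y \in s] `<=` [set x | x \in sU0 ++ s].
    by move=> y /= ys; rewrite mem_cat ys orbT.
  apply: H; apply: (sP (Ordinal ln)); exists a, w; split => //=.
  by rewrite (_ : (n - l.+1)%N = k)//; lia.
Qed.

End Modules.

Section SquareModes.
Variable R : realType.
Local Notation C := R[i].
Variables (V : VOA R) (W : admissible_module V).
Implicit Types (a : V) (v : W) (n : int).

Lemma uniform_bound K (P : nat -> nat -> Prop) :
  (forall k, (k < K)%N -> exists N, forall j, (N <= j)%N -> P k j) ->
  exists N, forall k j, (k < K)%N -> (N <= j)%N -> P k j.
Proof.
elim: K => [|K IHK] H; first by exists 0%N.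
have [k kK|N NP] := IHK; first by apply: H; rewrite ltnW.
have [N' N'P] := H K (leqnn _).
exists (maxn N N') => k j; rewrite ltnS geq_max leq_eqVlt => /orP[/eqP ->|kK] /andP[Nj N'j].
  exact: N'P.
exact: NP.
Qed.

Definition sqmode_partial K J a n v : W :=
  twopii ^ (- n - 1) *: \sum_(k < K) \sum_(j < J)
    laurent_coef (- n - j%:Z - 1) k j *: mmode (gproj (vgrading V) k a) (n + j%:Z) v.

Lemma sqmode_trunc a n v : exists N, forall K J, (N <= K)%N -> (N <= J)%N ->
  sqmode a n v = sqmode_partial K J a n v.
Proof.
have [K0 aK] := gproj_finite (vgrading V) a.
have [J0 vJ] := @uniform_bound K0 (fun k j => mmode (gproj (vgrading V) k a) (n + j%:Z) v = 0)
  (fun k _ => mmode_trunc_nat _ n v).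
have z k j : (J0 <= j)%N -> mmode (gproj (vgrading V) k a) (n + j%:Z) v = 0.
  by move=> Jj; case: (ltnP k K0) => [kK|/aK ->]; [exact: vJ|exact: mmode0l].
exists (maxn K0 J0) => K J; rewrite !geq_max => /andP[KK _] /andP[_ JJ].
rewrite /sqmode /sqmode_partial; congr (_ *: _).
rewrite (@fsbig_nat_trunc _ _ K) => [|k Kk].
  apply: eq_bigr => k _; apply: fsbig_nat_trunc => j Jj.
  by rewrite z ?scaler0// (leq_trans JJ).
rewrite (@fsbig_nat_trunc _ _ 0) ?big_ord0// => j _.
by rewrite aK ?(leq_trans KK)// mmode0l scaler0.
Qed.

Lemma sqmode_linl n v : linear (fun a => sqmode a n v : W).
Proof.
move=> c a b; have [N1 E1] := sqmode_trunc a n v; have [N2 E2] := sqmode_trunc b n v.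
have [N3 E3] := sqmode_trunc (c *: a + b) n v.
pose N := (N1 + N2 + N3)%N.
rewrite (E1 N N) ?(E2 N N) ?(E3 N N) /N; try lia.
rewrite /sqmode_partial !scaler_sumr -big_split; apply: eq_bigr => k _ /=.
rewrite !scaler_sumr -big_split; apply: eq_bigr => j _ /=.
rewrite (gproj_linear _ _) (mmode_linl _ _) !scalerDr !scalerA.
by congr (_ *: _ + _); ring.
Qed.

Lemma sqmode_piece k a n v J : gpiece (vgrading V) k a ->
  (forall j, (J <= j)%N -> mmode a (n + j%:Z) v = 0) ->
  sqmode a n v = twopii ^ (- n - 1) *:
    \sum_(j < J) laurent_coef (- n - j%:Z - 1) k j *: mmode a (n + j%:Z) v.
Proof.
move=> ak aJ; rewrite /sqmode; congr (_ *: _).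
have z i j : (i != k) || (J <= j)%N ->
    mmode (gproj (vgrading V) i a) (n + j%:Z) v = 0.
  rewrite (gproj_id _ ak); case: eqP => [_|_ _] /=; first exact: aJ.
  exact: mmode0l.
rewrite (@fsbig_nat_trunc _ _ k.+1) => [|i ki]; last first.
  rewrite (@fsbig_nat_trunc _ _ 0) ?big_ord0// => j _.
  by rewrite z ?scaler0// gtn_eqF.
rewrite big_ord_recr /= big1 => [|i _].
  rewrite add0r (@fsbig_nat_trunc _ _ J) => [|j Jj].
    by apply: eq_bigr => j _; rewrite ak.
  by rewrite z ?scaler0// Jj orbT.
rewrite (@fsbig_nat_trunc _ _ 0) ?big_ord0// => j _.
by rewrite z ?scaler0// ltn_eqF.
Qed.

Lemma sqmode_trunc_nat a n v : exists N, forall j, (N <= j)%N ->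
  sqmode a (n + j%:Z) v = 0.
Proof.
have [K aE] := gproj_finite (vgrading V) a.
have [J vJ] := @uniform_bound K (fun k j => mmode (gproj (vgrading V) k a) (n + j%:Z) v = 0)
  (fun k _ => mmode_trunc_nat _ n v).
exists J => j Jj; rewrite (gproj_sum_trunc aE) (lin_sum (sqmode_linl _ _)) big1// => k _.
rewrite (@sqmode_piece k _ _ _ 0 (gproj_piece _ _ _)) ?big_ord0 ?scaler0// => i _.
by rewrite -addrA -PoszD vJ// (leq_trans Jj)// leq_addr.
Qed.

Lemma sqmode_vacuum n v : -1 <= n ->
  sqmode (vacuum V) n v = if n == -1 then v else 0.
Proof.
move=> n1; rewrite (@sqmode_piece 0 _ _ _ 1 (vacuum_weight V)) => [|j j1].
  rewrite big_ord1 addr0 subr0 mmode_vacuum; case: eqP => [->|_]; last by rewrite !scaler0.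
  rewrite opprK subrr expr0z scale1r (_ : laurent_coef _ _ _ = 1) ?scale1r//.
  by rewrite laurent_coefE fpsM0 expm1_pow_head /fps_exp expr0 fact0 divr1 mulr1.
by rewrite mmode_vacuum; case: eqP => //; lia.
Qed.

(** The shift of omega by c/24 times the vacuum only shows in L[-2], because Y[1, z] is the
    identity. *)
Lemma sqL_omega n v : -2 <= n -> sqL n v =
  twopii ^+ 2 *: (sqmode (omega V) (n + 1) v -
    (if n == -2 then (central_charge V / 24%:R) *: v else 0)).
Proof.
move=> n2; rewrite /sqL /omega_tilde.
rewrite (linZ (sqmode_linl _ _)) (linB (sqmode_linl _ _)) (linZ (sqmode_linl _ _)).
rewrite sqmode_vacuum; last by lia.
by congr (_ *: (_ - _)); do 2 case: eqP => ?; rewrite ?scaler0//; lia.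
Qed.

Lemma triangular_sum (E : nmodType) S (F : nat -> nat -> E) :
  (forall r j, (S <= r + j)%N -> F r j = 0) ->
  \sum_(r < S) \sum_(j < S) F r j = \sum_(s < S) \sum_(r < s.+1) F r (s - r)%N.
Proof.
move=> F0.
have -> : \sum_(r < S) \sum_(j < S) F r j = \sum_(r < S) \sum_(j < S - r) F r j.
  apply: eq_bigr => r _.
  rewrite [RHS](big_ord_widen S (F r)) ?leq_subr// [RHS]big_mkcond.
  by apply: eq_bigr => j _; case: ifPn => // /negP H; rewrite F0//; lia.
elim: S F {F0} => [|S IHS] F; first by rewrite !big_ord0.
rewrite [RHS]big_ord_recr /= -IHS.
rewrite [in X in _ = _ + X]big_ord_recr /= subnn.
rewrite big_ord_recr /= subSn// subnn big_ord1 addrA; congr (_ + _).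
rewrite -big_split /=; apply: eq_bigr => r _.
by rewrite subSn ?(ltnW (ltn_ord r))// big_ord_recr.
Qed.

Lemma twopii_neq0 : twopii != 0 :> C.
Proof.
by apply/eqP => /(congr1 (@complex.Im R)) /= /eqP; rewrite mulf_eq0 pnatr_eq0 /= gt_eqF ?pi_gt0.
Qed.

(** The left side is the residue of (1 + w)^(m+1) Y(omega, w) v dw, the right side that of 2 pi i
    e^(2 pi i m z) Y[omega, z] v dz; the substitution is [sum_laurent_coef_exp]. *)
Lemma omega_zexp_modes (m : int) v S : (forall j, (S <= j)%N -> mmode (omega V) j%:Z v = 0) ->
  \sum_(s < S) binz (m + 1) s *: mmode (omega V) s%:Z v =
  twopii *: \sum_(r < S) ((twopii * m%:~R) ^+ r / r`!%:R) *: sqmode (omega V) r%:Z v.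
Proof.
move=> vS.
pose F r j := (m%:~R ^+ r / r`!%:R * laurent_coef (- (r + j)%N%:Z - 1) 2 j : C)
  *: mmode (omega V) (r + j)%N%:Z v.
transitivity (\sum_(r < S) \sum_(j < S) F r j).
  rewrite triangular_sum => [|r j rj]; last by rewrite /F vS ?scaler0.
  apply: eq_bigr => s _; rewrite -sum_laurent_coef_exp scaler_suml.
  by apply: eq_bigr => r _; rewrite /F subnKC// -ltnS.
rewrite scaler_sumr; apply: eq_bigr => r _.
rewrite (@sqmode_piece 2 _ _ _ S (omega_weight V)) => [|j Sj].
  rewrite !scaler_sumr; apply: eq_bigr => j _; rewrite /F -PoszD !scalerA.
  congr (_ *: _).
  have -> : - r%:Z - j%:Z - 1 = - (r + j)%N%:Z - 1 by lia.
  have -> : twopii ^ (- r%:Z - 1) = twopii ^- r.+1 :> C.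
    by rewrite (_ : - r%:Z - 1 = - r.+1%:Z) ?exprnN//; lia.
  have t0 := twopii_neq0; have f0 := factC_neq0 R r.
  rewrite exprMn exprS; move: (laurent_coef _ _ _) (twopii ^+ r) (expf_neq0 r t0).
  by move=> l x x0; field; rewrite f0 x0 t0.
by rewrite -PoszD vS// (leq_trans Sj)// leq_addl.
Qed.

(** The analogous change of coordinate for the kernel (1 + w)/w, which becomes 2 pi i / (e^(2 pi i
    z) - 1) and brings in the coefficients of x/(e^x - 1). *)
Lemma omega_expm1_modes v S :
  (forall j, (S <= j)%N -> mmode (omega V) (j%:Z - 1) v = 0) -> (2 <= S)%N ->
  mmode (omega V) (-1) v + mmode (omega V) 0 v =
  \sum_(r < S) (expm1_pow R (-1) r * twopii ^+ r) *: sqmode (omega V) (r%:Z - 1) v.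
Proof.
move=> vS S2.
pose F r j := (expm1_pow R (-1) r * laurent_coef (- (r + j)%N%:Z) 2 j : C)
  *: mmode (omega V) ((r + j)%N%:Z - 1) v.
transitivity (\sum_(r < S) \sum_(j < S) F r j).
  rewrite triangular_sum => [|r j rj]; last by rewrite /F vS ?scaler0.
  transitivity (\sum_(s < S) binz 1 s *: mmode (omega V) (s%:Z - 1) v).
    case: S S2 {vS} => [|[|S]] // _; rewrite 2!big_ord_recl big1 => [|i _].
      by rewrite addr0 binz0 binz1 !scale1r.
    by rewrite binz_small ?scale0r.
  apply: eq_bigr => s _; rewrite -sum_laurent_coef_expm1_powV scaler_suml.
  by apply: eq_bigr => r _; rewrite /F subnKC// -ltnS.
apply: eq_bigr => r _.
rewrite (@sqmode_piece 2 _ _ _ S (omega_weight V)) => [|j Sj].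
  rewrite !scaler_sumr; apply: eq_bigr => j _; rewrite /F !scalerA.
  have -> : r%:Z - 1 + j%:Z = (r + j)%N%:Z - 1 by lia.
  congr (_ *: _).
  have -> : - (r%:Z - 1) - j%:Z - 1 = - (r + j)%N%:Z by lia.
  have -> : twopii ^ (- (r%:Z - 1) - 1) = twopii ^- r :> C.
    by rewrite (_ : - (r%:Z - 1) - 1 = - r%:Z) ?exprnN//; lia.
  by rewrite mulfK ?expf_neq0 ?twopii_neq0.
rewrite (_ : r%:Z - 1 + j%:Z = (r + j)%N%:Z - 1); last by lia.
by rewrite vS// (leq_trans Sj)// leq_addl.
Qed.

End SquareModes.

(** * Zhu's recursion for the Virasoro vector *)

Section Intertwining.
Variable R : realType.
Local Notation C := R[i].
Variables (V : VOA R) (W M : admissible_module V) (hW hM : C).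
Variable I : W -> int -> M -> M.
Hypothesis W_weight : conformal_weight W hW.
Hypothesis M_weight : conformal_weight M hM.
Hypothesis I_op : intertwining_operator hW I.
Hypothesis M_basis : forall n, has_basis (gpiece (mgrading M) n).
Implicit Types (a : V) (v : W) (u : M).

Local Notation om := (omega V).

Lemma op_linl n u : linear (fun v => I v n u).
Proof. by case: I_op => -[+ _] _ _ _; apply. Qed.

Lemma op_linr v n : linear (I v n).
Proof. by case: I_op => -[_ +] _ _ _; apply. Qed.

Lemma op0l n u : I 0 n u = 0.
Proof. exact: (lin0 (op_linl n u)). Qed.

Lemma op_commutator a v u (m k : int) J :
  (forall j, (J <= j)%N -> mmode a j%:Z v = 0) ->
  mmode a m (I v k u) - I v k (mmode a m u) =
  \sum_(j < J) binz m j *: I (mmode a j%:Z v) (m + k - j%:Z) u.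
Proof.
move=> vJ; case: I_op => _ _ _ /(_ a v u m 0 k).
rewrite (@fsbig_nat_trunc _ _ J) => [|j Jj]; last by rewrite add0r vJ// op0l scaler0.
rewrite (@fsbig_nat_trunc _ _ 1) => [|j j1]; last by rewrite binz_small ?mulr0 ?scale0r.
rewrite big_ord1 expr0 binz0 mul1r scale1r expr0z scale1r !addr0 ?subr0 ?add0r => <-.
by apply: eq_bigr => j _; rewrite add0r.
Qed.

Lemma op_associator a v u (k : int) J :
  (forall j, (J <= j)%N -> I v (k + j%:Z) u = 0) ->
  (forall j, (J <= j)%N -> mmode a j%:Z u = 0) ->
  I (mmode a (-1) v) k u = \sum_(j < J)
    (mmode a (-1 - j%:Z) (I v (k + j%:Z) u) + I v (k - 1 - j%:Z) (mmode a j%:Z u)).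
Proof.
move=> vJ uJ; case: I_op => _ _ _ /(_ a v u 0 (-1) k).
rewrite (@fsbig_nat_trunc _ _ 1) => [|j j1]; last by rewrite binz_small ?scale0r.
rewrite big_ord1 binz0 scale1r addr0 add0r subr0 => ->.
rewrite (@fsbig_nat_trunc _ _ J) => [|j Jj]; last first.
  rewrite vJ// add0r uJ// (lin0 (mmode_linr _ _)) (lin0 (op_linr _ _)).
  by rewrite scaler0 subr0 scaler0.
apply: eq_bigr => j _.
rewrite binzN1 -exprMn mulrNN mulr1 expr1n scale1r !add0r exprN1 invrN1 scaleN1r opprK.
by congr (_ + I v _ _); lia.
Qed.

Lemma omega_degree n d v : gpiece (mgrading W) d v ->
  gpiecez (mgrading W) (d%:Z + 1 - n) (mmode om n v).
Proof.
move=> vd; have := mmode_degree n (omega_weight V) vd.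
by rewrite (_ : 2%:Z - n - 1 + d%:Z = d%:Z + 1 - n)//; lia.
Qed.

Lemma omega_degreeM n d u : gpiece (mgrading M) d u ->
  gpiecez (mgrading M) (d%:Z + 1 - n) (mmode om n u).
Proof.
move=> vd; have := mmode_degree n (omega_weight V) vd.
by rewrite (_ : 2%:Z - n - 1 + d%:Z = d%:Z + 1 - n)//; lia.
Qed.

Lemma omega_vanish d v j : gpiece (mgrading W) d v -> (d + 2 <= j)%N ->
  mmode om j%:Z v = 0.
Proof. by move=> vd dj; apply: (gpiecez_neg (omega_degree _ vd)); lia. Qed.

(** For e < 0 the component of u in degree m would have both eigenvalues hM + m and hM + e, hence
    vanishes. *)
Lemma eigen_gpiecez (e : int) u : virL 0 u = (hM + e%:~R) *: u ->
  gpiecez (mgrading M) e u.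
Proof.
move=> ue.
have wt n x : gpiece (mgrading M) n x -> virL 0 x = (hM + n%:R) *: x.
  by move=> xn; apply/(M_weight.2 n x).
case: e ue => n ue; first by apply/(M_weight.2 n u).
have [N uN] := gproj_finite (mgrading M) u.
rewrite /= (gproj_sum_trunc uN) big1// => m _.
have lg := gproj_linear (mgrading M) m.
have := congr1 (gproj (mgrading M) m) ue.
rewrite (linZ lg) {1}(gproj_sum_trunc uN) /virL (lin_sum (mmode_linr _ _)).
under eq_bigr => i _ do rewrite -/(virL 0 _) (wt _ _ (gproj_piece _ i u)).
rewrite (lin_sum lg) (bigD1 m)//= (linZ lg) (gproj_id _ (gproj_piece _ _ _)) eqxx.
rewrite big1 => [|i im]; last first.
  rewrite (linZ lg) (gproj_id _ (gproj_piece _ _ _)).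
  by rewrite (_ : (m == i :> nat) = false) ?scaler0//; apply/negbTE; rewrite eq_sym.
rewrite addr0 => /eqP; rewrite -subr_eq0 -scalerBl scaler_eq0 => /orP[|/eqP //].
rewrite opprD addrACA subrr add0r subr_eq0.
by rewrite -[m%:R]/((m%:Z)%:~R) eqr_int => /eqP.
Qed.

(** The commutator with L(0) involves only L(-1)v and L(0)v; the derivative property turns the first
    into a multiple of the same mode of v. So v_(k) u is an L(0)-eigenvector, and its eigenvalue
    determines its degree. *)
Lemma op_degree d n v u (k : int) : gpiece (mgrading W) d v -> gpiece (mgrading M) n u ->
  gpiecez (mgrading M) (d%:Z - k - 1 + n%:Z) (I v k u).
Proof.
move=> vd un; apply: eigen_gpiecez.
have E : mmode om 1 (I v k u) - I v k (mmode om 1 u) =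
    I (mmode om 0 v) (1 + k) u + I (mmode om 1 v) k u.
  rewrite (op_commutator u 1 k (fun j => omega_vanish (j := j) vd)).
  rewrite addn2 2!big_ord_recl big1 => [|i _]; last by rewrite binz_small ?scale0r.
  rewrite binz0 binz1 !scale1r !addr0; congr (_ + I _ _ _).
  by rewrite [1 + k]addrC; apply: addrK.
have wtM : mmode om 1 u = (hM + n%:R) *: u by apply/(M_weight.2 n u).
have wtW : mmode om 1 v = (hW + d%:R) *: v by apply/(W_weight.2 d v).
have Lm1 : I (mmode om 0 v) (1 + k) u = - ((1 + k)%:~R + hW) *: I v k u.
  by case: I_op => _ _ + _ => /(_ v (1 + k) u); rewrite /virL addNr (_ : 1 + k - 1 = k)//; lia.
move: E; rewrite Lm1 wtM wtW (linZ (op_linr _ _)) (linZ (op_linl _ _)).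
move=> /eqP; rewrite subr_eq => /eqP; rewrite /virL add0r => ->.
rewrite -!scalerDl; congr (_ *: _).
by rewrite !rmorphD !rmorphN /= -!pmulrn; ring.
Qed.

Lemma zero_mode_piece d v u : gpiece (mgrading W) d v ->
  zero_mode I v u = I v (d%:Z - 1) u.
Proof.
move=> vd; rewrite /zero_mode (@fsbig_nat_trunc _ _ d.+1) => [|j jd].
  rewrite big_ord_recr /= vd big1 ?add0r// => i _.
  by rewrite (gproj_id _ vd) ltn_eqF ?op0l.
by rewrite (gproj_id _ vd) gtn_eqF ?op0l.
Qed.

Lemma zero_mode_piecez (e : int) v u : gpiecez (mgrading W) e v ->
  zero_mode I v u = I v (e - 1) u.
Proof.
case: e => d /=; first exact: zero_mode_piece.
move=> ->; rewrite op0l (@zero_mode_piece 0) ?op0l//.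
by case: (gpiece_subspace (mgrading W) 0).
Qed.

Lemma zero_mode_trunc v u N : (forall n, (N <= n)%N -> gproj (mgrading W) n v = 0) ->
  zero_mode I v u = \sum_(n < N) I (gproj (mgrading W) n v) (n%:Z - 1) u.
Proof. by move=> vN; apply: fsbig_nat_trunc => j /vN ->; rewrite op0l. Qed.

Lemma zero_mode_linl u : linear (fun v => zero_mode I v u).
Proof.
move=> c v w; have [N1 E1] := gproj_finite (mgrading W) v.
have [N2 E2] := gproj_finite (mgrading W) w.
pose N := (N1 + N2)%N.
have F1 n : (N <= n)%N -> gproj (mgrading W) n v = 0 by move=> Nn; apply: E1; lia.
have F2 n : (N <= n)%N -> gproj (mgrading W) n w = 0 by move=> Nn; apply: E2; lia.
rewrite (zero_mode_trunc _ F1) (zero_mode_trunc _ F2) (@zero_mode_trunc _ _ N); last first.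
  by move=> n Nn; rewrite (gproj_linear _) F1// F2// scaler0 addr0.
rewrite scaler_sumr -big_split; apply: eq_bigr => n _ /=.
by rewrite (gproj_linear _) (op_linl _ _).
Qed.

Lemma zero_mode_linr v : linear (zero_mode I v).
Proof.
have [N vN] := gproj_finite (mgrading W) v.
move=> c x y; rewrite !(zero_mode_trunc _ vN) scaler_sumr -big_split.
by apply: eq_bigr => n _ /=; rewrite (op_linr _ _).
Qed.

Lemma zero_mode_degree n v u : gpiece (mgrading M) n u ->
  gpiece (mgrading M) n (zero_mode I v u).
Proof.
move=> un; have [N vN] := gproj_finite (mgrading W) v.
rewrite (zero_mode_trunc _ vN); apply: subspace_sum => [|d _].
  exact: gpiece_subspace.
have := op_degree (d%:Z - 1) (gproj_piece (mgrading W) d v) un.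
by move=> H; apply: gpiecez_nat H _; lia.
Qed.

Definition graded_trace N v : C := trace_on (gpiece (mgrading M) N) (zero_mode I v).

Lemma graded_trace_lin N : linear (graded_trace N : W -> C^o).
Proof.
move=> c v w; rewrite /graded_trace.
have -> : zero_mode I (c *: v + w) = (fun u => (fun u => c *: zero_mode I v u) u + zero_mode I w u).
  by apply/funext => u; rewrite (zero_mode_linl u).
have sp := gpiece_subspace (mgrading M) N.
have lc : linear (fun u => c *: zero_mode I v u).
  by move=> a x y; rewrite (zero_mode_linr v) scalerDr !scalerA mulrC.
rewrite trace_onD//.
- rewrite trace_on_scale//; first exact: zero_mode_linr.
  by move=> x; apply: zero_mode_degree.
- exact: zero_mode_linr.
- by move=> x xN; apply: subspaceZ => //; apply: zero_mode_degree.
- by move=> x; apply: zero_mode_degree.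
Qed.

Lemma graded_traceD N v w : graded_trace N (v + w) = graded_trace N v + graded_trace N w.
Proof. exact: (linD (graded_trace_lin N)). Qed.

Lemma graded_traceN N v : graded_trace N (- v) = - graded_trace N v.
Proof. exact: (linN (graded_trace_lin N)). Qed.

Lemma graded_traceZ N c v : graded_trace N (c *: v) = c * graded_trace N v.
Proof. exact: (linZ (graded_trace_lin N)). Qed.

Lemma graded_trace_sum N T (r : seq T) (P : pred T) (F : T -> W) :
  graded_trace N (\sum_(i <- r | P i) F i) = \sum_(i <- r | P i) graded_trace N (F i).
Proof. exact: (lin_sum (graded_trace_lin N)). Qed.

Definition omega_binom (m : int) (v : W) : W :=
  \sum_(j \in [set: nat]) binz (m + 1) j *: mmode om j%:Z v.

Lemma omega_binom_trunc m v J : (forall j, (J <= j)%N -> mmode om j%:Z v = 0) ->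
  omega_binom m v = \sum_(j < J) binz (m + 1) j *: mmode om j%:Z v.
Proof. by move=> vJ; apply: fsbig_nat_trunc => j /vJ ->; rewrite scaler0. Qed.

(* The commutator [[L(m), v_(deg v - 1 - m)]] is the zero mode of a vector that
   depends on [m] only, because all the modes involved preserve degrees. *)
Lemma virasoro_commutator d v u (m : int) : gpiece (mgrading W) d v ->
  mmode om (m + 1) (I v (d%:Z - 1 - m) u) - I v (d%:Z - 1 - m) (mmode om (m + 1) u)
  = zero_mode I (omega_binom m v) u.
Proof.
move=> vd; rewrite (op_commutator _ _ _ (fun j => omega_vanish (j := j) vd)).
rewrite (omega_binom_trunc _ (fun j => omega_vanish (j := j) vd)).
rewrite (lin_sum (zero_mode_linl u)); apply: eq_bigr => j _.
rewrite (linZ (zero_mode_linl u)) (zero_mode_piecez _ (omega_degree _ vd)).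
by congr (_ *: I _ _ _); lia.
Qed.

(** * Zhu's recursion for a homogeneous vector, with ordinary modes *)

Section Homogeneous.
Variables (d : nat) (v : W).
Hypothesis vd : gpiece (mgrading W) d v.

Local Notation MN N := (gpiece (mgrading M) N).
(** Indexed so that [J k] and [L k] both lower degrees by k. *)
Let J (k : int) (u : M) : M := I v (d%:Z - 1 + k) u.
Let L (m : int) (u : M) : M := mmode om (m + 1) u.

Let J_lin k : linear (J k). Proof. exact: op_linr. Qed.
Let L_lin m : linear (L m). Proof. exact: mmode_linr. Qed.

Let J_deg k n u : MN n u -> gpiecez (mgrading M) (n%:Z - k) (J k u).
Proof.
move=> un; have := op_degree (d%:Z - 1 + k) vd un.
by rewrite (_ : d%:Z - (d%:Z - 1 + k) - 1 + n%:Z = n%:Z - k)//; lia.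
Qed.

Let L_deg m n u : MN n u -> gpiecez (mgrading M) (n%:Z - m) (L m u).
Proof.
move=> un; have := omega_degreeM (m + 1) un.
by rewrite (_ : n%:Z + 1 - (m + 1) = n%:Z - m)//; lia.
Qed.

Let LJ (m : int) u : L m (J (- m) u) - J (- m) (L m u) = zero_mode I (omega_binom m v) u.
Proof. exact: virasoro_commutator. Qed.

(** [tp] and [tn] are the traces of the two kinds of terms in the normally ordered product of L and
    J: raising L to the left, lowering L to the right. *)
Let tp N (m : nat) := trace_on (MN N) (fun u => L (- m%:Z) (J m%:Z u)).
Let tn N (p : nat) := trace_on (MN N) (fun u => J (- p%:Z) (L p%:Z u)).

Let compJL k m : linear (fun u => J k (L m u)).
Proof. by move=> a x y; rewrite L_lin J_lin. Qed.
Let compLJ k m : linear (fun u => L k (J m u)).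
Proof. by move=> a x y; rewrite J_lin L_lin. Qed.

(** Since J_m maps M(N + m) to M(N) and L(-m) maps back, cyclicity moves the trace to M(N) with the
    factors exchanged; restoring their order costs the commutator. *)
Let tp_step N m : tp (N + m)%N m = tp N m - graded_trace N (omega_binom (- m%:Z) v).
Proof.
have down u : MN (N + m)%N u -> MN N (J m%:Z u).
  by move=> /(J_deg m%:Z) H; apply: gpiecez_nat H _; lia.
have up u : MN N u -> MN (N + m)%N (L (- m%:Z) u).
  by move=> /(L_deg (- m%:Z)) H; apply: gpiecez_nat H _; lia.
have upJ u : MN N u -> MN N (L (- m%:Z) (J m%:Z u)).
  move=> /(J_deg m%:Z) H; have [mN|Nm] := leqP m N; last first.
    rewrite (gpiecez_neg H); last by lia.
    rewrite (lin0 (L_lin _)).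
    by case: (gpiece_subspace (mgrading M) N).
  have {}H : MN (N - m)%N (J m%:Z u) by apply: gpiecez_nat H _; lia.
  by apply: gpiecez_nat (L_deg (- m%:Z) H) _; lia.
rewrite /tp (trace_on_cyclic (S' := MN N))//.
have -> : trace_on (MN N) (fun u => L (- m%:Z) (J m%:Z u)) =
   trace_on (MN N) (fun u => J m%:Z (L (- m%:Z) u) + zero_mode I (omega_binom (- m%:Z) v) u).
  apply: trace_on_eq => //.
    by move=> a x y; rewrite compJL (zero_mode_linr _) scalerDr addrACA.
  by move=> u _; rewrite -LJ opprK addrC subrK.
rewrite trace_onD//; first by rewrite addrK.
- exact: zero_mode_linr.
- by move=> x /up/down.
- by move=> x; apply: zero_mode_degree.
Qed.

Let tn_step N p : tn (N + p)%N p = tn N p + graded_trace N (omega_binom p%:Z v).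
Proof.
have down u : MN (N + p)%N u -> MN N (L p%:Z u).
  by move=> /(L_deg p%:Z) H; apply: gpiecez_nat H _; lia.
have up u : MN N u -> MN (N + p)%N (J (- p%:Z) u).
  by move=> /(J_deg (- p%:Z)) H; apply: gpiecez_nat H _; lia.
have upL u : MN N u -> MN N (J (- p%:Z) (L p%:Z u)).
  move=> /(L_deg p%:Z) H; have [mN|Nm] := leqP p N; last first.
    rewrite (gpiecez_neg H); last by lia.
    rewrite (lin0 (J_lin _)).
    by case: (gpiece_subspace (mgrading M) N).
  have {}H : MN (N - p)%N (L p%:Z u) by apply: gpiecez_nat H _; lia.
  by apply: gpiecez_nat (J_deg (- p%:Z) H) _; lia.
rewrite {1}/tn (trace_on_cyclic (S' := MN N))//.
have -> : trace_on (MN N) (fun u => L p%:Z (J (- p%:Z) u)) =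
   trace_on (MN N) (fun u => J (- p%:Z) (L p%:Z u) + zero_mode I (omega_binom p%:Z v) u).
  apply: trace_on_eq => //.
  - by move=> a x y; rewrite compJL (zero_mode_linr _) scalerDr addrACA.
  - by move=> x /up/down.
  - by move=> u _; rewrite -LJ addrC subrK.
rewrite trace_onD//.
- exact: zero_mode_linr.
- by move=> x; apply: zero_mode_degree.
Qed.

Let tp_small N m : (N < m)%N -> tp N m = 0.
Proof.
move=> Nm; apply: trace_on0 => // u /(J_deg m%:Z)/gpiecez_neg ->; last by lia.
exact/lin0/L_lin.
Qed.

Let tn_small N p : (N < p)%N -> tn N p = 0.
Proof.
move=> Np; apply: trace_on0 => // u /(L_deg p%:Z)/gpiecez_neg ->; last by lia.
exact/lin0/J_lin.
Qed.

(** Iterating the step from N down by m visits exactly the degrees l < N with m dividing N - l; the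
    start is zero because degrees below m are annihilated. Summation over m then produces sums over
    divisors. *)
Let step_solve (t : nat -> C) (X : W) m : (0 < m)%N ->
  (forall N, (N < m)%N -> t N = 0) ->
  (forall N, t (N + m)%N = t N + graded_trace N X) ->
  forall N, t N = \sum_(l < N | (m %| N - l)%N) graded_trace l X.
Proof.
move=> m0 t0 tS; elim/ltn_ind => N IHN.
have [Nm|mN] := ltnP N m.
  rewrite t0// big1// => l ml; have := dvdn_leq _ ml.
  have := ltn_ord l => lN; rewrite subn_gt0 lN => /(_ isT); lia.
rewrite -(subnK mN) tS IHN; last by lia.
rewrite (subnK mN); move: (N - m)%N (subnK mN) => K NE {IHN}.
have KN : (K < N)%N by lia.
rewrite -(big_mkord (fun l => m %| N - l)%N (fun l => graded_trace l X)).
rewrite (big_cat_nat (leq0n K) (ltnW KN)) /=; congr (_ + _).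
  rewrite big_mkord; apply: eq_bigl => l.
  rewrite -NE -addnBAC ?(ltnW (ltn_ord l))//.
  by rewrite dvdn_addl.
rewrite big_ltn_cond// -NE addKn dvdnn big_nat_cond big1 ?addr0// => l.
move=> /andP[/andP[Kl lN] ml].
have := dvdn_leq _ ml; rewrite subn_gt0 lN => /(_ isT); lia.
Qed.

(** Associativity expands the zero mode of omega_(-1) v into L(-j-2) J_(j+2) + J_(1-j) L(j-1). The
    term with j = 1 contributes the eigenvalue of L(0). The term J_1 L(-1) with j = 0 is reordered
    to L(-1) J_1, which completes the sum of the [tp] at the cost of the trace of omega_(0) v. *)
Let graded_trace_assoc N :
  graded_trace N (mmode om (-1) v) = (hM + N%:R) * graded_trace N v
   - graded_trace N (mmode om 0 v) + \sum_(m < N) (tp N m.+1 + tn N m.+1).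
Proof.
(* On M(N) the operator L(j-1) can be nonzero up to j = N + 1, hence N + 2 terms. *)
pose g (j : 'I_N.+2) u := L (- j.+2%:Z) (J j.+2%:Z u) + J (1 - j%:Z) (L (j%:Z - 1) u).
have J_z k u : MN N u -> N%:Z < k -> J k u = 0.
  by move=> uN Nk; apply: (gpiecez_neg (J_deg k uN)); lia.
have L_z k u : MN N u -> N%:Z < k -> L k u = 0.
  by move=> uN Nk; apply: (gpiecez_neg (L_deg k uN)); lia.
have LJ_deg m u : MN N u -> MN N (L (- m) (J m u)).
  move=> uN; have [mN|Nm] := lerP m N%:Z; last first.
    by rewrite J_z// (lin0 (L_lin _)); case: (gpiece_subspace (mgrading M) N).
  have H : MN `|N%:Z - m|%N (J m u) by apply: gpiecez_nat (J_deg m uN) _; lia.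
  by apply: gpiecez_nat (L_deg (- m) H) _; lia.
have JL_deg m u : MN N u -> MN N (J (- m) (L m u)).
  move=> uN; have [mN|Nm] := lerP m N%:Z; last first.
    by rewrite L_z// (lin0 (J_lin _)); case: (gpiece_subspace (mgrading M) N).
  have H : MN `|N%:Z - m|%N (L m u) by apply: gpiecez_nat (L_deg m uN) _; lia.
  by apply: gpiecez_nat (J_deg (- m) H) _; lia.
have JL_deg1 (j : nat) u : MN N u -> MN N (J (1 - j%:Z) (L (j%:Z - 1) u)).
  by move=> /(JL_deg (j%:Z - 1)); rewrite opprB.
have gl j : linear (g j).
  by move=> a x y; rewrite /g compLJ compJL scalerDr addrACA.
have gdeg j u : MN N u -> MN N (g j u).
  move=> uN; apply: subspaceD; first exact: gpiece_subspace.
    exact: LJ_deg.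
  exact: JL_deg1.
have -> : graded_trace N (mmode om (-1) v) =
    trace_on (MN N) (fun u => \sum_(j < N.+2) 1 *: g j u).
  apply: trace_on_eq => //.
  - exact: zero_mode_linr.
  - move=> a x y; rewrite scaler_sumr -big_split; apply: eq_bigr => j _.
    by rewrite !scale1r gl.
  - by move=> x; apply: zero_mode_degree.
  - move=> u uN; rewrite (zero_mode_piecez _ (omega_degree (-1) vd)).
    rewrite (@op_associator om v u _ N.+2).
    + apply: eq_bigr => j _; rewrite scale1r /g /J /L.
      congr (mmode _ _ (I _ _ _) + I _ _ (mmode _ _ _)); lia.
    + move=> j Nj; rewrite -[RHS](J_z (j%:Z + 2) u uN); last by lia.
      by rewrite /J; congr I; lia.
    + move=> j Nj; rewrite -[RHS](L_z (j%:Z - 1) u uN); last by lia.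
      by rewrite /L; congr mmode; lia.
rewrite trace_on_comb//.
under eq_bigr => j _ do rewrite mul1r.
have gE j : trace_on (MN N) (g j) = tp N j.+2 +
    trace_on (MN N) (fun u => J (1 - j%:Z) (L (j%:Z - 1) u)).
  rewrite trace_onD// => [x xN|x xN]; [exact: LJ_deg|exact: JL_deg1].
under eq_bigr => j _ do rewrite gE.
rewrite big_split /=.
have -> : \sum_(j < N.+2) tp N j.+2 = \sum_(m < N) tp N m.+1 - tp N 1.
  have N3 : (N < N.+3)%N by lia.
  rewrite big_ord_recr big_ord_recr /= (@tp_small N N.+2)// (tp_small N3) !addr0 {N3}.
  case: N {g J_z L_z LJ_deg JL_deg JL_deg1 gl gdeg gE} => [|N].
    by rewrite !big_ord0 tp_small// subr0.
  rewrite [in RHS]big_ord_recl [LHS]big_ord_recr /= (@tp_small N.+1 N.+2)// addr0.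
  by rewrite [RHS]addrAC subrr add0r.
rewrite 2!big_ord_recl /= big_split /=.
have -> : trace_on (MN N) (fun u => J (1 - 0%:Z) (L (0%:Z - 1) u)) =
   tp N 1 - graded_trace N (mmode om 0 v).
  have E0 : omega_binom (-1) v = mmode om 0 v.
    rewrite /omega_binom (@fsbig_nat_trunc _ _ 1) => [|j j1].
      by rewrite big_ord1 binz0 scale1r.
    by rewrite addNr binz_small ?scale0r.
  have -> : tp N 1 = trace_on (MN N) (fun u => J (1 - 0%:Z) (L (0%:Z - 1) u) +
      zero_mode I (mmode om 0 v) u).
    apply: trace_on_eq => //.
    - by move=> a x y; rewrite compJL (zero_mode_linr _) scalerDr addrACA.
    - by move=> x; apply: LJ_deg.
    - by move=> u _; rewrite -E0 -LJ opprK addrC subrK.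
  rewrite trace_onD//; first by rewrite addrK.
  - exact: zero_mode_linr.
  - by move=> x; apply: (JL_deg1 0%N).
  - by move=> x; apply: zero_mode_degree.
have -> : trace_on (MN N) (fun u => J (1 - 1%:Z) (L (1%:Z - 1) u)) =
   (hM + N%:R) * graded_trace N v.
  rewrite -trace_on_scale//; last 2 first.
  - exact: zero_mode_linr.
  - by move=> x; apply: zero_mode_degree.
  apply: trace_on_eq => //.
  - by move=> a x y; rewrite (zero_mode_linr _) scalerDr !scalerA mulrC.
  - exact: (JL_deg1 1%N).
  - move=> u uN; have -> : L (1%:Z - 1) u = (hM + N%:R) *: u by apply/(M_weight.2 N u).
    by rewrite (linZ (J_lin _)) (zero_mode_piece _ vd) /J subrr addr0.
have -> : \sum_(i < N) trace_on (MN N)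
     (fun u => J (1 - (bump 0 (bump 0 i))%:Z) (L ((bump 0 (bump 0 i))%:Z - 1) u))
   = \sum_(i < N) tn N i.+1.
  apply: eq_bigr => i _; congr trace_on; apply/funext => u.
  by congr (J _ (L _ u)); rewrite /bump /=; lia.
by ring.
Qed.

(** The term omega_(0) v is moved to the left because omega_(-1) + omega_(0) is the combination that
    [omega_expm1_modes] rewrites. On the right n = N - l, and m runs over its divisors. *)
Lemma graded_trace_recursion_piece N :
  graded_trace N (mmode om (-1) v + mmode om 0 v) = (hM + N%:R) * graded_trace N v
   + \sum_(1 <= n < N.+1) \sum_(1 <= m < n.+1 | (m %| n)%N)
      graded_trace (N - n)%N (omega_binom m%:Z v - omega_binom (- m%:Z) v).
Proof.
rewrite graded_traceD graded_trace_assoc.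
rewrite addrAC subrK; congr (_ + _).
pose X (m : nat) := omega_binom m%:Z v - omega_binom (- m%:Z) v.
have tE m : tp N m.+1 + tn N m.+1 =
    \sum_(l < N | (m.+1 %| N - l)%N) graded_trace l (X m.+1).
  rewrite (step_solve (t := tp^~ m.+1) (X := - omega_binom (- m.+1%:Z) v) (m := m.+1))//.
  - rewrite (step_solve (t := tn^~ m.+1) (X := omega_binom m.+1%:Z v) (m := m.+1))//.
    + rewrite -big_split; apply: eq_bigr => l _.
      by rewrite graded_traceD graded_traceN addrC.
    + by move=> K Km; apply: tn_small.
  - by move=> K Km; apply: tp_small.
  - by move=> K; rewrite tp_step graded_traceN.
under eq_bigr => m _ do rewrite tE big_mkcond.
rewrite exchange_big /= (reindex_inj rev_ord_inj) /= big_add1 big_mkord.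
apply: eq_bigr => i _.
rewrite big_add1 /= big_mkord (big_ord_widen_cond N (fun m => m.+1 %| i.+1)%N
  (fun m => graded_trace (N - i.+1)%N (X m.+1))) ?ltn_ord// [RHS]big_mkcond.
apply: eq_bigr => m _; rewrite subKn ?ltn_ord//.
case: ifPn => mi /=; last by [].
by rewrite (dvdn_leq _ mi).
Qed.

(** The zero mode in question is the commutator of L(0) with J_0, which vanishes on M(N), where L(0)
    is scalar and J_0 preserves the degree. *)
Lemma graded_trace_omega0 N : graded_trace N (omega_binom 0 v) = 0.
Proof.
apply: trace_on0 => // [|u uN]; first exact: zero_mode_linr.
rewrite -LJ oppr0.
have H : MN N (J 0 u) by apply: gpiecez_nat (J_deg 0 uN) _; lia.
have -> : L 0 (J 0 u) = (hM + N%:R) *: J 0 u by apply/(M_weight.2 N (J 0 u)).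
have -> : L 0 u = (hM + N%:R) *: u by apply/(M_weight.2 N u).
by rewrite (linZ (J_lin 0)) subrr.
Qed.

End Homogeneous.
End Intertwining.

(** * The recursion in square-bracket modes *)

Section TraceRecursion.
Variable R : realType.
Local Notation C := R[i].
Variables (V : VOA R) (W M : admissible_module V) (hW hM : C).
Variable I : W -> int -> M -> M.
Hypothesis W_weight : conformal_weight W hW.
Hypothesis M_weight : conformal_weight M hM.
Hypothesis I_op : intertwining_operator hW I.
Hypothesis M_basis : forall n, has_basis (gpiece (mgrading M) n).
Implicit Types (v : W).

Local Notation om := (omega V).
Local Notation T := (graded_trace I).

Lemma omega_binom_lin m : linear (omega_binom m : W -> W).
Proof.
move=> c v w.
have [N1 E1] := mmode_trunc_nat om 0 v; have [N2 E2] := mmode_trunc_nat om 0 w.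
pose N := (N1 + N2)%N.
have F1 j : (N <= j)%N -> mmode om j%:Z v = 0.
  by move=> Nj; rewrite -[j%:Z]add0r E1//; lia.
have F2 j : (N <= j)%N -> mmode om j%:Z w = 0.
  by move=> Nj; rewrite -[j%:Z]add0r E2//; lia.
rewrite (omega_binom_trunc _ F1) (omega_binom_trunc _ F2).
rewrite (@omega_binom_trunc _ _ _ _ _ N) => [|j Nj]; last first.
  by rewrite (mmode_linr _ _) F1// F2// scaler0 addr0.
rewrite scaler_sumr -big_split; apply: eq_bigr => j _ /=.
by rewrite (mmode_linr _ _) scalerDr !scalerA mulrC.
Qed.

Let by_pieces (Q : set W) : subspace Q ->
  (forall d v, gpiece (mgrading W) d v -> Q v) -> forall v, Q v.
Proof.
move=> sQ QP v; have [N vN] := gproj_finite (mgrading W) v.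
rewrite (gproj_sum_trunc vN); apply: subspace_sum => // i _.
exact/QP/gproj_piece.
Qed.

Let TD := graded_traceD W_weight M_weight I_op M_basis.
Let TZ := graded_traceZ W_weight M_weight I_op M_basis.
Let TN := graded_traceN W_weight M_weight I_op M_basis.
Let Tsum := graded_trace_sum W_weight M_weight I_op M_basis.

Let T0 N : T N 0 = 0.
Proof. by rewrite -(scale0r (0 : W)) TZ mul0r. Qed.

Let TB N x y : T N (x - y) = T N x - T N y.
Proof. by rewrite TD TN. Qed.

Lemma graded_trace_recursion v N :
  T N (mmode om (-1) v + mmode om 0 v) = (hM + N%:R) * T N v
   + \sum_(1 <= n < N.+1) \sum_(1 <= m < n.+1 | (m %| n)%N)
      T (N - n)%N (omega_binom m%:Z v - omega_binom (- m%:Z) v).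
Proof.
apply: (by_pieces (Q := [set v | T N (mmode om (-1) v + mmode om 0 v) = (hM + N%:R) * T N v
   + \sum_(1 <= n < N.+1) \sum_(1 <= m < n.+1 | (m %| n)%N)
      T (N - n)%N (omega_binom m%:Z v - omega_binom (- m%:Z) v)])); last first.
  by move=> d u ud; apply: (graded_trace_recursion_piece W_weight M_weight I_op M_basis ud).
have lin1 : linear (fun x : W => mmode om (-1) x + mmode om 0 x).
  by move=> a x y; rewrite !(mmode_linr _ _) scalerDr addrACA.
have lin2 m : linear (fun x : W => omega_binom m%:Z x - omega_binom (- m%:Z) x).
  by move=> a x y; rewrite !(omega_binom_lin _) scalerBr opprD addrACA.
split=> /= [|a x y xE yE].
  rewrite (lin0 lin1) !T0 mulr0 add0r big1// => n _; rewrite big1// => m _.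
  by rewrite (lin0 (lin2 m)) T0.
have -> : mmode om (-1) (a *: x + y) + mmode om 0 (a *: x + y) =
    a *: (mmode om (-1) x + mmode om 0 x) + (mmode om (-1) y + mmode om 0 y).
  exact: lin1.
rewrite TD TZ xE yE TD TZ !mulrDr mulrCA addrACA; congr (_ + _).
rewrite mulr_sumr -big_split; apply: eq_bigr => n _ /=.
rewrite mulr_sumr -big_split; apply: eq_bigr => m _ /=.
by rewrite -TZ -TD; congr (T _ _); rewrite -(lin2 m).
Qed.

Lemma graded_trace_sq_omega0 v N : T N (sqmode om 0 v) = 0.
Proof.
have H : T N (omega_binom 0 v) = 0.
  apply: (by_pieces (Q := [set v | T N (omega_binom 0 v) = 0])); last first.
    by move=> d u ud; apply: (graded_trace_omega0 W_weight M_weight I_op M_basis ud).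
  split=> /= [|a x y xE yE]; first by rewrite (lin0 (omega_binom_lin 0)) T0.
  by rewrite (omega_binom_lin 0) TD TZ xE yE mulr0 addr0.
have [S vS] := mmode_trunc_nat om 0 v.
have vS1 j : (S.+1 <= j)%N -> mmode om j%:Z v = 0.
  by move=> Sj; rewrite -[j%:Z]add0r vS// ltnW.
move: H; rewrite (omega_binom_trunc _ vS1) (omega_zexp_modes _ vS1).
rewrite big_ord_recl expr0 fact0 divr1 scale1r big1 => [|i _].
  by rewrite addr0 TZ => /eqP; rewrite mulf_eq0 (negbTE (twopii_neq0 R)) => /eqP.
by rewrite mulr0 expr0n /= mul0r scale0r.
Qed.

Let oddmode v (k : nat) := sqmode om k.*2.+1%:Z v.

(** The difference of the kernels for m and -m is twice a hyperbolic sine: only the odd modes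
    omega[2k+1] remain, with powers m^(2k+1) that add up to sigma_(2k+1) over divisors. *)
Let omega_binomB v m K : (forall j, (K.*2 <= j)%N -> mmode om j%:Z v = 0) ->
  omega_binom m%:Z v - omega_binom (- m%:Z) v =
  \sum_(k < K) (2 * twopii ^+ k.+1.*2 / k.*2.+1`!%:R * m%:R ^+ k.*2.+1) *: oddmode v k.
Proof.
move=> vK; rewrite !(omega_binom_trunc _ vK) !(omega_zexp_modes _ vK).
rewrite -scalerBr -sumrB.
rewrite (big_ord_double K (fun r => ((twopii * (m%:Z)%:~R) ^+ r / r`!%:R) *: sqmode om r%:Z v
  - ((twopii * (- m%:Z)%:~R) ^+ r / r`!%:R) *: sqmode om r%:Z v)).
rewrite scaler_sumr; apply: eq_bigr => k _.
have -> : twopii * (- m%:Z)%:~R = - (twopii * (m%:Z)%:~R) :> C by rewrite mulrNz mulrN.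
have sgn (y : C) : (- y) ^+ k.*2 = y ^+ k.*2.
  by rewrite exprNn -signr_odd odd_double expr0 mul1r.
have sgn1 (y : C) : (- y) ^+ k.*2.+1 = - y ^+ k.*2.+1.
  by rewrite exprSr sgn mulrN -exprSr.
rewrite sgn sgn1 subrr add0r mulNr scaleNr opprK -scalerDl scalerA.
congr (_ *: _); rewrite -[(m%:Z)%:~R]/(m%:R) exprMn.
rewrite doubleS (exprS twopii k.*2.+1).
move: (twopii ^+ k.*2.+1) (m%:R ^+ k.*2.+1) (k.*2.+1`!%:R^-1) => x y z.
by ring.
Qed.

(** The even coefficients of x/(e^x - 1) beyond degree 0 give the constant terms 2 zeta(2k+2) and
    the divisor sums give the higher ones, so each odd mode is convolved with a full Eisenstein
    series. The linear coefficient goes with omega[0] v, whose trace is zero; the other odd ones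
    vanish. *)
Lemma graded_trace_sq_omega v K : (forall j, (K.*2 <= j)%N -> mmode om j%:Z v = 0) ->
  forall N, T N (sqmode om (-1) v) = (hM + N%:R) * T N v +
    \sum_(k < K) (eisenstein_fps R k.+1 * (fun n => T n (oddmode v k))) N.
Proof.
move=> vK N.
have vS j : (K.+1.*2 <= j)%N -> mmode om (j%:Z - 1) v = 0.
  by move=> Kj; rewrite (_ : j%:Z - 1 = j.-1%:Z) ?vK//; lia.
have E : T N (mmode om (-1) v + mmode om 0 v) = T N (sqmode om (-1) v)
    + \sum_(k < K) (- 2 * zeta k.+1.*2) * T N (oddmode v k).
  rewrite (omega_expm1_modes vS (isT : (2 <= K.+1.*2)%N)).
  rewrite (big_ord_double K.+1 (fun r =>
    (expm1_pow R (-1) r * twopii ^+ r) *: sqmode om (r%:Z - 1) v)).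
  rewrite big_ord_recl /= expm1_pow_head mul1r expr0 scale1r sub0r subrr.
  rewrite TD TD (TZ N (expm1_pow R (-1) _ * _)) graded_trace_sq_omega0 mulr0 addr0 Tsum.
  congr (_ + _).
  apply: eq_bigr => k _; rewrite /bump leq0n add1n.
  have -> : expm1_pow R (-1) k.+1.*2.+1 = 0 by exact: expm1_powN1_odd.
  rewrite mul0r scale0r addr0 (TZ N (expm1_pow R (-1) _ * _)).
  by rewrite [_ * twopii ^+ _]mulrC expm1_powN1_even.
have rec := graded_trace_recursion v N; rewrite E in rec.
have -> : T N (sqmode om (-1) v) = (hM + N%:R) * T N v
   + (\sum_(1 <= n < N.+1) \sum_(1 <= m < n.+1 | (m %| n)%N)
      T (N - n)%N (omega_binom m%:Z v - omega_binom (- m%:Z) v)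
   - \sum_(k < K) (- 2 * zeta k.+1.*2) * T N (oddmode v k)).
  by rewrite addrA -rec addrK.
congr (_ + _).
have -> : \sum_(1 <= n < N.+1) \sum_(1 <= m < n.+1 | (m %| n)%N)
      T (N - n)%N (omega_binom m%:Z v - omega_binom (- m%:Z) v) =
  \sum_(k < K) \sum_(i < N) eisenstein_fps R k.+1 i.+1 * T (N - i.+1)%N (oddmode v k).
  rewrite big_add1 big_mkord [RHS]exchange_big /=; apply: eq_bigr => i _.
  under eq_bigr => m _ do rewrite (omega_binomB m vK) Tsum.
  rewrite exchange_big /=; apply: eq_bigr => k _.
  under eq_bigr => m _ do rewrite TZ.
  rewrite -mulr_suml -mulr_sumr /eisenstein_fps /= mul2n.
  rewrite (_ : (k.+1.*2 - 1)%N = k.*2.+1)//.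
  congr (_ * _ * _); rewrite sigmaE// natr_sum.
  by apply: eq_bigr => m _; rewrite natrX.
rewrite -sumrB; apply: eq_bigr => k _.
rewrite fpsM big_ord_recl subn0 mulNr mulNr opprK addrC.
by congr (_ + _); rewrite /eisenstein_fps /= mul2n.
Qed.

(* The connection form of [nabla] read off on the coefficients of the trace
   function: this is Zhu's recursion for [omega]. *)
Lemma graded_trace_sqL v K : (forall j, (K.*2 <= j)%N -> mmode om j%:Z v = 0) ->
  forall N, T N (sqL (-2) v) =
    twopii ^+ 2 * ((N%:R + (hM - central_charge V / 24%:R)) * T N v) +
    \sum_(k < K) (eisenstein_fps R k.+1 * (fun n => T n (sqL ((2 * k.+1)%N%:Z - 2) v))) N.
Proof.
move=> vK N.
rewrite sqL_omega// eqxx TZ TB (TZ N (central_charge V / _)).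
rewrite [sqmode om _ v](_ : _ = sqmode om (-1) v)//.
rewrite (graded_trace_sq_omega vK) addrAC -mulrBl mulrDr.
congr (_ * (_ * _) + _); first by ring.
rewrite mulr_sumr; apply: eq_bigr => k _.
rewrite !fpsM mulr_sumr; apply: eq_bigr => i _.
have -> : sqL ((2 * k.+1)%N%:Z - 2) v = twopii ^+ 2 *: oddmode v k.
  rewrite sqL_omega; last by lia.
  rewrite ifF; last by apply/eqP; lia.
  rewrite subr0; congr (_ *: sqmode _ _ _); lia.
by rewrite /= (TZ _ (twopii ^+ 2) (oddmode v k)) [RHS]mulrCA.
Qed.

End TraceRecursion.

(** * Flatness of trace functions *)

Section Flatness.
Variable R : realType.
Local Notation C := R[i].
Variables (V : VOA R) (W M : admissible_module V) (hW hM : C).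
Variable I : W -> int -> M -> M.
Hypothesis W_weight : conformal_weight W hW.
Hypothesis M_weight : conformal_weight M hM.
Hypothesis I_op : intertwining_operator hW I.
Hypothesis M_basis : forall n, has_basis (gpiece (mgrading M) n).
Hypothesis I_cvg : forall tau v, cvgn (series (trace_term hM I tau v)).
Implicit Types (v : W) (tau : upper R).

Let s : C := hM - central_charge V / 24%:R.
Let Tf v : fps C := fun n => graded_trace I n v.

Lemma trace_termE tau v :
  trace_term hM I tau v = (fun n => Tf v n * qpow tau (n%:R + s)).
Proof. by apply/funext => n; rewrite /trace_term /s addrA. Qed.

Let rad1_Tf v : rad1 (Tf v).
Proof. by apply: (@cvg_rad1 _ _ s) => tau; rewrite -trace_termE. Qed.

Let trace_functionE tau v : trace_function hM I tau v = qpow tau s * psum (Tf v) (nome tau).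
Proof. by rewrite /trace_function trace_termE qseries_lim. Qed.

Let trace_function_lin tau : linear (trace_function hM I tau : W -> C^o).
Proof.
move=> a x y; rewrite !trace_functionE.
have -> : Tf (a *: x + y) = fpsC a * Tf x + Tf y.
  apply: fps_ext => n; rewrite fpsD fpsCM /Tf.
  by rewrite (graded_traceD W_weight M_weight I_op M_basis)
    (graded_traceZ W_weight M_weight I_op M_basis).
have q1 := cabs_nome_lt1 tau.
rewrite psumD ?psumZ//; last exact: rad1C.
by rewrite mulrDr mulrCA.
Qed.

Lemma sqL_trunc v : exists K, forall k, (K < k)%N ->
  sqL ((2 * k)%N%:Z - 2) v = 0 :> W /\ forall j, (K.*2 <= j)%N -> mmode (omega V) j%:Z v = 0.
Proof.
have [N1 E1] := sqmode_trunc_nat (omega V) 0 v.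
have [N2 E2] := mmode_trunc_nat (omega V) 0 v.
exists (N1 + N2)%N => k Kk; split.
  rewrite sqL_omega; last by lia.
  rewrite ifF; last by apply/eqP; lia.
  rewrite (_ : _ + 1 = 0 + (2 * k - 1)%N%:Z); last by lia.
  by rewrite E1 ?subr0 ?scaler0//; lia.
by move=> j Kj; rewrite -[j%:Z]add0r E2//; lia.
Qed.

(** The Eisenstein terms of [graded_trace_sqL] are those subtracted in [connection_op]. What remains
    is s plus the Euler operator on coefficients, that is q d/dq. *)
Let trace_function_connection tau v :
  trace_function hM I tau (connection_op tau v) =
  qpow tau s * psum (fpsC s * Tf v + fps_theta (Tf v)) (nome tau).
Proof.
have [K KP] := sqL_trunc v.
have vK j : (K.*2 <= j)%N -> mmode (omega V) j%:Z v = 0 by have [_] := KP K.+1 (ltnSn K); apply.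
have q1 := cabs_nome_lt1 tau.
have lF := trace_function_lin tau.
rewrite /connection_op (@fsbig_pos_trunc _ _ K) => [|k /KP[-> _]]; last by rewrite scaler0.
rewrite (linZ lF) (linB lF) (lin_sum lF).
under eq_bigr => k _ do rewrite (linZ lF) trace_functionE eisensteinE.
rewrite trace_functionE.
have -> : Tf (sqL (-2) v) = fpsC (twopii ^+ 2) * (fpsC s * Tf v + fps_theta (Tf v))
    + \sum_(k < K) eisenstein_fps R k.+1 * Tf (sqL ((2 * k.+1)%N%:Z - 2) v).
  apply: fps_ext => n; rewrite fpsD fpsCM fpsD fpsCM /fps_theta fps_sum.
  rewrite /Tf (graded_trace_sqL W_weight M_weight I_op M_basis vK).
  by congr (_ * _ + _); rewrite -/s mulrDl addrC.
have rsum r (F : nat -> fps C) : (forall k, rad1 (F k)) -> rad1 (\sum_(k <- r) F k) /\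
    psum (\sum_(k <- r) F k) (nome tau) = \sum_(k <- r) psum (F k) (nome tau).
  move=> rF; elim: r => [|k r [IH1 IH2]].
    rewrite !big_nil; split; first exact: rad1_0.
    rewrite (_ : 0 = fpsC 0) ?psum_fpsC//.
    by apply: fps_ext => -[|n].
  rewrite !big_cons; split; first exact: rad1D.
  by rewrite psumD// IH2.
pose F k := eisenstein_fps R k.+1 * Tf (sqL ((2 * k.+1)%N%:Z - 2) v).
have rF k : rad1 (F k) by apply: rad1M => //; exact: rad1_eisenstein.
have [r1 r2] := rsum (index_iota 0 K) F rF.
have ra : rad1 (fpsC s * Tf v + fps_theta (Tf v)).
  by apply: rad1D; [exact: rad1C|exact: rad1_theta].
rewrite -(big_mkord xpredT F) psumD//; last exact: rad1C.
rewrite psumZ// r2 big_mkord.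
have -> : \sum_(k < K) psum (F k) (nome tau) = \sum_(k < K)
    psum (eisenstein_fps R k.+1) (nome tau) * psum (Tf (sqL ((2 * k.+1)%N%:Z - 2) v)) (nome tau).
  by apply: eq_bigr => k _; rewrite psumM//; exact: rad1_eisenstein.
set A := psum (_ + _) _; set S := \sum_(k < K) _ * _; set q := qpow _ _.
transitivity (twopii ^- 2 * (q * (twopii ^+ 2 * A + S) - \sum_(k < K)
   psum (eisenstein_fps R k.+1) (nome tau) *
   (q * psum (Tf (sqL ((2 * k.+1)%N%:Z - 2) v)) (nome tau)))) => //.
have -> : \sum_(k < K) psum (eisenstein_fps R k.+1) (nome tau) *
    (q * psum (Tf (sqL ((2 * k.+1)%N%:Z - 2) v)) (nome tau)) = q * S.
  by rewrite mulr_sumr; apply: eq_bigr => k _; rewrite mulrCA.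
have := twopii_neq0 R; move: twopii q A S => t q A S t0.
by field.
Qed.

Lemma trace_function_parallel (eta : R -> upper R) t (l : C) v :
  curve_derivative (fun u => val (eta u)) t l ->
  curve_derivative (fun u => trace_function hM I (eta u) v) t
    (twopii * l * trace_function hM I (eta t) (connection_op (eta t) v)).
Proof.
move=> de; rewrite trace_function_connection.
rewrite (_ : (fun u => _) = (fun u => qpow (eta u) s * psum (Tf v) (nome (eta u)))).
  exact: qseries_curve.
by apply/funext => u; rewrite trace_functionE.
Qed.

End Flatness.

(** * Uniqueness of parallel transport *)

Section FiniteGeneration.
Variable R : realType.
Local Notation C := R[i].
Variables (V : VOA R) (W : admissible_module V).
Implicit Types (tau : upper R) (psi : W -> C) (v : W).

(** Eisenstein series satisfy this bound. A path on the compact [0, 1] stays in one such half plane,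
    so boundedness is the only regularity of coefficients that the uniqueness argument has to
    track. *)
Definition bounded_on_half_planes (f : upper R -> C) : Prop :=
  forall y : R, 0 < y -> exists B, forall tau, y <= complex.Im (val tau) -> cabs (f tau) <= B.

(** The coefficients are chosen before [tau] and [psi]: the same relation holds for all conformal
    blocks, hence for both parallel sections to be compared. [F] may depend on tau to include the
    connection form. *)
Definition generated d (u : 'I_d -> W) (F : upper R -> (W -> C) -> C) : Prop :=
  exists f : 'I_d -> upper R -> C, (forall i, bounded_on_half_planes (f i)) /\
    forall tau psi, conformal_block tau psi -> F tau psi = \sum_i f i tau * psi (u i).

Lemma bounded_on_half_planesC (c : C) : bounded_on_half_planes (fun=> c).
Proof. by move=> y y0; exists (cabs c). Qed.

Lemma bounded_on_half_planesD f g : bounded_on_half_planes f -> bounded_on_half_planes g ->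
  bounded_on_half_planes (fun tau => f tau + g tau).
Proof.
move=> bf bg y y0; have [A fA] := bf y y0; have [B gB] := bg y y0.
by exists (A + B) => tau yt; apply: le_trans (cabsD _ _) (lerD (fA _ yt) (gB _ yt)).
Qed.

Lemma bounded_on_half_planesM f g : bounded_on_half_planes f -> bounded_on_half_planes g ->
  bounded_on_half_planes (fun tau => f tau * g tau).
Proof.
move=> bf bg y y0; have [A fA] := bf y y0; have [B gB] := bg y y0.
by exists (A * B) => tau yt; rewrite cabsM ler_pM ?cabs_ge0 ?fA ?gB.
Qed.

Lemma conformal_block_lin tau psi : conformal_block tau psi -> linear (psi : W -> C^o).
Proof. by move=> [H _ _] a x y; rewrite H. Qed.

Lemma conformal_block_expand (a : V) w : exists K, forall tau psi,
  conformal_block tau psi -> psi (sqmode a (-2) w) =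
   \sum_(k < K) (- (2 * k.+1 - 1)%N%:R * eisenstein k.+1 tau) * psi (sqmode a (2 * k)%N%:Z w).
Proof.
have [K aK] := sqmode_trunc_nat a 0 w; exists K => tau psi cb.
have lpsi := conformal_block_lin cb.
case: cb => _ _ /(_ a w 2%N isT).
rewrite (@fsbig_pos_trunc _ _ K) => [|k Kk]; last first.
  rewrite (_ : (2 * k)%N%:Z - 2%:Z = 0 + (2 * k - 2)%N%:Z); last by lia.
  by rewrite aK ?scaler0//; lia.
rewrite -signr_odd expr0 scale1r (linD lpsi) (lin_sum lpsi) => /eqP.
rewrite addr_eq0 => /eqP ->; rewrite -sumrN; apply: eq_bigr => k _.
rewrite (linZ lpsi) bin1 -scaleNr mulNr.
congr (- (_ * _) * psi (sqmode _ _ _)).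
by lia.
Qed.

Section Generators.
Variables (d : nat) (u : 'I_d -> W).

Lemma generated_ext F G : (forall tau psi, conformal_block tau psi -> F tau psi = G tau psi) ->
  generated u F -> generated u G.
Proof.
by move=> FG [f [fb fE]]; exists f; split=> // tau psi cb; rewrite -FG// fE.
Qed.

Lemma generated_mem i : generated u (fun _ psi => psi (u i)).
Proof.
exists (fun j _ => (j == i)%:R); split=> [j|tau psi cb].
  exact: bounded_on_half_planesC.
rewrite (bigD1 i)//= eqxx mul1r big1 ?addr0// => j /negbTE ->.
by rewrite mul0r.
Qed.

Lemma generated0 : generated u (fun _ _ => 0).
Proof.
exists (fun _ _ => 0); split=> [i|tau psi cb]; first exact: bounded_on_half_planesC.
by rewrite big1// => i _; rewrite mul0r.
Qed.

Lemma generatedM g F : bounded_on_half_planes g -> generated u F ->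
  generated u (fun tau psi => g tau * F tau psi).
Proof.
move=> bg [f [fb fE]]; exists (fun i tau => g tau * f i tau); split=> [i|tau psi cb].
  exact: bounded_on_half_planesM.
by rewrite fE// mulr_sumr; apply: eq_bigr => i _; rewrite mulrA.
Qed.

Lemma generatedD F G : generated u F -> generated u G ->
  generated u (fun tau psi => F tau psi + G tau psi).
Proof.
move=> [f [fb fE]] [g [gb gE]]; exists (fun i tau => f i tau + g i tau).
split=> [i|tau psi cb]; first exact: bounded_on_half_planesD.
by rewrite fE// gE// -big_split; apply: eq_bigr => i _; rewrite mulrDl.
Qed.

Lemma generated_sum n (F : 'I_n -> upper R -> (W -> C) -> C) :
  (forall k, generated u (F k)) -> generated u (fun tau psi => \sum_k F k tau psi).
Proof.
move=> FG; elim: (index_enum _) => [|k r IHr].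
  by apply: generated_ext generated0 => tau psi _; rewrite big_nil.
apply: generated_ext (generatedD (FG k) IHr) => tau psi _.
by rewrite big_cons.
Qed.

Definition generated_vector : set W := [set v | generated u (fun _ psi => psi v)].

Lemma generated_vector_subspace : subspace generated_vector.
Proof.
split=> [|a x y gx gy].
  apply: generated_ext generated0 => tau psi /conformal_block_lin lpsi.
  by rewrite (lin0 lpsi).
apply: generated_ext (generatedD (generatedM (bounded_on_half_planesC a) gx) gy).
by move=> tau psi [H _ _]; rewrite H.
Qed.

End Generators.

(* Modulo the conformal block relations [a_(-2) w] equals a combination of
   vectors of smaller degree with coefficients in Eisenstein series, so that a
   complement of [C_2(W)] spans all conformal blocks by induction on degrees. *)
Lemma conformal_block_generated : vir_C2_complement W ->
  exists d (u : 'I_d -> W), forall v, generated u (fun _ psi => psi v).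
Proof.
move=> [U [sU [s UE] gU _ [decU _]]].
exists (size s), (fun i => s`_i); set u := fun i : 'I__ => _.
have sQ := generated_vector_subspace u.
suff piece n v : gpiece (mgrading W) n v -> generated_vector u v.
  move=> v; have [N vN] := gproj_finite (mgrading W) v.
  rewrite (gproj_sum_trunc vN); apply: (subspace_sum (S := generated_vector u)) => // i _.
  exact/piece/gproj_piece.
elim/ltn_ind: n v => n IHn.
have low (e : int) v : gpiecez (mgrading W) e v -> e < n%:Z -> generated_vector u v.
  case: e => e /= ev en; first by apply: (IHn e).
  by rewrite ev; case: sQ.
apply: (C2_piece gU decU sQ).
  move=> x Ux _; move: x Ux; rewrite UE; apply: span_min => // x /= xs.
  have ix : (index x s < size s)%N by rewrite index_mem.
  have := generated_mem u (Ordinal ix).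
  by rewrite /u /= nth_index.
move=> k l a w ak wl kln.
have deg m : gpiecez (mgrading W) (n%:Z - 2 - m) (mmode a m w).
  have := mmode_degree m ak wl.
  by rewrite (_ : k%:Z - m - 1 + l%:Z = n%:Z - 2 - m)//; lia.
have tr m := mmode_trunc_nat a m w.
have sqlow (m : nat) : generated_vector u (sqmode a m%:Z w).
  have [J aJ] := tr m%:Z.
  rewrite (sqmode_piece ak aJ); apply: (subspaceZ (S := generated_vector u)) => //.
  apply: (subspace_sum (S := generated_vector u)) => // j _.
  apply: (subspaceZ (S := generated_vector u)) => //.
  by apply: low (deg _) _; lia.
have sq2 : generated u (fun _ psi => psi (sqmode a (-2) w)).
  have [K aK] := conformal_block_expand a w.
  apply: (@generated_ext _ _ (fun tau psi => \sum_(j < K)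
    (- (2 * j.+1 - 1)%N%:R * eisenstein j.+1 tau) * psi (sqmode a (2 * j)%N%:Z w))).
    by move=> tau psi cb; rewrite (aK tau psi cb).
  apply: generated_sum => j; apply: generatedM; last exact: sqlow.
  apply: bounded_on_half_planesM; first exact: bounded_on_half_planesC.
  by move=> y y0; apply: eisenstein_bounded.
(* The vector a[-2] w is 2 pi i a_(-2) w plus a combination of modes a_(m) w with m > -2, of degree
   below n; the relation is solved for a_(-2) w. *)
have [J aJ] := tr (-2).
have aJ1 j : (J.+1 <= j)%N -> mmode a (-2 + j%:Z) w = 0.
  by move=> Jj; apply: aJ; rewrite ltnW.
have := sqmode_piece ak aJ1; rewrite big_ord_recl /= [-2 + 0%Z]addr0.
have -> : laurent_coef (- (-2) - 0%Z - 1) k 0 = 1 :> C.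
  by rewrite laurent_coefE fpsM0 expm1_pow_head /fps_exp expr0 fact0 divr1 mulr1.
rewrite scale1r; set S := \sum_(_ < J) _; set c := twopii ^ _ => E.
have c0 : c != 0 by rewrite expfz_neq0// twopii_neq0.
have -> : mmode a (-2) w = c^-1 *: sqmode a (-2) w + (-1) *: S.
  by rewrite E scalerA mulVf// scale1r scaleN1r addrK.
apply: (subspaceD (S := generated_vector u)) => //.
  exact: (subspaceZ (S := generated_vector u)).
apply: (subspaceZ (S := generated_vector u)) => //.
apply: (subspace_sum (S := generated_vector u)) => // j _.
apply: (subspaceZ (S := generated_vector u)) => //.
by apply: low (deg _) _; rewrite /bump /=; lia.
Qed.

End FiniteGeneration.

(** * Gronwall's inequality and linear systems along a path *)

Section Uniqueness.
Variable R : realType.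
Local Notation C := R[i].

Lemma gronwall_zero (E dE : R -> R) (c : R) :
  (forall t : R, is_derive t (1 : R) E (dE t)) -> (forall t, 0 <= t <= 1 -> dE t <= c * E t) ->
  (forall t, 0 <= E t) -> E 0 = 0 -> E 1 = 0.
Proof.
move=> dEE bE E0 Ez.
pose g t := E t * expR (- c * t).
have dg (t : R) : is_derive t (1 : R) g (E t * (- c * expR (- c * t)) + expR (- c * t) * dE t).
  apply: (is_derive1M (dEE t)).
  have dl : is_derive t (1 : R) (fun u => - c * u) (- c).
    have d1 : is_derive t (1 : R) (fun=> - c) 0 by exact: is_derive_cst.
    have d2 : is_derive t (1 : R) (fun u : R => u) 1 by exact: is_derive_id.
    by apply: is_derive_eq (is_derive1M d1 d2) _; rewrite mulr0 addr0 mulr1.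
  apply: is_derive_eq (is_derive1_comp (is_derive_expR (- c * t)) dl) _.
  by rewrite mulrC.
have cg : {within `[0, 1], continuous g}.
  by apply: derivable_within_continuous => t _; case: (dg t).
have [t t01 gE] := MVT ltr01 (fun t _ => dg t) cg.
apply/eqP; rewrite eq_le E0 andbT.
have : g 1 <= 0.
  move: gE; rewrite {2}/g Ez mul0r !subr0 mulr1 => ->.
  have -> : E t * (- c * expR (- c * t)) + expR (- c * t) * dE t =
    (dE t - c * E t) * expR (- c * t) by ring.
  rewrite mulr_le0_ge0 ?expR_ge0// subr_le0 bE//.
  by move: t01; rewrite in_itv/= => /andP[? ?]; rewrite !ltW.
by rewrite /g pmulr_lle0// expR_gt0.
Qed.

(** For the sum E of the |delta_i|^2, the Cauchy inequality gives E' <= 2 B (sum of |delta_i|)^2 <=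
    2 B d E on [0, 1], which explains the Gronwall constant. *)
Lemma linear_system_zero d (delta ddelta : 'I_d -> R -> C) (B : R) : 0 <= B ->
  (forall i t, curve_derivative (delta i) t (ddelta i t)) ->
  (forall i t, 0 <= t <= 1 -> cabs (ddelta i t) <= B * \sum_j cabs (delta j t)) ->
  (forall i, delta i 0 = 0) -> forall i, delta i 1 = 0.
Proof.
move=> B0 dd bd d0.
pose E t := \sum_i cabs (delta i t) ^+ 2.
pose dE t := \sum_i (2 * (complex.Re (delta i t) * complex.Re (ddelta i t)
  + complex.Im (delta i t) * complex.Im (ddelta i t))).
have dEE (t : R) : is_derive t (1 : R) E (dE t).
  rewrite (_ : E = \sum_i (fun t => cabs (delta i t) ^+ 2)); last first.
    by apply/funext => u; rewrite /E fct_sumE.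
  apply: is_derive_sum => i.
  have [d1 d2] := dd i t.
  rewrite (_ : (fun u => _) = (fun u => complex.Re (delta i u)  * complex.Re (delta i u)) +
    (fun u => complex.Im (delta i u)  * complex.Im (delta i u))); last first.
    by apply/funext => u; rewrite cabs_sqr !expr2.
  apply: is_derive_eq (is_deriveD (is_derive1M d1 d1) (is_derive1M d2 d2)) _.
  by ring.
have E0 t : 0 <= E t by apply: sumr_ge0 => i _; rewrite exprn_ge0// cabs_ge0.
have Ez : E 0 = 0 by rewrite /E big1// => i _; rewrite d0 cabs0 expr0n.
have cs (a b : C) : complex.Re a * complex.Re b + complex.Im a * complex.Im b <= cabs a * cabs b.
  have Ei : complex.Re a * complex.Re b + complex.Im a * complex.Im b
      = complex.Re (a * b^*%C).
    by case: a b => [? ?] [? ?] /=; rewrite mulrN opprK.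
  have cJ : cabs b^*%C = cabs b by apply: (@complexI R); rewrite !cabsE normcJ.
  by rewrite Ei -cJ -cabsM (le_trans (ler_norm _))// Re_le_cabs.
have E1 : E 1 = 0.
  apply: (@gronwall_zero E dE (2 * B * d%:R)) => // t t01.
  have sq : (\sum_i cabs (delta i t)) ^+ 2 <= d%:R * E t.
    rewrite expr2 mulr_suml.
    apply: (@le_trans _ _ (\sum_i \sum_j (cabs (delta i t) ^+ 2 + cabs (delta j t) ^+ 2) / 2)).
      apply: ler_sum => i _; rewrite mulr_sumr; apply: ler_sum => j _.
      rewrite ler_pdivlMr// -subr_ge0.
      rewrite (_ : _ - _ = (cabs (delta i t) - cabs (delta j t)) ^+ 2) ?sqr_ge0//.
      by ring.
    rewrite le_eqVlt; apply/orP; left; apply/eqP.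
    under eq_bigr => i _ do rewrite -mulr_suml big_split /= sumr_const card_ord.
    rewrite -mulr_suml big_split /= sumr_const card_ord -/(E t) sumrMnl -/(E t).
    by rewrite -mulr_natl; field.
  apply: (@le_trans _ _ (\sum_i 2 * (cabs (delta i t) * (B * \sum_j cabs (delta j t))))).
    apply: ler_sum => i _; rewrite ler_pM2l//; apply: le_trans (cs _ _) _.
    by rewrite ler_wpM2l ?cabs_ge0 ?bd.
  rewrite -mulr_sumr -mulr_suml -mulrA.
  move: sq; set S := \sum_i _ => sq.
  have -> : 2 * (S * (B * S)) = 2 * B * S ^+ 2 by ring.
  by rewrite ler_wpM2l// mulr_ge0.
move=> i; apply: cabs_eq0; apply/eqP; rewrite -sqrf_eq0.
have := E1; rewrite /E => /eqP; rewrite psumr_eq0 => [|j _].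
  by move=> /allP/(_ i (mem_index_enum _)).
by rewrite exprn_ge0// cabs_ge0.
Qed.

Variables (V : VOA R) (W : admissible_module V).

Lemma connection_generated d (u : 'I_d -> W) :
  (forall v, generated u (fun _ psi => psi v)) ->
  forall v, generated u (fun tau psi => psi (connection_op tau v)).
Proof.
move=> gu v; have [K KP] := sqL_trunc v.
apply: (@generated_ext _ _ _ _ _ (fun tau psi => twopii ^- 2 * (psi (sqL (-2) v)
  + (-1) * \sum_(k < K) eisenstein k.+1 tau * psi (sqL ((2 * k.+1)%N%:Z - 2) v)))).
  move=> tau psi /conformal_block_lin lpsi.
  rewrite /connection_op (@fsbig_pos_trunc _ _ K) => [|k /KP[-> _]]; last by rewrite scaler0.
  rewrite (linZ lpsi (twopii ^- 2)) (linB lpsi (sqL (-2) v)) (lin_sum lpsi) mulN1r.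
  congr (_ * (_ - _)); apply: eq_bigr => k _.
  by rewrite (linZ lpsi (eisenstein k.+1 tau)).
apply: generatedM; first exact: bounded_on_half_planesC.
apply: generatedD => //.
apply: generatedM; first exact: bounded_on_half_planesC.
apply: generated_sum => k; apply: generatedM => //.
by move=> y y0; apply: eisenstein_bounded.
Qed.

Lemma curve_bounds (eta : R -> upper R) (deta : R -> C) : C1_path eta deta ->
  exists y B, [/\ 0 < y, forall t, 0 <= t <= 1 -> y <= complex.Im (val (eta t))
    & forall t, 0 <= t <= 1 -> cabs (deta t) <= B].
Proof.
move=> [de cde].
have [|t0 _ mint] := @EVT_min R (fun t => complex.Im (val (eta t))) 0 1 ler01.
  by apply: derivable_within_continuous => t _; have [_ []] := de t.
have [|t1 _ maxt] := @EVT_max R (fun t => cabs (deta t)) 0 1 ler01.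
  apply: continuous_subspaceT => t; apply/cvgrPdist_lt => e e0.
  have := cde t => /cvgrPdist_lt /(_ e%:C); rewrite ltcR => /(_ e0).
  apply: filterS => u; rewrite -cabsE ltcR; apply: le_lt_trans.
  rewrite ler_norml; apply/andP; split.
    have := cabsD (deta u - deta t) (deta t); rewrite subrK -[cabs (_ - _)]cabsN opprB.
    by rewrite -lerBlDr => h; rewrite -lerN2 opprK opprB.
  by rewrite lerBlDr -{1}[deta t](subrK (deta u)) cabsD.
exists (complex.Im (val (eta t0))), (cabs (deta t1)); split.
- exact: (valP (eta t0)).
- by move=> t t01; apply: mint; rewrite in_itv.
- by move=> t t01; apply: maxt; rewrite in_itv.
Qed.

Lemma parallel_unique (eta : R -> upper R) (deta : R -> C) (s1 s2 : R -> W -> C) :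
  vir_C2_complement W -> C1_path eta deta ->
  parallel_along eta deta s1 -> parallel_along eta deta s2 ->
  s1 0 = s2 0 -> s1 1 = s2 1.
Proof.
move=> cW ceta [cb1 d1] [cb2 d2] s0.
have [d [u gu]] := conformal_block_generated cW.
have [y [B [y0 yb dB]]] := curve_bounds ceta.
pose delta i t := s1 t (u i) - s2 t (u i).
have dd i t : curve_derivative (delta i) t
   (twopii * deta t * (s1 t (connection_op (eta t) (u i)) - s2 t (connection_op (eta t) (u i)))).
  apply: curve_derivative_eq.
    apply: curve_derivativeD; first exact: d1.
    rewrite (_ : (fun t => - s2 t (u i)) = (fun t => (-1) * s2 t (u i))); last first.
      by apply/funext => x; rewrite mulN1r.
    exact: curve_derivativeZ (d2 _ _).
  by ring.
pose Q i (f : 'I_d -> upper R -> C) := (forall j, bounded_on_half_planes (f j)) /\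
    forall tau psi, conformal_block tau psi ->
     psi (connection_op tau (u i)) = \sum_j f j tau * psi (u j).
have [f fP] : {f : 'I_d -> 'I_d -> upper R -> C & forall i, Q i (f i)}.
  by apply: choice => i; apply: (connection_generated gu).
pose P (ij : 'I_d * 'I_d) (b : R) := forall tau : upper R,
  y <= complex.Im (val tau) -> cabs (f ij.1 ij.2 tau) <= b.
have [b bP] : {b : 'I_d * 'I_d -> R & forall ij, P ij (b ij)}.
  by apply: choice => -[i j]; have [+ _] := fP i => /(_ j y y0).
(* Here B bounds the speed of the path and the sum over all pairs dominates each coefficient bound,
   so one constant serves every equation of the system. *)
pose L := cabs twopii * B * \sum_ij `|b ij|.
have Bge : 0 <= B by apply: le_trans (cabs_ge0 _) (dB 0 _); rewrite lexx ler01.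
have L0 : 0 <= L by rewrite !mulr_ge0 ?cabs_ge0// sumr_ge0.
have z := linear_system_zero L0 dd _ _.
have delta1 i : delta i 1 = 0.
  apply: z => [{}i t t01|{}i]; last by rewrite /delta s0 subrr.
  rewrite !cabsM /L -!mulrA ler_wpM2l ?cabs_ge0//.
  apply: ler_pM; rewrite ?cabs_ge0 ?dB//.
  have [_ fE] := fP i; rewrite !fE// -sumrB mulr_sumr.
  apply: le_trans (cabs_sum _ _) _; apply: ler_sum => j _.
  rewrite -mulrBr cabsM ler_wpM2r ?cabs_ge0//.
  apply: le_trans (bP (i, j) _ (yb _ t01)) _; apply: le_trans (ler_norm _) _.
  by rewrite (bigD1 (i, j))//= lerDl sumr_ge0.
apply/funext => v; apply/eqP; rewrite -subr_eq0; apply/eqP.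
have [g [_ gE]] := gu v.
rewrite (gE _ _ (cb1 1)) (gE _ _ (cb2 1)) -sumrB big1// => i _.
by rewrite -mulrBr -/(delta i 1) delta1 mulr0.
Qed.

End Uniqueness.

(** * Comparison of the two representations *)

Lemma trace_space_parallel (R : realType) (V : VOA R)
  (V_complements : forall M : admissible_module V,
     irreducible M -> vir_C2_complement M)
  (W : admissible_module V) (hW : int) (W_weight : conformal_weight W hW%:~R)
  (tau : upper R) (rho : SL2Z_rep (fiber W tau))
  (rhoP : is_trace_representation hW rho)
  (eta : R -> upper R) (deta : R -> R[i]) (phi : upper R -> W -> R[i]) :
  C1_path eta deta -> trace_space hW phi ->
  parallel_along eta deta (fun t => phi (eta t)).
Proof.
have [I_cvg phi_hol _ _ _] := rhoP.
move=> [de _] phiT; split=> [t|]; first by have [+ _] := phi_hol _ phiT; apply.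
(* The transport equation is linear in [phi], so it suffices to check it on the trace functions that
   span the space. *)
pose Q := [set phi : upper R -> W -> R[i] | forall t v,
  curve_derivative (fun u => phi (eta u) v) t
    (twopii * deta t * phi (eta t) (connection_op (eta t) v))].
move: phi phiT; apply: (span_min (T := Q)).
  split=> [t v|a phi psi Qphi Qpsi t v].
    by apply: curve_derivative_eq (curve_derivative_cst t 0) _; rewrite mulr0.
  apply: curve_derivative_eq (curve_derivativeD (curve_derivativeZ a (Qphi t v)) (Qpsi t v)) _.
  rewrite mulrCA -mulrDr; congr (_ * _).
move=> _ [M [hM [I [M_irr M_weight I_op ->]]]] t v.
apply: (trace_function_parallel W_weight M_weight I_op) => //.
  by move=> n; apply/mpiece_basis/V_complements.
by move=> tau' w; apply: I_cvg.
Qed.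

Theorem proposition7p24 (R : realType) (V : VOA R)
  (V_strongly_rational : strongly_rational V)
  (V_complements : forall M : admissible_module V,
     irreducible M -> vir_C2_complement M)
  (W : admissible_module V) (W_irreducible : irreducible W)
  (hW : int) (W_weight : conformal_weight W hW%:~R)
  (tau : upper R)
  (rho_trace : SL2Z_rep (fiber W tau))
  (rho_traceP : is_trace_representation hW rho_trace) :
  exists rho_mon : SL2Z_rep (fiber W tau),
    is_monodromy_representation rho_mon /\
    equivalent_rep rho_mon rho_trace.
Proof.
exists rho_trace; split; last first.
  by exists idfun; split=> //; exists idfun.
move=> gamma eta deta ceta eta0 eta1 psi.
have [_ _ _ [_ ev_surj] rhoE] := rho_traceP.
have [phi phiT phiE] := ev_surj psi.
have par := trace_space_parallel V_complements W_weight rho_traceP ceta phiT.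
split=> [|s spar s0]; first by exists (fun t => phi (eta t)); rewrite eta0.
have -> : s 1 = phi (eta 1).
  apply: (parallel_unique (V_complements W W_irreducible) ceta spar par).
  by rewrite s0 eta0.
(* The action of gamma^(-1) is [slash gamma], whose value at tau is by definition
   [equivariance gamma tau] applied to phi(gamma tau). *)
by rewrite (rhoE _ phi)// /sl2_action invgK eta1.
Qed.
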